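(* Every balanced configuration $\mathcal{C}\subseteq\mathbb{R}^2$ satisfying the minimal distance property is group-balanced.
   Context: A configuration is a set of points $\mathcal{C}\subseteq\mathbb{R}^2$. It is balanced if for every $P\in\mathcal{C}$ and every distance $d$, the points $P_1,\dots,P_m\in\mathcal{C}$ at distance exactly $d$ from $P$ satisfy $\overrightarrow{PP_1}+\dots+\overrightarrow{PP_m}=\vec{0}$ (the empty sum being $\vec 0$). A configuration $\mathcal{C}$ has the minimal distance property if there is some $d>0$ such that any two distinct points $x,y\in\mathcal{C}$ are at distance at least $d$, and some pair of points $x,y\in\mathcal{C}$ is at distance exactly $d$. A configuration $\mathcal{C}\subseteq\mathbb{R}^2$ is group-balanced if for every $P\in\mathcal{C}$ there is a symmetry of $\mathcal{C}$ (an isometry of $\mathbb{R}^2$ mapping $\mathcal{C}$ onto itself) that fixes no point of $\mathbb{R}^2$ except $P$ (and does fix $P$). *)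

(* Defs.v *)
From mathcomp Require Import all_boot all_order all_algebra.
From mathcomp Require Import boolp classical_sets functions cardinality fsbigop.
From mathcomp Require Import reals.

Set Implicit Arguments.
Unset Strict Implicit.
Unset Printing Implicit Defensive.

Import Order.TTheory GRing.Theory Num.Theory.

Local Open Scope classical_set_scope.
Local Open Scope ring_scope.

Section Configurations.
Context {R : realType}.
Implicit Types (x y P : 'rV[R]_2) (C : set 'rV[R]_2).

(* The norm that MathComp-Analysis puts on ['rV[R]_2] is the sup norm, so the
   Euclidean distance is defined here. *)
Definition dist x y : R := Num.sqrt (\sum_(i < 2) (y 0 i - x 0 i) ^+ 2).

Definition at_distance C P (d : R) : set 'rV[R]_2 :=
  [set Q | C Q /\ dist P Q = d].

(* Listing the points at distance [d] as P_1, ..., P_m presupposes that there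
   are finitely many of them.  This has to be required explicitly, because
   [\sum_(Q \in A) F Q] is 0 by convention when [F] has infinite support
   on [A]. *)
Definition balanced C : Prop :=
  forall P, C P -> forall d : R,
    finite_set (at_distance C P d) /\
    \sum_(Q \in at_distance C P d) (Q - P) = 0.

Definition minimal_distance_property C : Prop :=
  exists d : R, [/\ 0 < d,
    forall x y, C x -> C y -> x <> y -> d <= dist x y &
    exists x y, [/\ C x, C y & dist x y = d]].

Definition plane_isometry (f : 'rV[R]_2 -> 'rV[R]_2) : Prop :=
  bijective f /\ forall x y, dist (f x) (f y) = dist x y.

Definition configuration_symmetry C (f : 'rV[R]_2 -> 'rV[R]_2) : Prop :=
  plane_isometry f /\ f @` C = C.

Definition group_balanced C : Prop :=
  forall P, C P ->
    exists f, configuration_symmetry C f /\ forall Q, f Q = Q <-> Q = P.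

End Configurations.

(* Main.v *)
(** Scale the minimal distance to 1.  Around a point with a neighbour at distance 1, separation
    and balance leave three possibilities for the unit circle: it is antipodal, a regular
    triangle, or five points, and the last one is incompatible with the balance of the
    neighbours.

    If some unit circle is a triangle, either all neighbours of its centre have triangles too, or
    they all have degree two and the points behind them have triangles again.  So the configuration
    contains a honeycomb, respectively a honeycomb with its edges halved, and it is the honeycomb,
    respectively the halved honeycomb with none or all of the hexagon centres.  All of these have
    a rotation by 120, 180 or 60 degrees about each point.

    Otherwise every unit step can be repeated, and the configuration contains a full line of
    unit steps.  Let [F] be the set of the points whose images under the half turns about the line
    points do not all belong to the configuration; it is balanced at all line points.  The
    rightmost point of [F] among those nearest to a line point reflects in it and in its
    neighbours to such points again, so that its whole orbit lies in the configuration; hence [F]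
    is empty.  A similar study of the points nearest to a point [P] of the first row above the
    line yields the half turn about [P], and the half turns found so far generate those about all
    remaining points. *)

Require Import Defs.
From mathcomp Require Import all_boot all_order all_algebra.
From mathcomp Require Import boolp classical_sets functions cardinality fsbigop.
From mathcomp Require Import reals.
From mathcomp Require Import zify ring lra.

Set Implicit Arguments.
Unset Strict Implicit.
Unset Printing Implicit Defensive.
Import Order.TTheory GRing.Theory Num.Theory.
Local Open Scope ring_scope.

(** * Frames and shells *)

Section Frames.
Variable R : realType.
Implicit Types (F D : R -> R -> Prop) (x y a b u v r : R) (s t : seq (R * R)).

(** Balance is far weaker than symmetry, since the vectors to a circle may cancel without any
    pairing. It becomes rigid once few points fit on the circle: three vectors of equal length with
    sum zero form a regular triangle and four form a rhombus. So the recurrent task is to confine a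
    circle to an arc that is too narrow for many points. In the basic window around a vertical axis
    only three points above against three below can then fail to be antipodal, and this pattern is
    settled by the balance of an adjacent centre. Passing from local to global symmetry uses minimal
    counterexamples. If a part of the configuration is invariant under a rotation about a centre,
    its sum on each circle around that centre is fixed by the rotation and vanishes; removing the
    part therefore preserves balance there. The violators of a symmetry thus form a balanced set,
    and being nearest to a centre is what confines them to a window. Five neighbours fail because
    the points 2 p0 - p4 and 2 p1 - p2, obtained by reflecting neighbours in neighbours, would be
    distinct but less than 1 apart. *)

Definition separated F := forall x y x' y', F x y -> F x' y' ->
  (x - x') ^+ 2 + (y - y') ^+ 2 < 1 -> x = x' /\ y = y'.

(** [r] is the squared radius, which keeps all circle equations polynomial. *)
Definition shell F r s := uniq s /\
  forall p : R * R, p \in s <-> F p.1 p.2 /\ p.1 ^+ 2 + p.2 ^+ 2 = r.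

(** Balance about the origin, which need not belong to [F]: the notion is also applied to subsets of
    a configuration, around centres that have been removed from them. *)
Definition balanced0 F := forall r, exists s, [/\ shell F r s,
  \sum_(p <- s) p.1 = 0 & \sum_(p <- s) p.2 = 0].

Definition shift a b F := fun x y => F (a + x) (b + y).
(** The set in coordinates whose first axis is the unit vector [(u, v)]. *)
Definition turn u v F := fun x y => F (u * x - v * y) (v * x + u * y).

Definition good D := separated D /\ forall a b, D a b -> balanced0 (shift a b D).

Lemma shell_ext F F' r s : (forall x y, F x y <-> F' x y) -> shell F r s -> shell F' r s.
Proof. by move=> FF' [us hs]; split=> // p; rewrite hs FF'. Qed.

Lemma balanced0_ext F F' : (forall x y, F x y <-> F' x y) -> balanced0 F -> balanced0 F'.
Proof.
move=> FF' bF r; have [s [hs s1 s2]] := bF r; exists s; split=> //.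
exact: shell_ext FF' hs.
Qed.

Lemma pair_eqP (p q : R * R) : p = q <-> p.1 = q.1 /\ p.2 = q.2.
Proof. by case: p q => [a b] [c d] /=; split=> [[-> ->]|[-> ->]]. Qed.

Lemma balanced0_turn F u v : u ^+ 2 + v ^+ 2 = 1 -> balanced0 F -> balanced0 (turn u v F).
Proof.
move=> uv bF r; have [s [[us hs] s1 s2]] := bF r.
pose g (p : R * R) := (u * p.1 + v * p.2, u * p.2 - v * p.1).
pose g' (p : R * R) := (u * p.1 - v * p.2, v * p.1 + u * p.2).
have gK : cancel g g'.
  move=> [a b]; rewrite /g /g' /=; congr pair; [have := congr1 (fun z => z * a) uv|have := congr1 (fun z => z * b) uv]; rewrite /=; nra.
have g'K : cancel g' g.
  move=> [a b]; rewrite /g /g' /=; congr pair; [have := congr1 (fun z => z * a) uv|have := congr1 (fun z => z * b) uv]; rewrite /=; nra.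
exists (map g s); split.
- split; first by rewrite map_inj_uniq //; exact: can_inj gK.
  move=> [a b] /=; rewrite /turn -[(a, b)]g'K mem_map; last exact: can_inj gK.
  rewrite hs /g' /=.
  suff -> : (u * a - v * b) ^+ 2 + (v * a + u * b) ^+ 2 = (u ^+ 2 + v ^+ 2) * (a ^+ 2 + b ^+ 2) by rewrite uv mul1r.
  by ring.
- by rewrite big_map /g /= big_split /= -!mulr_sumr s1 s2 !mulr0 addr0.
- by rewrite big_map /g /= sumrB -!mulr_sumr s1 s2 !mulr0 subr0.
Qed.

Lemma separated_shift F a b : separated F -> separated (shift a b F).
Proof.
move=> sF x y x' y' f f' l; have [] := sF _ _ _ _ f f'; first by move: l; nra.
by move=> /addrI -> /addrI ->.
Qed.

Lemma unit_sq_inj u v x y : u ^+ 2 + v ^+ 2 = 1 -> u * x - v * y = 0 -> v * x + u * y = 0 ->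
  x = 0 /\ y = 0.
Proof.
move=> uv e1 e2; split.
  have -> : x = (u ^+ 2 + v ^+ 2) * x by rewrite uv mul1r.
  have -> : (u ^+ 2 + v ^+ 2) * x = u * (u * x - v * y) + v * (v * x + u * y) by ring.
  by rewrite e1 e2 !mulr0 addr0.
have -> : y = (u ^+ 2 + v ^+ 2) * y by rewrite uv mul1r.
have -> : (u ^+ 2 + v ^+ 2) * y = u * (v * x + u * y) - v * (u * x - v * y) by ring.
by rewrite e1 e2 !mulr0 subr0.
Qed.

Lemma separated_turn F u v : u ^+ 2 + v ^+ 2 = 1 -> separated F -> separated (turn u v F).
Proof.
move=> uv sF x y x' y' f f' l; have [] := sF _ _ _ _ f f'.
  suff -> : (u * x - v * y - (u * x' - v * y')) ^+ 2 + (v * x + u * y - (v * x' + u * y')) ^+ 2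
    = (u ^+ 2 + v ^+ 2) * ((x - x') ^+ 2 + (y - y') ^+ 2) by rewrite uv mul1r.
  by ring.
move=> e1 e2; have [] := @unit_sq_inj u v (x - x') (y - y') uv; [lra|lra|].
by move=> /subr0_eq -> /subr0_eq ->.
Qed.

Lemma good_shift D a b : good D -> good (shift a b D).
Proof.
move=> [sD bD]; split; first exact: separated_shift.
move=> c d Dcd; apply: balanced0_ext (bD _ _ Dcd) => x y.
by rewrite /shift !addrA.
Qed.

Lemma good_turn D u v : u ^+ 2 + v ^+ 2 = 1 -> good D -> good (turn u v D).
Proof.
move=> uv [sD bD]; split; first exact: separated_turn.
move=> c d Dcd; apply: balanced0_ext (balanced0_turn uv (bD _ _ Dcd)) => x y.
rewrite /shift /turn.
suff [-> ->] : u * (c + x) - v * (d + y) = u * c - v * d + (u * x - v * y) /\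
  v * (c + x) + u * (d + y) = v * c + u * d + (v * x + u * y) by [].
by split; ring.
Qed.

Definition mirror F := fun x y => F x (- y).

Lemma separated_mirror F : separated F -> separated (mirror F).
Proof.
move=> sF x y x' y' f f' l; have [] := sF _ _ _ _ f f'; first by move: l; nra.
by move=> -> /oppr_inj ->.
Qed.

Lemma balanced0_mirror F : balanced0 F -> balanced0 (mirror F).
Proof.
move=> bF r; have [s [[us hs] s1 s2]] := bF r.
pose g (p : R * R) := (p.1, - p.2).
have gK : involutive g by move=> [a b]; rewrite /g /= opprK.
exists (map g s); split.
- split; first by rewrite map_inj_uniq //; exact: can_inj gK.
  move=> p; rewrite -[p in p \in _]gK mem_map; last exact: can_inj gK.
  by rewrite hs /mirror /g /= sqrrN.
- by rewrite big_map.
- by rewrite big_map /g /= sumrN s2 oppr0.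
Qed.

Lemma good_mirror D : good D -> good (mirror D).
Proof.
move=> [sD bD]; split; first exact: separated_mirror.
move=> c d Dcd; apply: balanced0_ext (balanced0_mirror (bD _ _ Dcd)) => x y.
by rewrite /shift /mirror opprD.
Qed.

(** A vanishing sum with a positive term has a negative one. This is how balance about one centre
    produces a point that is nearer to another centre. *)
Lemma balanced_opposite F c d x y : balanced0 F -> F x y -> 0 < c * x + d * y ->
  exists x' y', [/\ F x' y', x' ^+ 2 + y' ^+ 2 = x ^+ 2 + y ^+ 2 & c * x' + d * y' < 0].
Proof.
move=> bF Fxy pos; have [s [[us hs] s1 s2]] := bF (x ^+ 2 + y ^+ 2).
have xs : (x, y) \in s by apply/hs.
have [/hasP[[x' y'] /hs[/= F' n'] neg]|/hasPn h] := boolP (has (fun p => c * p.1 + d * p.2 < 0) s).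
  by exists x', y'.
have : \sum_(p <- s) (c * p.1 + d * p.2) = 0 by rewrite big_split /= -!mulr_sumr s1 s2 !mulr0 addr0.
rewrite (big_rem _ xs) /= => e.
have : 0 <= \sum_(p <- rem (x, y) s) (c * p.1 + d * p.2).
  by rewrite big_seq; apply: sumr_ge0 => p /mem_rem ps; rewrite leNgt; exact: h.
by move: e pos; lra.
Qed.

Lemma upper_list s r : uniq s ->
  (forall p, p \in s -> p.1 ^+ 2 + p.2 ^+ 2 = r /\ 0 < p.2) ->
  exists t, perm_eq s t /\ sorted <%R (map fst t).
Proof.
move=> us hs; exists (sort (fun p q : R * R => p.1 <= q.1) s).
set t := sort _ _.
have st : perm_eq s t by rewrite perm_sym perm_sort.
split=> //; rewrite lt_sorted_uniq_le; apply/andP; split.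
  rewrite map_inj_in_uniq ?sort_uniq // => -[a b] [c d]; rewrite -!(perm_mem st) => /hs /= [n p] /hs /= [n' p'] e.
  congr pair => //; rewrite e in n.
  have /eqP : (b - d) * (b + d) = 0 by move: n n'; nra.
  by rewrite mulf_eq0 => /orP[/eqP|/eqP]; lra.
rewrite sorted_map.
have := @sort_sorted _ (fun p q : R * R => p.1 <= q.1).
by apply=> p q; exact: le_total.
Qed.
End Frames.

(** * Balanced circles in a narrow window *)

Section Shells.
Variable R : realType.
Implicit Types (F D : R -> R -> Prop) (x y a b u v r : R) (s t : seq (R * R)).

Definition upper F r t := sorted <%R (map fst t) /\
  forall x y, (x, y) \in t <-> [/\ F x y, x ^+ 2 + y ^+ 2 = r & 0 < y].

(* The points below the axis are listed through their mirror images. *)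
Lemma balanced_split F r : balanced0 F -> exists t t' z,
  [/\ upper F r t, upper (mirror F) r t',
      forall x, x \in z <-> F x 0 /\ x ^+ 2 = r,
      \sum_(p <- t) p.1 + \sum_(p <- t') p.1 + \sum_(x <- z) x = 0 &
      \sum_(p <- t) p.2 = \sum_(p <- t') p.2] /\ uniq z.
Proof.
move=> bF; have [s [[us hs] s1 s2]] := bF r.
pose up (p : R * R) := 0 < p.2; pose dn (p : R * R) := p.2 < 0; pose ax (p : R * R) := p.2 == 0.
have [|t [st so]] := @upper_list _ (filter up s) r (filter_uniq _ us).
  by move=> p; rewrite mem_filter => /andP[? /hs []].
pose g (p : R * R) := (p.1, - p.2).
have gK : involutive g by move=> [a b]; rewrite /g /= opprK.
have [||t' [st' so']] := @upper_list _ (map g (filter dn s)) r.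
- by rewrite map_inj_uniq ?filter_uniq //; exact: can_inj gK.
- move=> p; rewrite -[p in p \in _]gK mem_map; last exact: can_inj gK.
  rewrite mem_filter => /andP[]; rewrite /dn /= oppr_lt0 => ? /hs [] /= _.
  by rewrite sqrrN.
have part f : \sum_(p <- s) f p = \sum_(p <- filter up s) f p + \sum_(p <- filter dn s) f p
     + \sum_(p <- filter ax s) f p :> R.
  elim: (s) => [|p l IH]; first by rewrite !big_nil !addr0.
  rewrite /= /up /dn /ax big_cons IH; case: ltrgt0P => _; rewrite ?big_cons; ring.
exists t, t', (map fst (filter ax s)); split; last first.
  rewrite map_inj_in_uniq ?filter_uniq // => -[a b] [c d].
  by rewrite !mem_filter /ax /= => /andP[/eqP-> _] /andP[/eqP-> _] ->.
split.
- split=> // x y; rewrite -(perm_mem st) mem_filter /up /=; split.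
    by case/andP=> ? /hs[].
  by case=> f n p; rewrite p; apply/hs.
- split=> // x y; rewrite -(perm_mem st') -[(x, y)]gK mem_map; last exact: can_inj gK.
  rewrite mem_filter /dn /= oppr_lt0 /mirror; split.
    by case/andP=> ? /hs[] /=; rewrite sqrrN.
  by case=> f n p; rewrite p; apply/hs; rewrite sqrrN.
- move=> x; split.
    by case/mapP=> -[a b]; rewrite mem_filter /ax /= => /andP[/eqP -> /hs[]] /= f n ->; split=> //; rewrite -n; ring.
  case=> f n; apply/mapP; exists (x, 0) => //; rewrite mem_filter /ax eqxx /=; apply/hs => /=; split=> //.
  by rewrite -n; ring.
- rewrite -(perm_big _ st) -(perm_big _ st') !big_map /=.
  by have := s1; rewrite part.
- rewrite -(perm_big _ st) -(perm_big _ st') big_map /= sumrN.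
  have := s2; rewrite part [X in _ + _ + X]big1_seq; last by move=> p; rewrite /= mem_filter => /andP[/eqP].
  by rewrite addr0 => /eqP; rewrite addr_eq0 => /eqP.
Qed.

(** Four vectors of equal length with sum zero form a rhombus and cancel in opposite pairs. The
    ordinates of [c] and [d] are mirrored, and the signs of [a2] and [b2] forbid pairing [a] with
    [b]. *)
Lemma four_balanced (a1 a2 b1 b2 c1 c2 d1 d2 r : R) : 0 < r ->
  a1 ^+ 2 + a2 ^+ 2 = r -> b1 ^+ 2 + b2 ^+ 2 = r -> c1 ^+ 2 + c2 ^+ 2 = r -> d1 ^+ 2 + d2 ^+ 2 = r ->
  0 < a2 -> 0 <= b2 -> a1 + b1 + c1 + d1 = 0 -> a2 + b2 = c2 + d2 ->
  (c1 = - a1 /\ c2 = a2 /\ d1 = - b1 /\ d2 = b2) \/ (c1 = - b1 /\ c2 = b2 /\ d1 = - a1 /\ d2 = a2).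
Proof.
move=> r0 ha hb hc hd pa pb e1 e2.
have D1 : d1 = - (a1 + b1 + c1) by lra.
have D2 : d2 = a2 + b2 - c2 by lra.
have e : (a1 + b1) * (a1 + c1) + (a2 + b2) * (a2 - c2) = a1 ^+2 + a2^+2 - (c1^+2+c2^+2) by move: hd; rewrite D1 D2; nra.
have e' : (a1 + b1) * (b1 + c1) + (a2 + b2) * (b2 - c2) = 0 by move: hd; rewrite D1 D2; nra.
rewrite ha hc subrr in e.
(* both a + c and b + c are orthogonal to a + b <> 0, so they are parallel; their difference a - b too *)
have k : (a1 + c1) * (b1 + c1) + (a2 - c2) * (b2 - c2) = 0 by move: hd; rewrite D1 D2; nra.
have s0 : 0 < (a2 + b2) ^+ 2 by apply: exprn_gt0; lra.
have p1 : (a2 + b2) * (a2 - c2) = - ((a1 + b1) * (a1 + c1)) by lra.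
have p2 : (a2 + b2) * (b2 - c2) = - ((a1 + b1) * (b1 + c1)) by lra.
have : ((a2 + b2) ^+ 2 + (a1 + b1) ^+ 2) * ((a1 + c1) * (b1 + c1)) = 0.
  have : (a2 + b2) ^+ 2 * ((a2 - c2) * (b2 - c2)) = (a1 + b1) ^+ 2 * ((a1 + c1) * (b1 + c1)).
    have -> : (a2 + b2) ^+ 2 * ((a2 - c2) * (b2 - c2)) = ((a2 + b2) * (a2 - c2)) * ((a2 + b2) * (b2 - c2)) by ring.
    by rewrite p1 p2; ring.
  have := congr1 (fun z => (a2 + b2) ^+ 2 * z) k; rewrite /= mulr0; lra.
move/eqP; rewrite mulf_eq0 => /orP[/eqP h|]; first by have := sqr_ge0 (a1 + b1); lra.
have n0 : a2 + b2 != 0 by apply: lt0r_neq0; lra.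
rewrite mulf_eq0 => /orP[/eqP h|/eqP h].
  left; rewrite h mulr0 oppr0 in p1; move/eqP: p1; rewrite mulf_eq0 (negPf n0) /= => /eqP; lra.
right; rewrite h mulr0 oppr0 in p2; move/eqP: p2; rewrite mulf_eq0 (negPf n0) /= => /eqP; lra.
Qed.


Lemma separated_ge F x y x' y' : separated F -> F x y -> F x' y' -> x != x' ->
  1 <= (x - x') ^+ 2 + (y - y') ^+ 2.
Proof.
move=> sF f f' n; rewrite leNgt; apply/negP => l.
by have [e _] := sF _ _ _ _ f f' l; rewrite e eqxx in n.
Qed.

(** On the quarter circle around the top the chords have slope at most 1 in absolute value, so a
    unit chord has horizontal extent at least 1 / sqrt 2. *)
Lemma flat_arc_gap (r x y x' y' : R) : x ^+ 2 + y ^+ 2 = r -> x' ^+ 2 + y' ^+ 2 = r ->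
  x < x' -> 0 < y -> 0 < y' -> x ^+ 2 <= y ^+ 2 -> x' ^+ 2 <= y' ^+ 2 ->
  1 <= (x - x') ^+ 2 + (y - y') ^+ 2 -> 7 / 10 <= x' - x.
Proof.
move=> n n' lx py py' f f' d.
have s0 : 0 < y + y' by lra.
have e : (y - y') * (y + y') = (x' - x) * (x' + x) by nra.
have k : (x' + x) ^+ 2 <= (y + y') ^+ 2.
  have b1 : - y <= x /\ x <= y by split; nra.
  have b2 : - y' <= x' /\ x' <= y' by split; nra.
  nra.
have : (y - y') ^+ 2 <= (x - x') ^+ 2.
  have : (y - y') ^+ 2 * (y + y') ^+ 2 <= (x - x') ^+ 2 * (y + y') ^+ 2.
    have -> : (y - y') ^+ 2 * (y + y') ^+ 2 = (x - x') ^+ 2 * (x' + x) ^+ 2.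
      by rewrite -exprMn e; ring.
    by apply: ler_wpM2l => //; exact: sqr_ge0.
  by rewrite ler_pM2r // exprn_gt0.
move=> h; nra.
Qed.

(** Two ordinates of at least sqrt (r / 2) add up to more than sqrt r. *)
Lemma flat21 (r y v1 v2 : R) : 1 <= r -> 0 < y -> 0 < v1 -> 0 < v2 -> y ^+ 2 <= r ->
  r <= 2 * v1 ^+ 2 -> r <= 2 * v2 ^+ 2 -> v1 + v2 <= y -> False.
Proof.
move=> r1 y0 v10 v20 hy h1 h2 h.
have k : (v1 + v2) ^+ 2 <= y ^+ 2 by nra.
have : 0 < v1 * v2 by exact: mulr_gt0.
nra.
Qed.

(** Here 3 / sqrt 2 > 2. *)
Lemma flat32 (r y1 y2 y3 v1 v2 : R) : 1 <= r -> 0 < y1 -> 0 < y2 -> 0 < y3 ->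
  0 < v1 -> 0 < v2 -> v1 ^+ 2 <= r -> v2 ^+ 2 <= r ->
  r <= 2 * y1 ^+ 2 -> r <= 2 * y2 ^+ 2 -> r <= 2 * y3 ^+ 2 -> y1 + y2 + y3 <= v1 + v2 -> False.
Proof.
move=> r1 p1 p2 p3 q1 q2 h1 h2 k1 k2 k3 h.
have l : (v1 + v2) ^+ 2 <= 4 * r by have := sqr_ge0 (v1 - v2); nra.
have m a b : 0 < a -> 0 < b -> r <= 2 * a ^+ 2 -> r <= 2 * b ^+ 2 -> r <= 2 * (a * b).
  move=> a0 b0 ha hb; have [ab|ab] := lerP a b; nra.
have m12 := m _ _ p1 p2 k1 k2; have m13 := m _ _ p1 p3 k1 k3; have m23 := m _ _ p2 p3 k2 k3.
have : (y1 + y2 + y3) ^+ 2 <= (v1 + v2) ^+ 2 by nra.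
nra.
Qed.

Definition antipodal F r := forall x y, F x y -> x ^+ 2 + y ^+ 2 = r -> F (- x) (- y).

(** The first bound says that no point of the circle is nearer than sqrt (r - 1) to [(1, 0)] or
    [(- 1, 0)], the second that none is nearer than 1. *)
Definition window F r := forall x y, F x y -> x ^+ 2 + y ^+ 2 = r ->
  x ^+ 2 <= 1 /\ 4 * x ^+ 2 <= r ^+ 2.

Lemma window_flat F r x y : 1 <= r -> window F r -> F x y -> x ^+ 2 + y ^+ 2 = r ->
  r <= 2 * y ^+ 2 /\ x ^+ 2 <= y ^+ 2.
Proof.
move=> r1 w f n; have [w1 w2] := w _ _ f n.
have : r <= 2 * y ^+ 2 by have [r2|r2] := lerP 2 r; nra.
by split=> //; nra.
Qed.

Lemma window_mirror F r : window F r -> window (mirror F) r.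
Proof. by move=> w x y f n; apply: (w x (- y)) => //; rewrite sqrrN. Qed.

(** Three gaps of 7/10 exceed the width 2 of the window. *)
Lemma upper_size F r t : separated F -> 1 <= r -> window F r -> upper F r t -> (size t <= 3)%N.
Proof.
move=> sF r1 w [so ut].
have P x y : (x, y) \in t -> [/\ F x y, x ^+ 2 + y ^+ 2 = r, 0 < y, r <= 2 * y ^+ 2 & x ^+ 2 <= y ^+ 2].
  by move=> /ut[f n p]; have [] := window_flat r1 w f n; split.
have G x y x' y' : (x, y) \in t -> (x', y') \in t -> x < x' -> 7 / 10 <= x' - x.
  move=> /P[f n p _ q] /P[f' n' p' _ q'] l.
  apply: (flat_arc_gap n n' l p p' q q'); apply: (separated_ge sF f f').
  by rewrite lt_eqF.
case: t so P G {ut} => [|[x1 y1] [|[x2 y2] [|[x3 y3] [|[x4 y4] t]]]] //= so P G.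
have m1 : (x1, y1) \in [:: (x1, y1), (x2, y2), (x3, y3), (x4, y4) & t] by rewrite !inE eqxx.
have m2 : (x2, y2) \in [:: (x1, y1), (x2, y2), (x3, y3), (x4, y4) & t] by rewrite !inE eqxx ?orbT.
have m3 : (x3, y3) \in [:: (x1, y1), (x2, y2), (x3, y3), (x4, y4) & t] by rewrite !inE eqxx ?orbT.
have m4 : (x4, y4) \in [:: (x1, y1), (x2, y2), (x3, y3), (x4, y4) & t] by rewrite !inE eqxx ?orbT.
case/and4P: so => l1 l2 l3 _.
have g1 := G _ _ _ _ m1 m2 l1; have g2 := G _ _ _ _ m2 m3 l2; have g3 := G _ _ _ _ m3 m4 l3.
have [f1 n1 _ _ _] := P _ _ m1; have [f4 n4 _ _ _] := P _ _ m4.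
have [w1 _] := w _ _ f1 n1; have [w4 _] := w _ _ f4 n4.
have b1 : - 1 <= x1 by nra.
have b4 : x4 <= 1 by nra.
lra.
Qed.

(** At most three points lie above the axis, at most three below and none on it. The heights exclude
    unequal numbers, and one against one or two against two is antipodal by [four_balanced]. *)
Lemma window_cases F r : separated F -> balanced0 F -> 1 <= r -> window F r ->
  antipodal F r \/
  exists x1 y1 x2 y2 x3 y3 u1 v1 u2 v2 u3 v3,
    [/\ upper F r [:: (x1, y1); (x2, y2); (x3, y3)],
        upper (mirror F) r [:: (u1, v1); (u2, v2); (u3, v3)],
        x1 + x2 + x3 + (u1 + u2 + u3) = 0 & y1 + y2 + y3 = v1 + v2 + v3].
Proof.
move=> sF bF r1 w.
have [t [t' [z [[ut ut' hz e1 e2] _]]]] := balanced_split r bF.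
have z0 : z = [::].
  case: z hz {e1} => // x z hz; have [f n] := iffLR (hz x) (mem_head x z).
  have n' : x ^+ 2 + 0 ^+ 2 = r by rewrite expr0n addr0.
  have [+ _] := window_flat r1 w f n'; rewrite expr0n mulr0 leNgt => /negP[]; exact: lt_le_trans r1.
rewrite {}z0 big_nil addr0 {z hz} in e1.
have st := upper_size sF r1 w ut.
have st' := upper_size (separated_mirror sF) r1 (window_mirror w) ut'.
have P x y : (x, y) \in t -> [/\ x ^+ 2 + y ^+ 2 = r, 0 < y & r <= 2 * y ^+ 2].
  by move=> /(ut.2)[f n p]; have [] := window_flat r1 w f n; split.
have P' x y : (x, y) \in t' -> [/\ x ^+ 2 + y ^+ 2 = r, 0 < y & r <= 2 * y ^+ 2].
  by move=> /(ut'.2)[f n p]; have [] := window_flat r1 (window_mirror w) f n; split.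
have anti : (forall x y, ((x, y) \in t -> (- x, y) \in t') /\ ((x, y) \in t' -> (- x, y) \in t)) -> antipodal F r.
  move=> h x y f n; have [_ _] := (ut, ut').
  have y0 : y != 0 by apply/eqP => y0; have [] := window_flat r1 w f n; rewrite y0; lra.
  have [ys|ys|ye] := ltrgtP 0 y; last by rewrite -ye eqxx in y0.
    have /(proj1 (h x y)) : (x, y) \in t by apply/ut.2.
    by move=> /(ut'.2)[].
  have /(proj2 (h x (- y))) : (x, - y) \in t' by apply/ut'.2; rewrite /mirror opprK sqrrN; split=> //; lra.
  by move=> /(ut.2)[].
case: t t' st st' ut ut' e1 e2 P P' anti => [|[x1 y1] [|[x2 y2] [|[x3 y3] [|? ?]]]] // [|[u1 v1] [|[u2 v2] [|[u3 v3] [|? ?]]]] // _ _ ut ut';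
 rewrite ?big_cons ?big_nil ?addr0 /= => e1 e2 P P' anti.
all: try (have [n1 p1 q1] : [/\ x1 ^+ 2 + y1 ^+ 2 = r, 0 < y1 & r <= 2 * y1 ^+ 2] by apply: P; rewrite !inE eqxx ?orbT).
all: try (have [n2 p2 q2] : [/\ x2 ^+ 2 + y2 ^+ 2 = r, 0 < y2 & r <= 2 * y2 ^+ 2] by apply: P; rewrite !inE eqxx ?orbT).
all: try (have [n3 p3 q3] : [/\ x3 ^+ 2 + y3 ^+ 2 = r, 0 < y3 & r <= 2 * y3 ^+ 2] by apply: P; rewrite !inE eqxx ?orbT).
all: try (have [m1 s1 k1] : [/\ u1 ^+ 2 + v1 ^+ 2 = r, 0 < v1 & r <= 2 * v1 ^+ 2] by apply: P'; rewrite !inE eqxx ?orbT).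
all: try (have [m2 s2 k2] : [/\ u2 ^+ 2 + v2 ^+ 2 = r, 0 < v2 & r <= 2 * v2 ^+ 2] by apply: P'; rewrite !inE eqxx ?orbT).
all: try (have [m3 s3 k3] : [/\ u3 ^+ 2 + v3 ^+ 2 = r, 0 < v3 & r <= 2 * v3 ^+ 2] by apply: P'; rewrite !inE eqxx ?orbT).
all: clear P P'.
all: try by exfalso; lra.
- by left; apply: anti.
- left; apply: anti => x y; rewrite !inE.
  have -> : u1 = - x1 by lra.
  have -> : v1 = y1 by [].
  split=> /eqP[-> ->]; by rewrite ?opprK eqxx.
- by exfalso; apply: (@flat21 r y1 v1 v2) => //; nra.
- by exfalso; apply: (@flat21 r y1 v1 v2) => //; nra.
- by exfalso; apply: (@flat21 r v1 y1 y2) => //; nra.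
- left; apply: anti => x y; rewrite !inE.
  have r0 : 0 < r by lra.
  have [] := @four_balanced x1 y1 x2 y2 u1 v1 u2 v2 r r0 n1 n2 m1 m2 p1 (ltW p2); [lra|lra| |].
    by case=> -> [-> [-> ->]]; split=> /orP[]/eqP[-> ->]; rewrite ?opprK eqxx ?orbT.
  by case=> -> [-> [-> ->]]; split=> /orP[]/eqP[-> ->]; rewrite ?opprK eqxx ?orbT.
- by exfalso; apply: (@flat32 r v1 v2 v3 y1 y2) => //; nra.
- by exfalso; apply: (@flat21 r v1 y1 y2) => //; nra.
- by exfalso; apply: (@flat32 r y1 y2 y3 v1 v2) => //; nra.
- right; exists x1, y1, x2, y2, x3, y3, u1, v1, u2, v2, u3, v3.
  split=> //; lra.
Qed.
End Shells.

(** * Unit neighbours *)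

Section UnitShell.
Variable R : realType.
Implicit Types (F D : R -> R -> Prop) (x y a b u v r : R) (s t : seq (R * R)).

Definition h : R := Num.sqrt 3 / 2.

Lemma h2 : h ^+ 2 = 3 / 4.
Proof. by rewrite /h exprMn sqr_sqrtr //; lra. Qed.

Lemma h_gt0 : 0 < h.
Proof. by rewrite /h divr_gt0 ?sqrtr_gt0. Qed.

Lemma h_bounds : 866 / 1000 < h < 867 / 1000.
Proof. by have := (h2, h_gt0) => -[e p]; apply/andP; split; nra. Qed.

Lemma separated_dot F x y x' y' r : separated F -> F x y -> F x' y' ->
  x ^+ 2 + y ^+ 2 = r -> x' ^+ 2 + y' ^+ 2 = r -> ~ (x = x' /\ y = y') ->
  x * x' + y * y' <= r - 1 / 2.
Proof.
move=> sF f f' n n' ne; rewrite leNgt; apply/negP => l.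
by apply: ne; apply: (sF _ _ _ _ f f'); nra.
Qed.

(** The arc between 60 and 120 degrees has no room for two points 60 degrees apart, unless both are
    its ends. *)
Lemma second_top (x1 y1 x2 y2 : R) : x1 ^+ 2 + y1 ^+ 2 = 1 -> x2 ^+ 2 + y2 ^+ 2 = 1 ->
  0 < y1 -> 0 < y2 -> x1 < x2 -> x2 <= 1 / 2 -> x1 * x2 + y1 * y2 <= 1 / 2 -> x1 <= - (1 / 2).
Proof.
move=> n1 n2 p1 p2 l b d; rewrite leNgt; apply/negP => c.
have q1 : h < y1 by have := (h2, h_gt0) => -[e p]; nra.
have q2 : h <= y2 by have := (h2, h_gt0) => -[e p]; nra.
have := (h2, h_gt0) => -[e p].
have : h * h < y1 * y2 by nra.
nra.
Qed.

(** The arc from 120 to 180 degrees without its last end has no room for two points either. *)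
Lemma no_third_top (x1 y1 x2 y2 : R) : x1 ^+ 2 + y1 ^+ 2 = 1 -> x2 ^+ 2 + y2 ^+ 2 = 1 ->
  0 < y1 -> 0 < y2 -> x1 < x2 -> x2 <= - (1 / 2) -> 1 / 2 < x1 * x2 + y1 * y2.
Proof.
move=> n1 n2 p1 p2 l b.
have q : 1 < - x1 + y1 by nra.
have [c|c] := lerP (- x2) y2.
  have : - x2 * (- x1 + y1) <= x1 * x2 + y1 * y2 by nra.
  nra.
nra.
Qed.

Definition tri D := [/\ D 1 0, D (- (1 / 2)) h, D (- (1 / 2)) (- h) &
  forall x y, D x y -> x ^+ 2 + y ^+ 2 = 1 ->
   [\/ x = 1 /\ y = 0, x = - (1 / 2) /\ y = h | x = - (1 / 2) /\ y = - h]].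

Definition five D := exists x1 y1 x2 y2 u1 v1 u2 v2,
  [/\ upper D 1 [:: (x1, y1); (x2, y2)], upper (mirror D) 1 [:: (u1, v1); (u2, v2)],
      x1 + x2 + u1 + u2 = - 1, y1 + y2 = v1 + v2 & ~ D (- 1) 0].

Lemma unit_upper D t : separated D -> D 1 0 -> upper D 1 t ->
  [\/ t = [::], exists x y, t = [:: (x, y)] /\ x <= 1 / 2 |
      exists x1 y1 x2 y2, [/\ t = [:: (x1, y1); (x2, y2)], x1 <= - (1 / 2), x2 <= 1 / 2 & x1 < x2]].
Proof.
move=> sD D1 [so ut].
have P x y : (x, y) \in t -> [/\ D x y, x ^+ 2 + y ^+ 2 = 1, 0 < y & x <= 1 / 2].
  move=> /ut[f n p]; split=> //.
  have : 1 * x + 0 * y <= 1 - 1 / 2 by apply: (separated_dot sD D1 f) => //; [ring|lra].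
  lra.
case: t so P {ut} => [|[x1 y1] [|[x2 y2] t]] so P; first by constructor 1.
  by constructor 2; exists x1, y1; split=> //; have [] := P x1 y1 (mem_head _ _).
have [f1 n1 p1 b1] := P x1 y1 (mem_head _ _).
have [|f2 n2 p2 b2] := P x2 y2; first by rewrite !inE eqxx orbT.
have l12 : x1 < x2 by move: so => /= /andP[].
have d12 : x1 * x2 + y1 * y2 <= 1 / 2.
  have : x1 * x2 + y1 * y2 <= 1 - 1 / 2 by apply: (separated_dot sD f1 f2 n1 n2); lra.
  lra.
case: t so P => [|[x3 y3] t] so P.
  constructor 3; exists x1, y1, x2, y2; split=> //; exact: second_top d12.
have [|f3 n3 p3 b3] := P x3 y3; first by rewrite !inE eqxx !orbT.
have l23 : x2 < x3 by move: so => /= /and3P[].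
have d23 : x2 * x3 + y2 * y3 <= 1 / 2.
  have : x2 * x3 + y2 * y3 <= 1 - 1 / 2 by apply: (separated_dot sD f2 f3 n2 n3); lra.
  lra.
have := second_top n2 n3 p2 p3 l23 b3 d23.
by move=> /(no_third_top n1 n2 p1 p2 l12); lra.
Qed.

(** By [unit_upper] each side of the axis holds at most two neighbours. If [(- 1, 0)] is absent, the
    abscissae of the others sum to - 1, which leaves one against one, the triangle, or two against
    two. If it is present, all others have height at least [h], and equal numbers give
    antipodality. *)
Lemma unit_types D : separated D -> balanced0 D -> D 1 0 -> [\/ antipodal D 1, tri D | five D].
Proof.
move=> sD bD D1.
have [t [t' [z [[ut ut' hz e1 e2] uz]]]] := balanced_split 1 bD.
have ax x : x ^+ 2 = 1 -> x = 1 \/ x = - 1.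
  by move/eqP; rewrite sqrf_eq1 => /orP[]/eqP ->; [left|right].
have [Dm1|nDm1] := pselect (D (- 1) 0); last first.
- have ez : \sum_(x <- z) x = 1.
    have pz : perm_eq z [:: 1].
      apply: uniq_perm => // x; rewrite inE; apply/idP/eqP => [/hz[f /ax[]//]|->].
        by move=> xm; rewrite xm in f.
      by apply/hz; split=> //; rewrite expr1n.
    by rewrite (perm_big _ pz) big_seq1.
  rewrite {}ez in e1.
  have D1' : mirror D 1 0 by rewrite /mirror oppr0.
  have C := unit_upper sD D1 ut; have C' := unit_upper (separated_mirror sD) D1' ut'.
  case: C => [t0|[x1 [y1 [t0 b1]]]|[x1 [y1 [x2 [y2 [t0 b1 b2 l]]]]]];
  case: C' => [t0'|[u1 [v1 [t0' c1]]]|[u1 [v1 [u2 [v2 [t0' c1 c2 l']]]]]]; subst t t'.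
  all: rewrite ?big_cons ?big_nil /= in e1 e2.
  all: try (have [f1 n1 p1] : [/\ D x1 y1, x1 ^+ 2 + y1 ^+ 2 = 1 & 0 < y1] by apply: (iffLR (ut.2 _ _)); rewrite !inE eqxx ?orbT).
  all: try (have [f2 n2 p2] : [/\ D x2 y2, x2 ^+ 2 + y2 ^+ 2 = 1 & 0 < y2] by apply: (iffLR (ut.2 _ _)); rewrite !inE eqxx ?orbT).
  all: try (have [g1 m1 s1] : [/\ mirror D u1 v1, u1 ^+ 2 + v1 ^+ 2 = 1 & 0 < v1] by apply: (iffLR (ut'.2 _ _)); rewrite !inE eqxx ?orbT).
  all: try (have [g2 m2 s2] : [/\ mirror D u2 v2, u2 ^+ 2 + v2 ^+ 2 = 1 & 0 < v2] by apply: (iffLR (ut'.2 _ _)); rewrite !inE eqxx ?orbT).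
  all: try by exfalso; lra.
  + have ev : v1 = y1 by lra.
    have eu : u1 = - (1 / 2) /\ x1 = - (1 / 2) by split; nra.
    case: eu => eu ex; subst u1 x1.
    have ey : y1 = h by have := (h2, h_gt0) => -[e p]; nra.
    subst v1; subst y1; constructor 2; split=> // x y f n.
    have [ys|ys|ye] := ltrgtP 0 y.
    * constructor 2; have : (x, y) \in [:: (- (1 / 2), h)] by apply/ut.2.
      by rewrite inE => /eqP[-> ->].
    * constructor 3; have : (x, - y) \in [:: (- (1 / 2), h)] by apply/ut'.2; rewrite /mirror opprK sqrrN oppr_gt0.
      by rewrite inE => /eqP[-> <-]; rewrite opprK.
    * constructor 1; move: n; rewrite -ye expr0n addr0 => /ax[//|xm].
      by rewrite -ye xm in f.
  (* Four vectors in all: in the rhombus the opposite of [(1, 0)] would have ordinate 0. *)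
  + exfalso; have [] := @four_balanced R x1 y1 1 0 u1 v1 u2 v2 1 ltr01 n1 _ m1 m2 p1 (lexx _); [|lra|lra|lra|lra].
    by rewrite expr1n expr0n addr0.
  + exfalso; have [] := @four_balanced R u1 v1 1 0 x1 y1 x2 y2 1 ltr01 m1 _ n1 n2 s1 (lexx _); [|lra|lra|lra|lra].
    by rewrite expr1n expr0n addr0.
  + constructor 3; exists x1, y1, x2, y2, u1, v1, u2, v2; split=> //; lra.
- have bd x y : D x y -> x ^+ 2 + y ^+ 2 = 1 -> 0 < y -> x <= 1 / 2 /\ - (1 / 2) <= x.
    move=> f n p.
    have k1 : 1 * x + 0 * y <= 1 - 1 / 2 by apply: (separated_dot sD D1 f) => //; [ring|lra].
    have k2 : - 1 * x + 0 * y <= 1 - 1 / 2 by apply: (separated_dot sD Dm1 f) => //; [ring|lra].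
    by split; lra.
  have bd' x y : mirror D x y -> x ^+ 2 + y ^+ 2 = 1 -> 0 < y -> x <= 1 / 2 /\ - (1 / 2) <= x.
    move=> f n p.
    have k1 : 1 * x + 0 * - y <= 1 - 1 / 2 by apply: (separated_dot sD D1 f) => //; rewrite ?sqrrN //; [ring|lra].
    have k2 : - 1 * x + 0 * - y <= 1 - 1 / 2 by apply: (separated_dot sD Dm1 f) => //; rewrite ?sqrrN //; [ring|lra].
    by split; lra.
  have ez : \sum_(x <- z) x = 0.
    have pz : perm_eq z [:: 1; - 1].
      apply: uniq_perm => //=; first by rewrite inE andbT; apply/eqP; lra.
      move=> x; rewrite !inE; apply/idP/orP => [/hz[f /ax[]->]|[]/eqP->]; rewrite ?eqxx; [by left|by right| |].
        by apply/hz; rewrite expr1n.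
      by apply/hz; rewrite sqrrN expr1n.
    by rewrite (perm_big _ pz) !big_cons big_nil /=; ring.
  rewrite {}ez addr0 in e1; constructor 1.
  have D1' : mirror D 1 0 by rewrite /mirror oppr0.
  have C := unit_upper sD D1 ut; have C' := unit_upper (separated_mirror sD) D1' ut'.
  have anti : (forall x y, ((x, y) \in t -> (- x, y) \in t') /\ ((x, y) \in t' -> (- x, y) \in t)) -> antipodal D 1.
    move=> H x y f n; have [ys|ys|ye] := ltrgtP 0 y.
    - have /(proj1 (H x y)) : (x, y) \in t by apply/ut.2.
      by move=> /(ut'.2)[].
    - have /(proj2 (H x (- y))) : (x, - y) \in t' by apply/ut'.2; rewrite /mirror opprK sqrrN oppr_gt0.
      by move=> /(ut.2)[].
    - by move: n f; rewrite -ye expr0n addr0 oppr0 => /ax[]->; rewrite ?opprK.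
  case: C => [t0|[x1 [y1 [t0 b1]]]|[x1 [y1 [x2 [y2 [t0 b1 b2 l]]]]]];
  case: C' => [t0'|[u1 [v1 [t0' c1]]]|[u1 [v1 [u2 [v2 [t0' c1 c2 l']]]]]]; subst t t'.
  all: rewrite ?big_cons ?big_nil /= in e1 e2.
  all: try (have [f1 n1 p1] : [/\ D x1 y1, x1 ^+ 2 + y1 ^+ 2 = 1 & 0 < y1] by apply: (iffLR (ut.2 _ _)); rewrite !inE eqxx ?orbT).
  all: try (have [f2 n2 p2] : [/\ D x2 y2, x2 ^+ 2 + y2 ^+ 2 = 1 & 0 < y2] by apply: (iffLR (ut.2 _ _)); rewrite !inE eqxx ?orbT).
  all: try (have [g1 m1 s1] : [/\ mirror D u1 v1, u1 ^+ 2 + v1 ^+ 2 = 1 & 0 < v1] by apply: (iffLR (ut'.2 _ _)); rewrite !inE eqxx ?orbT).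
  all: try (have [g2 m2 s2] : [/\ mirror D u2 v2, u2 ^+ 2 + v2 ^+ 2 = 1 & 0 < v2] by apply: (iffLR (ut'.2 _ _)); rewrite !inE eqxx ?orbT).
  all: try by exfalso; lra.
  + by apply: anti.
  + apply: anti => x y; rewrite !inE.
    have -> : u1 = - x1 by lra.
    have -> : v1 = y1 by lra.
    by split=> /eqP[-> ->]; rewrite ?opprK eqxx.
  + exfalso; have := bd _ _ f1 n1 p1; have := bd' _ _ g1 m1 s1; have := bd' _ _ g2 m2 s2.
    have := (h2, h_gt0) => -[e p] [q1 q2] [q3 q4] [q5 q6].
    have w1 : h <= v1 by nra.
    have w2 : h <= v2 by nra.
    nra.
  + exfalso; have := bd _ _ f1 n1 p1; have := bd _ _ f2 n2 p2; have := bd' _ _ g1 m1 s1.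
    have := (h2, h_gt0) => -[e p] [q1 q2] [q3 q4] [q5 q6].
    have w1 : h <= y1 by nra.
    have w2 : h <= y2 by nra.
    nra.
  + apply: anti => x y; rewrite !inE.
    have [] := @four_balanced R x1 y1 x2 y2 u1 v1 u2 v2 1 ltr01 n1 n2 m1 m2 p1 (ltW p2); [lra|lra| |].
      by case=> -> [-> [-> ->]]; split=> /orP[]/eqP[-> ->]; rewrite ?opprK eqxx ?orbT.
    by case=> -> [-> [-> ->]]; split=> /orP[]/eqP[-> ->]; rewrite ?opprK eqxx ?orbT.
Qed.
End UnitShell.

(** * Circles slightly larger than the unit circle *)

Section NearShells.
Variable R : realType.
Implicit Types (F D : R -> R -> Prop) (x y a b u v r : R) (s t : seq (R * R)).
Notation h := (h R).

Lemma separated_half F a b x y r : separated F -> F a b -> F x y -> a ^+ 2 + b ^+ 2 = 1 ->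
  x ^+ 2 + y ^+ 2 = r -> 1 < r -> a * x + b * y <= r / 2.
Proof.
move=> sF f f' n n' r1; rewrite leNgt; apply/negP => l.
have [] := sF _ _ _ _ f f'; first by nra.
by move=> ea eb; move: r1; rewrite -n' -ea -eb n ltxx.
Qed.

(* Distance at least 1 on a circle, with the ordinates eliminated. *)
Lemma upper_chord (x y x' y' r : R) : x ^+ 2 + y ^+ 2 = r -> x' ^+ 2 + y' ^+ 2 = r -> 0 <= y -> 0 <= y' ->
  1 <= (x - x') ^+ 2 + (y - y') ^+ 2 -> x * x' <= r - 1 / 2 /\ r * (1 - (x - x') ^+ 2) <= x * x' + 1 / 4.
Proof.
move=> n n' y0 y0' k; have l : x * x' + y * y' <= r - 1 / 2 by move: n n' k; clear; lra.
have l' : x * x' <= r - 1 / 2 by move: (mulr_ge0 y0 y0') l; clear; lra.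
split=> //; have q : (y * y') ^+ 2 <= (r - 1 / 2 - x * x') ^+ 2.
  by move: (mulr_ge0 y0 y0') l; clear; nra.
have e : (y * y') ^+ 2 = (r - x ^+ 2) * (r - x' ^+ 2) by rewrite exprMn; congr (_ * _); [move: n|move: n']; clear; lra.
by rewrite e in q; move: q; clear; lra.
Qed.

(** A unit chord that starts at abscissa - r / 2 already ends in the right half. This holds up to a
    root of r^3 - 4 r + 1 near 1.86; the bound 87/50 = 2 - 2 * 13/100 is the one used for five
    neighbours. *)
Lemma narrow_side (r x y x' y' : R) : 1 < r -> r <= 87 / 50 -> x ^+ 2 + y ^+ 2 = r ->
  x' ^+ 2 + y' ^+ 2 = r -> 0 < y -> 0 < y' -> x < x' -> 1 <= (x - x') ^+ 2 + (y - y') ^+ 2 ->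
  - r <= 2 * x -> x' <= 0 -> False.
Proof.
move=> r1 r2 n n' /ltW p /ltW p' l d b c; have [_ k] := upper_chord n n' p p' d.
move: r1 r2 l b c k; clear; rewrite -[x']opprK; move: (- x') => u r1 r2 l b c k.
have u0 : 0 <= u by move: c; lra.
have xu : x * - u <= u * r / 2 by move: b u0; clear; nra.
have ur : 0 <= u * (r / 2 - u) by move: b l u0; clear; nra.
have d2 : (x - - u) ^+ 2 <= (r / 2 - u) ^+ 2 by move: b l; clear; nra.
have d3 : (r / 2 - u) ^+ 2 <= r ^+ 2 / 4 - r * u / 2 by move: ur; clear; nra.
have k2 : r * (1 - (r ^+ 2 / 4 - r * u / 2)) <= u * r / 2 + 1 / 4 by move: k xu d2 d3 r1; clear; nra.
have k3 : 0 <= r * (r - 1) * u by rewrite !mulr_ge0 //; move: r1; clear; lra.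
have k4 : r - r ^+ 3 / 4 <= 1 / 4 by move: k2 k3; clear; nra.
have : r ^+ 2 <= 76 / 25 by move: r1 r2; clear; nra.
by move: k4 r1 r2; clear; nra.
Qed.

(** The middle point shares one half of the arc with an outer point. *)
Lemma narrow_arc (r x1 y1 x2 y2 x3 y3 : R) : 1 < r ->
  x1 ^+ 2 + y1 ^+ 2 = r -> x2 ^+ 2 + y2 ^+ 2 = r -> x3 ^+ 2 + y3 ^+ 2 = r ->
  0 < y1 -> 0 < y2 -> 0 < y3 -> x1 < x2 -> x2 < x3 ->
  1 <= (x1 - x2) ^+ 2 + (y1 - y2) ^+ 2 -> 1 <= (x2 - x3) ^+ 2 + (y2 - y3) ^+ 2 ->
  r <= 87 / 50 -> - r <= 2 * x1 -> 2 * x3 <= r -> False.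
Proof.
move=> r1 n1 n2 n3 p1 p2 p3 l12 l23 d12 d23 hr b1 b3.
have [c|/ltW c] := lerP x2 0; first exact: narrow_side n1 n2 p1 p2 l12 d12 b1 c.
apply: (@narrow_side r (- x3) y3 (- x2) y2) => //; rewrite ?sqrrN ?ltrN2 ?oppr_le0 //.
- have -> : (- x3 - - x2) ^+ 2 = (x2 - x3) ^+ 2 by ring.
  by have -> : (y3 - y2) ^+ 2 = (y2 - y3) ^+ 2 by ring.
by move: b3; clear; lra.
Qed.

Lemma upper3 F r x1 y1 x2 y2 x3 y3 : separated F -> upper F r [:: (x1, y1); (x2, y2); (x3, y3)] ->
  [/\ [/\ F x1 y1, x1 ^+ 2 + y1 ^+ 2 = r & 0 < y1], [/\ F x2 y2, x2 ^+ 2 + y2 ^+ 2 = r & 0 < y2],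
      [/\ F x3 y3, x3 ^+ 2 + y3 ^+ 2 = r & 0 < y3], x1 < x2 /\ x2 < x3 &
      1 <= (x1 - x2) ^+ 2 + (y1 - y2) ^+ 2 /\ 1 <= (x2 - x3) ^+ 2 + (y2 - y3) ^+ 2].
Proof.
move=> sF [/= /and3P[l12 l23 _] u].
have [f1 n1 p1] : [/\ F x1 y1, x1 ^+ 2 + y1 ^+ 2 = r & 0 < y1] by apply: (iffLR (u _ _)); rewrite !inE eqxx.
have [f2 n2 p2] : [/\ F x2 y2, x2 ^+ 2 + y2 ^+ 2 = r & 0 < y2] by apply: (iffLR (u _ _)); rewrite !inE eqxx orbT.
have [f3 n3 p3] : [/\ F x3 y3, x3 ^+ 2 + y3 ^+ 2 = r & 0 < y3] by apply: (iffLR (u _ _)); rewrite !inE eqxx !orbT.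
by split=> //; split; apply: separated_ge sF _ _ _ => //; rewrite lt_eqF.
Qed.

(** Distance 1 from [(1, 0)] and [(- 1, 0)] confines the circle to abscissae of absolute value at
    most r / 2. Three points do not fit on such an arc, so the exceptional case of [window_cases] is
    impossible. *)
Lemma antipodal_near D r : separated D -> balanced0 D -> D 1 0 -> D (- 1) 0 ->
  1 < r -> r <= 87 / 50 -> antipodal D r.
Proof.
move=> sD bD D1 Dm r1 r2.
have w' x y : D x y -> x ^+ 2 + y ^+ 2 = r -> - r <= 2 * x /\ 2 * x <= r.
  move=> f n; have k1 : 1 * x + 0 * y <= r / 2 by apply: (separated_half sD D1 f _ n r1); ring.
  have k2 : - 1 * x + 0 * y <= r / 2 by apply: (separated_half sD Dm f _ n r1); ring.
  by split; lra.
have w : window D r by move=> x y f n; have [] := w' x y f n; split; nra.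
have [//|] := window_cases sD bD (ltW r1) w.
move=> [x1 [y1 [x2 [y2 [x3 [y3 [u1 [v1 [u2 [v2 [u3 [v3 [ut _ _ _]]]]]]]]]]]]].
have [[f1 n1 p1] [f2 n2 p2] [f3 n3 p3] [l12 l23] [d12 d23]] := upper3 sD ut.
have [b1 _] := w' _ _ f1 n1; have [_ b3] := w' _ _ f3 n3.
by exfalso; apply: (narrow_arc r1 n1 n2 n3) => //.
Qed.

End NearShells.

(** * Threefold vertices *)

Section Threefold.
Variable R : realType.
Implicit Types (F D : R -> R -> Prop) (x y a b u v r : R) (s t : seq (R * R)).
Notation h := (h R).

Definition rx x y : R := - (1 / 2) * x - h * y.
Definition ry x y : R := h * x + - (1 / 2) * y.

Lemma hh : h * h = 3 / 4.
Proof. by rewrite -expr2 h2. Qed.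

Lemma rx2 x y : rx (rx x y) (ry x y) = - (1 / 2) * x + h * y.
Proof.
rewrite /rx /ry.
suff : h * h * x = 3 / 4 * x by clear; nra.
by rewrite hh.
Qed.

Lemma ry2 x y : ry (rx x y) (ry x y) = - h * x - 1 / 2 * y.
Proof.
rewrite /rx /ry.
suff : h * h * y = 3 / 4 * y by clear; nra.
by rewrite hh.
Qed.

Lemma rx3 x y : rx (- (1 / 2) * x + h * y) (- h * x - 1 / 2 * y) = x.
Proof.
rewrite /rx.
suff : h * h * x = 3 / 4 * x by clear; nra.
by rewrite hh.
Qed.

Lemma ry3 x y : ry (- (1 / 2) * x + h * y) (- h * x - 1 / 2 * y) = y.
Proof.
rewrite /ry.
suff : h * h * y = 3 / 4 * y by clear; nra.
by rewrite hh.
Qed.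

Lemma rxy_norm x y : rx x y ^+ 2 + ry x y ^+ 2 = x ^+ 2 + y ^+ 2.
Proof.
have -> : rx x y ^+ 2 + ry x y ^+ 2 = (1 / 4 + h * h) * (x ^+ 2 + y ^+ 2) by rewrite /rx /ry; field.
by rewrite hh; field.
Qed.

Lemma rxy_norm2 x y : (- (1 / 2) * x + h * y) ^+ 2 + (- h * x - 1 / 2 * y) ^+ 2 = x ^+ 2 + y ^+ 2.
Proof.
have -> : (- (1 / 2) * x + h * y) ^+ 2 + (- h * x - 1 / 2 * y) ^+ 2 = (1 / 4 + h * h) * (x ^+ 2 + y ^+ 2) by field.
by rewrite hh; field.
Qed.

Lemma turn_rxy D x y : turn (- (1 / 2)) h D x y = D (rx x y) (ry x y).
Proof. by []. Qed.

Lemma half_h : (- (1 / 2)) ^+ 2 + h ^+ 2 = 1.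
Proof. by rewrite h2; field. Qed.

Lemma tri_turn D : tri D -> tri (turn (- (1 / 2)) h D).
Proof.
move=> [d1 d2 d3 d].
have r1 : rx 1 0 = - (1 / 2) /\ ry 1 0 = h by rewrite /rx /ry; split; ring.
have r2 : rx (- (1 / 2)) h = - (1 / 2) /\ ry (- (1 / 2)) h = - h.
  by rewrite /rx /ry hh; split; field.
have r3 : rx (- (1 / 2)) (- h) = 1 /\ ry (- (1 / 2)) (- h) = 0.
  by rewrite /rx /ry !mulrN !mulNr hh; split; field.
split; rewrite ?turn_rxy.
- by rewrite r1.1 r1.2.
- by rewrite r2.1 r2.2.
- by rewrite r3.1 r3.2.
- move=> x y; rewrite turn_rxy => /d H n.
  have := H (etrans (rxy_norm x y) n).
  have ex : rx (rx (rx x y) (ry x y)) (ry (rx x y) (ry x y)) = x by rewrite [rx (rx x y) _]rx2 [ry (rx x y) _]ry2 rx3.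
  have ey : ry (rx (rx x y) (ry x y)) (ry (rx x y) (ry x y)) = y by rewrite [rx (rx x y) _]rx2 [ry (rx x y) _]ry2 ry3.
  case=> -[e1 e2]; move: ex ey; rewrite e1 e2.
  + by rewrite r1.1 r1.2 r2.1 r2.2 => <- <-; constructor 3.
  + by rewrite r2.1 r2.2 r3.1 r3.2 => <- <-; constructor 1.
  + by rewrite r3.1 r3.2 r1.1 r1.2 => <- <-; constructor 2.
Qed.

Lemma tri_bounds D x y r : separated D -> tri D -> D x y -> x ^+ 2 + y ^+ 2 = r -> 1 < r ->
  [/\ 2 * x <= r, - x + 2 * h * y <= r & - x - 2 * h * y <= r].
Proof.
move=> sD [d1 d2 d3 _] f n r1; have e := h2 R.
have k1 : 1 * x + 0 * y <= r / 2 by apply: (separated_half sD d1 f _ n r1); ring.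
have k2 : - (1 / 2) * x + h * y <= r / 2 by apply: (separated_half sD d2 f half_h n r1).
have k3 : - (1 / 2) * x + - h * y <= r / 2.
  by apply: (separated_half sD d3 f _ n r1); rewrite (sqrrN h) half_h.
by split; lra.
Qed.

Lemma all_eq_size (T : eqType) (l : seq T) : uniq l ->
  (forall p q, p \in l -> q \in l -> p = q) -> l = [::] \/ exists p, l = [:: p].
Proof.
case: l => [|p [|q l]] u H; [by left|by right; exists p|].
have e : p = q by apply: H; rewrite !inE eqxx ?orbT.
by move: u; rewrite e /= inE eqxx.
Qed.

(** Three vectors of equal length with sum zero form a regular triangle, and the sign of the cross
    product [c] decides its orientation. *)
Lemma three_balanced (r x0 y0 x1 y1 x2 y2 : R) : x0 ^+ 2 + y0 ^+ 2 = r ->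
  x1 ^+ 2 + y1 ^+ 2 = r -> x2 ^+ 2 + y2 ^+ 2 = r ->
  x0 + x1 + x2 = 0 -> y0 + y1 + y2 = 0 ->
  (x1 = rx x0 y0 /\ y1 = ry x0 y0) \/ (x2 = rx x0 y0 /\ y2 = ry x0 y0).
Proof.
move=> n0 n1 n2 e1 e2.
have E1 : x2 = - x0 - x1 by move: e1; clear; lra.
have E2 : y2 = - y0 - y1 by move: e2; clear; lra.
have d : x0 * x1 + y0 * y1 = - r / 2 by move: n0 n1 n2; rewrite E1 E2; clear; nra.
have [r0|r0] := eqVneq r 0.
  have z a b : a ^+ 2 + b ^+ 2 = r -> a = 0 /\ b = 0 by rewrite r0; clear; split; nra.
  have [-> ->] := z _ _ n1; have [-> ->] := z _ _ n0.
  by left; rewrite /rx /ry !mulr0 subr0 addr0.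
set c := x0 * y1 - y0 * x1.
have c2 : (c - h * r) * (c + h * r) = 0.
  have -> : (c - h * r) * (c + h * r) = c ^+ 2 - h * h * r ^+ 2 by ring.
  have -> : c ^+ 2 = (x0 ^+ 2 + y0 ^+ 2) * (x1 ^+ 2 + y1 ^+ 2) - (x0 * x1 + y0 * y1) ^+ 2 by rewrite /c; ring.
  by rewrite n0 n1 d hh; field.
have X1 : r * x1 = x0 * (- r / 2) - y0 * c by rewrite -d -n0 /c; ring.
have Y1 : r * y1 = y0 * (- r / 2) + x0 * c by rewrite -d -n0 /c; ring.
move/eqP: c2; rewrite mulf_eq0 => /orP[]/eqP ce.
  left; have {}ce : c = h * r by move: ce; clear; lra.
  split; apply: (mulfI r0); rewrite ?X1 ?Y1 ce /rx /ry; by field.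
right; have {}ce : c = - (h * r) by move: ce; clear; lra.
rewrite E1 E2; split; apply: (mulfI r0); rewrite mulrBr ?X1 ?Y1 ce /rx /ry; by field.
Qed.

(** Two of the numbers have equal signs, so their squares add up to at most the square of their sum,
    which is the square of the third. *)
Lemma zero_sum_sq (r a b c : R) : a + b + c = 0 -> a <= r -> b <= r -> c <= r ->
  - r <= a -> - r <= b -> - r <= c -> a ^+ 2 + b ^+ 2 + c ^+ 2 <= 2 * r ^+ 2.
Proof.
have main a' b' c' : a' + b' + c' = 0 -> 0 <= a' * b' -> c' <= r -> - r <= c' ->
    a' ^+ 2 + b' ^+ 2 + c' ^+ 2 <= 2 * r ^+ 2.
  move=> e0 ab l1 l2; have -> : c' = - (a' + b') by move: e0; clear; lra.
  have : (a' + b') ^+ 2 <= r ^+ 2 by move: e0 l1 l2; clear; nra.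
  by move: ab; clear; nra.
move=> e0 a1 b1 c1 a2 b2 c2.
have [ab|ab] := lerP 0 (a * b); first exact: main.
have [bc|bc] := lerP 0 (b * c).
  have := main b c a; rewrite [b + c + a]addrC addrA => /(_ e0 bc a1 a2).
  by clear; lra.
have ac : 0 <= a * c by move: ab bc; clear; nra.
have := main a c b; rewrite addrAC => /(_ e0 ac b1 b2).
by clear; lra.
Qed.

Lemma sum_three (T : eqType) (s : seq T) (A B C : pred T) (g : T -> R) :
  (forall p, p \in s -> (A p + B p + C p = 1)%N) ->
  \sum_(p <- s) g p = \sum_(p <- filter A s) g p + \sum_(p <- filter B s) g p
     + \sum_(p <- filter C s) g p.
Proof.
elim: s => [|p s IH] H; first by rewrite !big_nil !addr0.
have := H p (mem_head _ _); rewrite big_cons IH => [|q qs]; last by apply: H; rewrite inE qs orbT.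
by rewrite /=; case: (A p) (B p) (C p) => -[] [] // _; rewrite big_cons; ring.
Qed.

(** The regular triangle with inradius [t] and a vertex at [(- (2 * t), 0)]. *)
Definition in_tri (t x y : R) : Prop := [/\ x <= t, - (1 / 2) * x + h * y <= t & - (1 / 2) * x - h * y <= t].

Lemma in_tri_rot (t x y : R) : in_tri t x y -> in_tri t (rx x y) (ry x y).
Proof.
move=> [b0 b1 b2]; split.
- by rewrite /rx; move: b2; clear; lra.
- by have := rx3 x y; rewrite -rx2 -ry2 rx2 => ->.
- by have := rx2 x y; rewrite {1}/rx => ->.
Qed.

Lemma rot_dist x y x' y' : (rx x y - rx x' y') ^+ 2 + (ry x y - ry x' y') ^+ 2 =
  (x - x') ^+ 2 + (y - y') ^+ 2.
Proof.
have -> : rx x y - rx x' y' = rx (x - x') (y - y') by rewrite /rx; ring.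
have -> : ry x y - ry x' y' = ry (x - x') (y - y') by rewrite /ry; ring.
exact: rxy_norm.
Qed.

(* A circle meets the three corners [a_k <= - t] of a triangle around its centre; if it does
   so at most once per corner, balance forces a regular triangle. *)
Lemma corner_shell0 F (r t x y : R) : balanced0 F -> 0 < t -> 4 / 3 * t ^+ 2 < r ->
  (forall x y, F x y -> x ^+ 2 + y ^+ 2 = r -> in_tri t x y) ->
  (forall x y x' y', F x y -> F x' y' -> x ^+ 2 + y ^+ 2 = r -> x' ^+ 2 + y' ^+ 2 = r ->
    (x - x') ^+ 2 + (y - y') ^+ 2 < 1 -> x = x' /\ y = y') ->
  (forall x y x' y', x ^+ 2 + y ^+ 2 = r -> x' ^+ 2 + y' ^+ 2 = r -> in_tri t x y -> in_tri t x' y' ->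
    x <= - t -> x' <= - t -> (x - x') ^+ 2 + (y - y') ^+ 2 < 1) ->
  F x y -> x ^+ 2 + y ^+ 2 = r -> x <= - t -> F (rx x y) (ry x y).
Proof.
move=> bF t0 tr bnd sep uni f n l; have [s [[us hs] s1 s2]] := bF r.
pose A k (p : R * R) := match k with 0%N => p.1 <= - t | 1%N => - (1 / 2) * p.1 + h * p.2 <= - t
   | _ => - (1 / 2) * p.1 - h * p.2 <= - t end.
have P p : p \in s -> in_tri t p.1 p.2 by move=> /hs[fp np]; apply: bnd.
have np p : p \in s -> p.1 ^+ 2 + p.2 ^+ 2 = r by move=> /hs[].
have cov p : p \in s -> [\/ A 0%N p, A 1%N p | A 2%N p].
  move=> ps; have [b0 b1 b2] := P p ps; have np' := np p ps.
  have [|c0] := lerP p.1 (- t); first by constructor 1.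
  have [|c1] := lerP (- (1 / 2) * p.1 + h * p.2) (- t); first by constructor 2.
  have [|c2] := lerP (- (1 / 2) * p.1 - h * p.2) (- t); first by constructor 3.
  (* The three projections sum to 0 and their squares to 3/2 r, which exceeds 2 t^2. *)
  exfalso; have e : h ^+ 2 * p.2 ^+ 2 = 3 / 4 * p.2 ^+ 2 by rewrite h2.
  have e0 : p.1 + (- (1 / 2) * p.1 + h * p.2) + (- (1 / 2) * p.1 - h * p.2) = 0 by field.
  have := zero_sum_sq e0 b0 b1 b2 (ltW c0) (ltW c1) (ltW c2).
  by move: np' e tr; clear; lra.
have U k p q : p \in filter (A k) s -> q \in filter (A k) s -> p = q.
  rewrite !mem_filter => /andP[pk ps] /andP[qk qs].
  have [fp m] := iffLR (hs p) ps; have [fq m'] := iffLR (hs q) qs.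
  have tp := P p ps; have tq := P q qs; apply/pair_eqP; apply: sep => //.
  have tp1 := in_tri_rot tp; have tq1 := in_tri_rot tq.
  have tp2 := in_tri_rot tp1; have tq2 := in_tri_rot tq1.
  have n1 := rxy_norm p.1 p.2; have n2 := rxy_norm q.1 q.2; rewrite m in n1; rewrite m' in n2.
  case: k pk qk => [|[|k]] /= pk qk.
  - exact: uni.
  - rewrite -rot_dist -rot_dist; apply: uni => //; rewrite ?rxy_norm // ?rx2 //.
  - rewrite -rot_dist; apply: uni => //.
have D0 k p : p \in filter (A k) s -> filter (A k) s = [:: p].
  move=> ps; have [e|[q e]] := all_eq_size (filter_uniq (A k) us) (@U k); first by rewrite e in ps.
  by move: ps; rewrite e inE => /eqP ->.
have sep01 p : p \in s -> ~ (A 0%N p /\ A 1%N p).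
  by move=> ps [/= a0 a1]; have [_ _ b2] := P p ps; move: a0 a1 b2 t0; clear; lra.
have sep02 p : p \in s -> ~ (A 0%N p /\ A 2%N p).
  by move=> ps [/= a0 a1]; have [_ b2 _] := P p ps; move: a0 a1 b2 t0; clear; lra.
have sep12 p : p \in s -> ~ (A 1%N p /\ A 2%N p).
  by move=> ps [/= a0 a1]; have [b2 _ _] := P p ps; move: a0 a1 b2 t0; clear; lra.
have part := @sum_three _ s (A 0%N) (A 1%N) (A 2%N).
have one p : p \in s -> (A 0%N p + A 1%N p + A 2%N p = 1)%N.
  move=> ps; have := cov p ps; have := sep01 p ps; have := sep02 p ps; have := sep12 p ps.
  case: (A 0%N p) (A 1%N p) (A 2%N p) => -[] [] //; by [case=> _ _; case|move=> H; case: H|move=> _ H; case: H|move=> _ _ H; case: H|move=> _ _ _ []].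
have xs : (x, y) \in filter (A 0%N) s by rewrite mem_filter /= l; apply/hs.
have {}part g := part g one.
have e1 := part fst; have e2 := part snd; rewrite s1 in e1; rewrite s2 in e2.
rewrite (D0 _ _ xs) in e1 e2.
(* Two corners alone cannot balance: opposite points in them occur only for r = 4/3 t^2. *)
have opp p : p \in s -> x + p.1 = 0 -> y + p.2 = 0 ->
    - (1 / 2) * p.1 + h * p.2 <= - t \/ - (1 / 2) * p.1 - h * p.2 <= - t -> False.
  move=> ps ex ey; have [] := bnd _ _ f n; have [] := P p ps.
  have -> : p.1 = - x by move: ex; clear; lra.
  have -> : p.2 = - y by move: ey; clear; lra.
  have e : h ^+ 2 * y ^+ 2 = 3 / 4 * y ^+ 2 by rewrite h2.
  move=> b0 b1 b2 _ b4 b5 c.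
  have ehx : x = - t by move: b0 l; clear; lra.
  have : (h * y) ^+ 2 = t ^+ 2 / 4.
    have : h * y = t / 2 \/ h * y = - (t / 2).
      by case: c => c; [left|right]; move: c b1 b2 b4 b5 ehx; clear; lra.
    by case=> ->; field.
  by move: n e tr; rewrite ehx; clear; nra.
have [g1|[q g1]] := all_eq_size (filter_uniq (A 1%N) us) (@U 1%N);
have [g2|[w g2]] := all_eq_size (filter_uniq (A 2%N) us) (@U 2%N);
rewrite g1 g2 ?big_nil ?big_seq1 /= in e1 e2.
- by exfalso; move: e1 e2 l t0; clear; lra.
- have : w \in filter (A 2%N) s by rewrite g2 mem_head.
  rewrite mem_filter => /andP[wa ws]; exfalso; apply: (opp w) => //; [by move: e1; clear; lra|by move: e2; clear; lra|by right].
- have : q \in filter (A 1%N) s by rewrite g1 mem_head.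
  rewrite mem_filter => /andP[wa ws]; exfalso; apply: (opp q) => //; [by move: e1; clear; lra|by move: e2; clear; lra|by left].
have : w \in filter (A 2%N) s by rewrite g2 mem_head.
have : q \in filter (A 1%N) s by rewrite g1 mem_head.
rewrite !mem_filter => /andP[_ qs] /andP[_ ws].
have [fq nq] := iffLR (hs q) qs; have [fw nw] := iffLR (hs w) ws.
by have [[<- <-]|[<- <-]] := three_balanced n nq nw (esym e1) (esym e2).
Qed.

Lemma rotK x y : rx (rx (rx x y) (ry x y)) (ry (rx x y) (ry x y)) = x /\
  ry (rx (rx x y) (ry x y)) (ry (rx x y) (ry x y)) = y.
Proof. by rewrite [rx (rx x y) _]rx2 [ry (rx x y) _]ry2 rx3 ry3. Qed.

Lemma corner_shell F (r t x y : R) : separated F -> balanced0 F -> 0 < t -> 4 / 3 * t ^+ 2 < r ->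
  (forall x y, F x y -> x ^+ 2 + y ^+ 2 = r -> in_tri t x y) ->
  (forall x y x' y', x ^+ 2 + y ^+ 2 = r -> x' ^+ 2 + y' ^+ 2 = r -> in_tri t x y -> in_tri t x' y' ->
    x <= - t -> x' <= - t -> (x - x') ^+ 2 + (y - y') ^+ 2 < 1) ->
  F x y -> x ^+ 2 + y ^+ 2 = r -> F (rx x y) (ry x y).
Proof.
move=> sF bF t0 tr bnd uni f n.
pose F1 := turn (- (1 / 2)) h F; pose F2 := turn (- (1 / 2)) h F1.
have bF1 : balanced0 F1 := balanced0_turn half_h bF; have bF2 : balanced0 F2 := balanced0_turn half_h bF1.
have sF1 : separated F1 := separated_turn half_h sF; have sF2 : separated F2 := separated_turn half_h sF1.
have bnd1 a b : F1 a b -> a ^+ 2 + b ^+ 2 = r -> in_tri t a b.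
  rewrite /F1 turn_rxy => g m; have := bnd _ _ g; rewrite rxy_norm => /(_ m) H.
  by have := in_tri_rot (in_tri_rot H); case: (rotK a b) => -> ->.
have bnd2 a b : F2 a b -> a ^+ 2 + b ^+ 2 = r -> in_tri t a b.
  rewrite /F2 turn_rxy => g m; have := bnd1 _ _ g; rewrite rxy_norm => /(_ m) H.
  by have := in_tri_rot (in_tri_rot H); case: (rotK a b) => -> ->.
have go G (sG : separated G) (bG : balanced0 G) (bn : forall x y, G x y -> x ^+ 2 + y ^+ 2 = r -> in_tri t x y) a b :
    G a b -> a ^+ 2 + b ^+ 2 = r -> a <= - t -> G (rx a b) (ry a b).
  move=> g m al; apply: (corner_shell0 bG t0 tr bn _ uni g m al) => c d c' d' gc gc' _ _.
  exact: sG gc gc'.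
have [b0 b1 b2] := bnd _ _ f n; have [e1 e2] := rotK x y.
have [c0|c0] := lerP x (- t); first exact: go f n c0.
have [c1|c1] := lerP (- (1 / 2) * x + h * y) (- t).
  have := go F1 sF1 bF1 bnd1 (rx (rx x y) (ry x y)) (ry (rx x y) (ry x y)).
  by rewrite /F1 !turn_rxy e1 e2 !rxy_norm rx2; apply.
have [c2|c2] := lerP (- (1 / 2) * x - h * y) (- t).
  have := go F2 sF2 bF2 bnd2 (rx x y) (ry x y).
  by rewrite /F2 /F1 !turn_rxy e1 e2 !rxy_norm; apply.
exfalso; have e0 : x + (- (1 / 2) * x + h * y) + (- (1 / 2) * x - h * y) = 0 by field.
have := zero_sum_sq e0 b0 b1 b2 (ltW c0) (ltW c1) (ltW c2).
have e : h ^+ 2 * y ^+ 2 = 3 / 4 * y ^+ 2 by rewrite h2.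
by move: n e tr; clear; lra.
Qed.

(** The sides of the corner force [y ^+ 2 <= 64 / 300], and the circle is so steep there that the
    abscissae differ by at most 13/100. *)
Lemma sector_close x y x' y' r : 1 < r -> r <= 2 ->
  x ^+ 2 + y ^+ 2 = r -> x' ^+ 2 + y' ^+ 2 = r -> in_tri (r / 2) x y -> in_tri (r / 2) x' y' ->
  x <= - (r / 2) -> x' <= - (r / 2) -> (x - x') ^+ 2 + (y - y') ^+ 2 < 1.
Proof.
move=> r1 r2 n n' [_ b1 b2] [_ b1' b2'] l l'.
have k a b : a ^+ 2 + b ^+ 2 = r -> 2 * a <= - r -> - a + 2 * h * b <= r -> - a - 2 * h * b <= r ->
    4 * h ^+ 2 * b ^+ 2 <= (r + a) ^+ 2 /\ r + a <= 4 / 5.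
  move=> ab l0 c1 c2.
  have q : (2 * h * b) ^+ 2 <= (r + a) ^+ 2 by move: c1 c2; clear; nra.
  have q' : 4 * h ^+ 2 * b ^+ 2 <= (r + a) ^+ 2 by move: q; clear; nra.
  split=> //; move: q'; rewrite h2; move: ab l0 r1 r2 c1 c2; clear; nra.
have [q q'] : 4 * h ^+ 2 * y ^+ 2 <= (r + x) ^+ 2 /\ r + x <= 4 / 5.
  by apply: k => //; [move: l|move: b1|move: b2]; clear; lra.
have [p p'] : 4 * h ^+ 2 * y' ^+ 2 <= (r + x') ^+ 2 /\ r + x' <= 4 / 5.
  by apply: k => //; [move: l'|move: b1'|move: b2']; clear; lra.
rewrite h2 in q p.
have a0 : 0 <= r + x by move: b1 b2; clear; lra.
have a0' : 0 <= r + x' by move: b1' b2'; clear; lra.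
have yb : y ^+ 2 <= 64 / 300 by move: q q' a0; set c := r + x; clearbody c; clear; nra.
have yb' : y' ^+ 2 <= 64 / 300 by move: p p' a0'; set c := r + x'; clearbody c; clear; nra.
have w : (x - x') * (x + x') = y' ^+ 2 - y ^+ 2 by move: n n'; clear; nra.
have xb : x <= - (88 / 100) by move: n yb r1 l; clear; nra.
have xb' : x' <= - (88 / 100) by move: n' yb' r1 l'; clear; nra.
have d1 : x - x' <= 13 / 100 /\ - (13 / 100) <= x - x'.
  have := sqr_ge0 y; have := sqr_ge0 y'; move: w yb yb' xb xb'; clear; split; nra.
have d2 : y - y' <= 93 / 100 /\ - (93 / 100) <= y - y'.
  have c1 b : b ^+ 2 <= 64 / 300 -> b <= 93 / 200 /\ - (93 / 200) <= b by clear; split; nra.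
  by move: (c1 _ yb) (c1 _ yb'); clear; case=> ? ? [? ?]; split; lra.
by move: d1 d2; clear; case=> ? ? [? ?]; nra.
Qed.

(** Distance 1 from the three neighbours confines the circle to [in_tri (r / 2)], and up to r = 2
    each corner holds at most one point. *)
Lemma tri_shell D x y r : separated D -> balanced0 D -> tri D -> 1 < r -> r <= 2 ->
  D x y -> x ^+ 2 + y ^+ 2 = r -> D (rx x y) (ry x y).
Proof.
move=> sD bD tD r1 r2; apply: (corner_shell (t := r / 2)) => //.
- by move: r1; clear; lra.
- by move: r1 r2; clear; nra.
- move=> a b f n; have [b0 b1 b2] := tri_bounds sD tD f n r1.
  by split; [move: b0|move: b1|move: b2]; clear; lra.
- by move=> a b a' b'; exact: sector_close.
Qed.
End Threefold.

(** * Neighbours of a threefold vertex have degree three or two *)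

Section ThreefoldNeighbour.
Variable R : realType.
Implicit Types (F D : R -> R -> Prop) (x y a b u v r : R) (s t : seq (R * R)).
Notation h := (h R).

Lemma upper_le2 D p q w : separated D -> balanced0 D -> D 1 0 ->
  uniq [:: p; q; w] ->
  (forall z : R * R, z \in [:: p; q; w] -> [/\ D z.1 z.2, z.1 ^+ 2 + z.2 ^+ 2 = 1 & 0 < z.2]) ->
  False.
Proof.
move=> sD bD D1 u H; have [t [t' [z [[ut _ _ _ _] _]]]] := balanced_split 1 bD.
have : {subset [:: p; q; w] <= t} by move=> [c d] /H /= cd; apply/ut.2.
move/(uniq_leq_size u).
case: (unit_upper sD D1 ut) => [->|[x1 [y1 [-> _]]]|[x1 [y1 [x2 [y2 [-> _ _ _]]]]]] //.
Qed.

(** Concavity of the upper unit circle: between abscissae - x and 1 / 2 the arc lies above its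
    chord. *)
Lemma chord_le (x y a b : R) : x ^+ 2 + y ^+ 2 = 1 -> a ^+ 2 + b ^+ 2 = 1 -> 0 < y -> 0 < b ->
  - x <= a -> a <= 1 / 2 -> 0 <= x -> (a + x) * (h - y) <= (b - y) * (1 / 2 + x).
Proof.
move=> n m y0 b0 l1 l2 x0.
have e := h2 R; have p := h_gt0 R.
have k1 : (b - y) * (b + y) = (x - a) * (x + a) by move: n m; clear; nra.
have k2 : (b - h) * (b + h) = (1 / 2 - a) * (1 / 2 + a) by move: m e; clear; nra.
have k3 : (h - y) * (h + y) = (x - 1 / 2) * (x + 1 / 2) by move: n e; clear; nra.
have s1 : 0 < b + y by lra.
have s3 : 0 < h + y by lra.
suff : 0 <= ((b - y) * (1 / 2 + x) - (a + x) * (h - y)) * ((b + y) * (h + y)).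
  by rewrite pmulr_lge0 ?subr_ge0 // mulr_gt0.
have -> : ((b - y) * (1 / 2 + x) - (a + x) * (h - y)) * ((b + y) * (h + y)) =
  ((b - y) * (b + y)) * (1 / 2 + x) * (h + y) - (a + x) * ((h - y) * (h + y)) * (b + y) by ring.
rewrite k1 k3.
have -> : (x - a) * (x + a) * (1 / 2 + x) * (h + y) - (a + x) * ((x - 1 / 2) * (x + 1 / 2)) * (b + y) =
  (x + a) * (1 / 2 + x) * ((x - a) * (h + y) - (x - 1 / 2) * (b + y)) by ring.
apply: mulr_ge0; first by apply: mulr_ge0; lra.
(* (x - a) (h + y) >= (x - 1/2) (b + y) *)
have -> : (x - a) * (h + y) - (x - 1 / 2) * (b + y) = (1 / 2 - a) * (h + y) - (x - 1 / 2) * (b - h) by ring.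
have s2 : 0 < b + h by lra.
suff : 0 <= ((1 / 2 - a) * (h + y) - (x - 1 / 2) * (b - h)) * (b + h) by rewrite pmulr_lge0.
have -> : ((1 / 2 - a) * (h + y) - (x - 1 / 2) * (b - h)) * (b + h) =
  (1 / 2 - a) * ((h + y) * (b + h)) - (x - 1 / 2) * ((b - h) * (b + h)) by ring.
rewrite k2.
have -> : (1 / 2 - a) * ((h + y) * (b + h)) - (x - 1 / 2) * ((1 / 2 - a) * (1 / 2 + a)) =
 (1 / 2 - a) * ((h + y) * (b + h) - (x - 1 / 2) * (1 / 2 + a)) by ring.
apply: mulr_ge0; first by lra.
have : x <= 1 by move: n; clear; nra.
have hb : 866 / 1000 < h by have /andP[] := h_bounds R.
by move: l1 l2 x0 y0 b0 hb; clear; nra.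
Qed.

(* The unit circle around the second arm of a triple meets the disc around a neighbour of the
   first arm. *)
Lemma tri_conflict x y a b : x ^+ 2 + y ^+ 2 = 1 -> a ^+ 2 + b ^+ 2 = 1 -> 0 < y -> 0 < b ->
  - x <= a -> a <= 1 / 2 -> 0 <= x -> x < 1 / 2 ->
  ((- (1 / 2) + a / 2 + h * b) - (1 - x)) ^+ 2 + ((h - h * a + b / 2) - y) ^+ 2 < 1.
Proof.
move=> n m y0 b0 l1 l2 x0 x1.
have e := h2 R; have p := h_gt0 R.
have c := chord_le n m y0 b0 l1 l2 x0.
have yh : h < y by move: n e p y0 x0 x1; clear; nra.
have y1 : y <= 1 by move: n; clear; nra.
have ne : h * h = 3 / 4 by rewrite -expr2.
have hy : 3 / 4 < h * y by rewrite -ne; move: yh p; clear; nra.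
pose q1 := (3 / 2 - x) / 2 - h * (y - h); pose q2 := h - h * x + y / 2.
pose N := (3 / 2 - x) ^+ 2 + (y - h) ^+ 2.
suff k : N < 2 * (a * q1 + b * q2).
  have -> : ((- (1 / 2) + a / 2 + h * b) - (1 - x)) ^+ 2 + ((h - h * a + b / 2) - y) ^+ 2 =
    (a ^+ 2 + b ^+ 2) * (1 / 4 + h ^+ 2) + N - 2 * (a * q1 + b * q2) by rewrite /N /q1 /q2; field.
  by rewrite m e; move: k; clear; lra.
have eN : N = 4 - 3 * x - 2 * (h * y).
  have -> : N = 9 / 4 - 3 * x + (x ^+ 2 + y ^+ 2) - 2 * (h * y) + h * h by rewrite /N; field.
  by rewrite n ne; field.
have eq1 : q1 = 3 / 2 - x / 2 - h * y.
  have -> : q1 = 3 / 4 - x / 2 - h * y + h * h by rewrite /q1; field.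
  by rewrite ne; field.
have q20 : 0 <= q2 by rewrite /q2; move: p x1 y0; clear; nra.
suff k : 0 < (1 / 2 + x) * (2 * (a * q1 + b * q2) - N).
  by move: k; rewrite pmulr_rgt0 ?subr_gt0 //; lra.
have lb : 2 * a * q1 * (1 / 2 + x) + 2 * q2 * (y * (1 / 2 + x) + (a + x) * (h - y)) - N * (1 / 2 + x)
   <= (1 / 2 + x) * (2 * (a * q1 + b * q2) - N).
  have : q2 * ((a + x) * (h - y)) <= q2 * ((b - y) * (1 / 2 + x)) by apply: ler_wpM2l.
  by clear; lra.
apply: lt_le_trans lb.
have -> : 2 * a * q1 * (1 / 2 + x) + 2 * q2 * (y * (1 / 2 + x) + (a + x) * (h - y)) - N * (1 / 2 + x)
  = (a + x) * (x - 1 + 2 * (h * y)) + (1 / 2 - a) * (4 * (h * y) - 3).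
  rewrite eN eq1 /q2.
  have ye : y ^+ 2 = 1 - x ^+ 2 by move: n; clear; lra.
  have -> : 2 * a * (3 / 2 - x / 2 - h * y) * (1 / 2 + x) + 2 * (h - h * x + y / 2) * (y * (1 / 2 + x) + (a + x) * (h - y)) - (4 - 3 * x - 2 * (h * y)) * (1 / 2 + x)
   = 2 * a * (3 / 2 - x / 2 - h * y) * (1 / 2 + x) + 2 * (1 - x) * (h * y * (1 / 2 + x) + (a + x) * (h * h - h * y)) + (y ^+ 2 * (1 / 2 + x) + (a + x) * (h * y - y ^+ 2)) - (4 - 3 * x - 2 * (h * y)) * (1 / 2 + x) by field.
  by rewrite ne ye; field.
have f1 : 0 < x - 1 + 2 * (h * y) by move: hy x0; clear; lra.
have f2 : 0 < 4 * (h * y) - 3 by move: hy; clear; lra.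
have [la|la] := ltrP a (1 / 2).
  have g1 : 0 <= (a + x) * (x - 1 + 2 * (h * y)) by apply: mulr_ge0; lra.
  have g2 : 0 < (1 / 2 - a) * (4 * (h * y) - 3) by apply: mulr_gt0 => //; lra.
  by move: g1 g2; clear; lra.
have g1 : 0 < (a + x) * (x - 1 + 2 * (h * y)) by apply: mulr_gt0 => //; lra.
have g2 : 0 <= (1 / 2 - a) * (4 * (h * y) - 3) by apply: mulr_ge0; lra.
by move: g1 g2; clear; lra.
Qed.

(* The frame at the other end of the first unit vector, which again points to the origin. *)
Definition back D x y := D (1 - x) (- y).

Definition deg2 D := D (- 1) 0 /\ forall x y, D x y -> x ^+ 2 + y ^+ 2 = 1 -> y = 0.

Lemma backK D x y : back (back D) x y <-> D x y.
Proof. by rewrite /back opprK opprB addrCA subrr addr0. Qed.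

Lemma good_back D : good D -> good (back D).
Proof.
move=> gD; have e1 : (- 1) ^+ 2 + 0 ^+ 2 = 1 :> R by ring.
have [sB bB] := good_turn e1 (good_shift 1 0 gD).
have E x y : turn (- 1) 0 (shift 1 0 D) x y <-> back D x y.
  by rewrite /turn /shift /back !mul0r !mulN1r subr0 !add0r.
split=> [x y x' y' /E f /E f'|a b /E f]; first exact: sB.
apply: balanced0_ext (bB _ _ f) => x y; exact: E.
Qed.

Lemma tri_mirror D : tri D -> tri (mirror D).
Proof.
move=> [d1 d2 d3 d]; split; rewrite /mirror ?oppr0 ?opprK // => x y f n.
have n' : x ^+ 2 + (- y) ^+ 2 = 1 by rewrite sqrrN.
have [[ex ey]|[ex ey]|[ex ey]] := d _ _ f n'.
- by constructor 1; rewrite ex -[y]opprK ey oppr0.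
- by constructor 3; rewrite ex -[y]opprK ey.
- by constructor 2; rewrite ex -[y]opprK ey opprK.
Qed.

(** The point would be a neighbour of [(1, 0)] that bends back towards the origin. By [tri_shell]
    the second arm has a corresponding neighbour, and [tri_conflict] then clears so much of the unit
    circle around the second arm that none of the three unit types is possible. *)
Lemma tri_no_side_neighbour D x y : good D -> D 0 0 -> tri D ->
  D (1 - x) y -> x ^+ 2 + y ^+ 2 = 1 -> 0 <= x -> 0 < y -> False.
Proof.
move=> gD D0 tD f n x0 y0; have [sD bD'] := gD.
have bD : balanced0 D by apply: balanced0_ext (bD' _ _ D0) => a b; rewrite /shift !add0r.
have [d1 d2 d3 d] := tD.
have e := h2 R; have p := h_gt0 R; have ne := hh R.
have nr : (1 - x) ^+ 2 + y ^+ 2 = 2 - 2 * x by move: n; clear; lra.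
(* Otherwise the point is a fourth unit neighbour of the origin or too close to it. *)
have x1 : x < 1 / 2.
  rewrite ltNge; apply/negP => xge.
  have [x12|x12] := eqVneq x (1 / 2).
    have n1 : (1 - x) ^+ 2 + y ^+ 2 = 1 by rewrite nr x12; field.
    by have [[ex _]|[ex _]|[ex _]] := d _ _ f n1; move: ex; rewrite x12; clear; lra.
  have xl : 1 / 2 < x by rewrite lt_neqAle eq_sym x12.
  have [] := sD _ _ _ _ f D0; first by rewrite !subr0 nr; lra.
  by move=> _ yy; rewrite yy ltxx in y0.
have r1 : 1 < 2 - 2 * x by lra.
have r2 : 2 - 2 * x <= 2 by lra.
have fr := tri_shell sD bD tD r1 r2 f nr.
(* The frame at the arm [(- (1 / 2), h)] looking back at the origin; the rotated point has
   coordinates [(x, - y)] in it. *)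
pose G := turn (1 / 2) (- h) (shift (- (1 / 2)) h D).
have uv : (1 / 2) ^+ 2 + (- h) ^+ 2 = 1 by rewrite sqrrN e; field.
have [sG bG'] := good_turn uv (good_shift (- (1 / 2)) h gD); rewrite -/G in sG bG'.
have GE a b : G a b = D (- (1 / 2) + (1 / 2 * a - - h * b)) (h + (- h * a + 1 / 2 * b)) by [].
have G0 : G 0 0 by rewrite GE !mulr0 subr0 !addr0.
have bG : balanced0 G by apply: balanced0_ext (bG' _ _ G0) => a b; rewrite /shift !add0r.
have G1 : G 1 0.
  by rewrite GE; congr (D _ _): D0; lra.
have Gx : G x (- y).
  by rewrite GE; congr (D _ _): fr; rewrite /rx /ry; field.
have H a b : G a b -> a ^+ 2 + b ^+ 2 = 1 -> 0 < b -> - x <= a -> False.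
  move=> g m b0 la.
  have a1 : a <= 1 / 2.
    have : 1 * a + 0 * b <= 1 - 1 / 2 by apply: (separated_dot sG G1 g) => //; [ring|lra].
    by clear; lra.
  have c := tri_conflict n m y0 b0 la a1 x0 x1.
  rewrite GE in g.
  have [] := sD _ _ _ _ g f.
    by apply: le_lt_trans c; rewrite le_eqVlt; apply/orP; left; apply/eqP; field.
  move=> ea eb.
  have k1 : a = 3 / 4 - x / 2 - h * y + h * h.
    have -> : a = (1 / 4 + h * h) * a by rewrite ne; field.
    have -> : (1 / 4 + h * h) * a = 1 / 2 * (- (1 / 2) + (1 / 2 * a - - h * b)) - h * (h + (- h * a + 1 / 2 * b)) + 1 / 4 + h * h by field.
    by rewrite ea eb; field.
  have k2 : b = h - h * x + y / 2.
    have -> : b = (1 / 4 + h * h) * b by rewrite ne; field.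
    have -> : (1 / 4 + h * h) * b = h * (- (1 / 2) + (1 / 2 * a - - h * b)) + 1 / 2 * (h + (- h * a + 1 / 2 * b)) by field.
    by rewrite ea eb; field.
  have k3 : 3 - 3 * x = 2 * (h * y).
    have : a ^+ 2 + b ^+ 2 = (3 - 3 * x - 2 * (h * y)) + 1.
      rewrite k1 k2.
      have -> : (3 / 4 - x / 2 - h * y + h * h) ^+ 2 + (h - h * x + y / 2) ^+ 2 =
       (1 / 4 + h * h) * (9 / 4 - 3 * x + (x ^+ 2 + y ^+ 2) - 2 * (h * y) + h * h) by field.
      by rewrite n ne; field.
    by rewrite m; clear; lra.
  have : (3 - 3 * x) ^+ 2 = 4 * (h * h) * y ^+ 2 by rewrite k3; ring.
  by rewrite ne; move: n x0 x1; clear; nra.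
(* An antipodal circle contains [(- x, y)], which [H] forbids, and a triangle has no neighbour with
   abscissa in [0, 1/2). *)
have [aG|tG|[x2 [y2 [x3 [y3 [u1 [v1 [u2 [v2 [ug ug' e1 e2 nG]]]]]]]]]] := unit_types sG bG G1.
- have n' : x ^+ 2 + (- y) ^+ 2 = 1 by rewrite sqrrN.
  have g := aG _ _ Gx n'; rewrite opprK in g.
  by apply: (H _ _ g); rewrite ?sqrrN.
- have [_ _ _ tg] := tG; have n' : x ^+ 2 + (- y) ^+ 2 = 1 by rewrite sqrrN.
  by have [[ex _]|[ex _]|[ex _]] := tg _ _ Gx n'; move: ex x0 x1; clear; lra.
have sM := separated_mirror sG.
have M1 : mirror G 1 0 by rewrite /mirror oppr0.
have [f2 n2 p2] : [/\ G x2 y2, x2 ^+ 2 + y2 ^+ 2 = 1 & 0 < y2] by apply: (iffLR (ug.2 _ _)); rewrite mem_head.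
have [f3 n3 p3] : [/\ G x3 y3, x3 ^+ 2 + y3 ^+ 2 = 1 & 0 < y3] by apply: (iffLR (ug.2 _ _)); rewrite !inE eqxx orbT.
have l23 : x2 < x3 by move: (ug.1) => /= /andP[].
have x3l : x3 < - x by rewrite ltNge; apply/negP => l; apply: (H _ _ f3 n3 p3 l).
have [f4 n4 p4] : [/\ G u1 (- v1), u1 ^+ 2 + v1 ^+ 2 = 1 & 0 < v1] by apply: (iffLR (ug'.2 _ _)); rewrite mem_head.
have u1l : u1 <= - (1 / 2).
  have [//|[? [? [//]]]|[? [? [? [? [[-> _ _ _] //]]]]]] := unit_upper sM M1 ug'.
(* seen from [(x, - y)] the three other neighbours lie on one side *)
have uv' : x ^+ 2 + (- y) ^+ 2 = 1 by rewrite sqrrN.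
have [sW bW] := (separated_turn uv' sG, balanced0_turn uv' bG).
pose k (q : R * R) := (x * q.1 - y * q.2, - (y * q.1 + x * q.2)).
have kE q : mirror (turn x (- y) G) (k q).1 (k q).2 <-> G q.1 q.2.
  rewrite /mirror /turn /k /= opprK.
  have -> : x * (x * q.1 - y * q.2) - - y * (y * q.1 + x * q.2) = (x ^+ 2 + y ^+ 2) * q.1 by ring.
  have -> : - y * (x * q.1 - y * q.2) + x * (y * q.1 + x * q.2) = (x ^+ 2 + y ^+ 2) * q.2 by ring.
  by rewrite n !mul1r.
have kI : injective k.
  move=> [a b] [c d']; rewrite /k /= => -[ea eb].
  have [] := @unit_sq_inj R x y (a - c) (b - d') n; [by move: ea; clear; lra|by move: eb; clear; lra|].
  by move=> /subr0_eq -> /subr0_eq ->.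
have kn q : (k q).1 ^+ 2 + (k q).2 ^+ 2 = q.1 ^+ 2 + q.2 ^+ 2.
  rewrite /k /=.
  have -> : (x * q.1 - y * q.2) ^+ 2 + (- (y * q.1 + x * q.2)) ^+ 2 = (x ^+ 2 + y ^+ 2) * (q.1 ^+ 2 + q.2 ^+ 2) by ring.
  by rewrite n mul1r.
have W1 : mirror (turn x (- y) G) 1 0.
  by rewrite /mirror /turn oppr0 !mulr1 !mulr0 subr0 addr0.
have side a b : a ^+ 2 + b ^+ 2 = 1 -> a < - x -> 0 < b -> 0 < - (y * a + x * b).
  move=> m la b0; have by' : b < y by move: n m la b0 x0 y0; clear; nra.
  have s1 : 0 < y * (- x - a) by apply: mulr_gt0 => //; lra.
  have s2 : 0 <= x * (y - b) by apply: mulr_ge0 => //; lra.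
  by move: s1 s2; clear; lra.
apply: (@upper_le2 _ (k (x2, y2)) (k (x3, y3)) (k (u1, - v1)) (separated_mirror sW) (balanced0_mirror bW) W1).
  rewrite -[X in uniq X]/(map k [:: (x2, y2); (x3, y3); (u1, - v1)]) map_inj_uniq //= !inE !xpair_eqE.
  rewrite (lt_eqF l23) /= andbT; apply/andP; split; apply/negP => /andP[_ /eqP]; move: p2 p3 p4; clear; lra.
move=> z; rewrite !inE => /or3P[]/eqP->; (split; [by apply/kE|by rewrite kn /= ?sqrrN|]); rewrite /k /=.
- by apply: side => //; apply: lt_trans x3l.
- exact: side.
- by move: u1l x0 y0 p4; clear; nra.
Qed.

Lemma balanced_origin D : good D -> D 0 0 -> balanced0 D.
Proof. by move=> [_ bD] D0; apply: balanced0_ext (bD _ _ D0) => a b; rewrite /shift !add0r. Qed.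

(** By [tri_no_side_neighbour] and its mirror image every neighbour off the axis has negative
    abscissa. An antipodal circle is then reduced to the axis, and in the five-point case the four
    abscissae would sum to less than - 1. *)
Lemma tri_neighbour D : good D -> D 0 0 -> tri D -> tri (back D) \/ deg2 (back D).
Proof.
move=> gD D0 tD; have gB := good_back gD; have [d1 _ _ _] := tD.
have B1 : back D 1 0 by rewrite /back subrr oppr0.
have B0 : back D 0 0 by rewrite /back subr0 oppr0.
have bB := balanced_origin gB B0; have [sB _] := gB.
have N x y : back D x y -> x ^+ 2 + y ^+ 2 = 1 -> 0 <= x -> y = 0.
  move=> f n x0; have [ys|ys|->//] := ltrgtP 0 y; exfalso.
    apply: (@tri_no_side_neighbour (mirror D) x y) => //.
    - exact: good_mirror.
    - by rewrite /mirror oppr0.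
    - exact: tri_mirror.
  apply: (@tri_no_side_neighbour D x (- y)) => //; rewrite ?sqrrN // oppr_gt0 //.
have [aB|tB|[x1 [y1 [x2 [y2 [u1 [v1 [u2 [v2 [ug ug' e1 e2 nG]]]]]]]]]] := unit_types sB bB B1.
- right; split; first by rewrite -oppr0; apply: aB => //; rewrite expr1n expr0n addr0.
  move=> x y f n; have [x0|x0] := lerP 0 x; first exact: N n x0.
  have := N (- x) (- y) (aB _ _ f n); rewrite !sqrrN => /(_ n).
  by move/(_ _)/eqP; rewrite oppr_eq0 => H; apply/eqP; apply: H; lra.
- by left.
exfalso.
have Nu x y : (x, y) \in [:: (x1, y1); (x2, y2)] -> x < 0 /\ 0 < y.
  move=> /(ug.2)[f n p]; split=> //; rewrite ltNge; apply/negP => l.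
  by have := N _ _ f n l; move: p => /[swap] ->; rewrite ltxx.
have Nd x y : (x, y) \in [:: (u1, v1); (u2, v2)] -> x < 0 /\ 0 < y.
  move=> /(ug'.2)[f n p]; split=> //; rewrite ltNge; apply/negP => l.
  have := N x (- y) f; rewrite sqrrN => /(_ n l)/eqP; rewrite oppr_eq0 => /eqP yz.
  by rewrite yz ltxx in p.
have [x20 _] : x2 < 0 /\ 0 < y2 by apply: Nu; rewrite !inE eqxx orbT.
have [u20 _] : u2 < 0 /\ 0 < v2 by apply: Nd; rewrite !inE eqxx orbT.
have [//|[? [? [//]]]|[? [? [? [? [[<- _ _ _] x1l _ _]]]]]] := unit_upper sB B1 ug.
have M1 : mirror (back D) 1 0 by rewrite /mirror oppr0.
have [//|[? [? [//]]]|[? [? [? [? [[<- _ _ _] u1l _ _]]]]]] := unit_upper (separated_mirror sB) M1 ug'.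
by lra.
Qed.
End ThreefoldNeighbour.

(** * Five unit neighbours *)

Section Pentagon.
Variable R : realType.
Implicit Types (F D : R -> R -> Prop) (x y a b u v r : R) (s t : seq (R * R)) (p q w : R * R).
Notation h := (h R).

Definition dot p q : R := p.1 * q.1 + p.2 * q.2.
Definition crs p q : R := p.1 * q.2 - p.2 * q.1.

(* Five unit neighbours in counterclockwise order. *)
Record pent D p0 p1 p2 p3 p4 : Prop := Pent {
  pent_mem : [/\ D p0.1 p0.2, D p1.1 p1.2, D p2.1 p2.2, D p3.1 p3.2 & D p4.1 p4.2];
  pent_unit : [/\ dot p0 p0 = 1, dot p1 p1 = 1, dot p2 p2 = 1, dot p3 p3 = 1 & dot p4 p4 = 1];
  pent_dot : [/\ dot p0 p1 <= 1 / 2, dot p1 p2 <= 1 / 2, dot p2 p3 <= 1 / 2, dot p3 p4 <= 1 / 2 & dot p4 p0 <= 1 / 2];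
  pent_crs : [/\ h <= crs p0 p1, h <= crs p1 p2, h <= crs p2 p3, h <= crs p3 p4 & h <= crs p4 p0];
  pent_sum1 : p0.1 + p1.1 + p2.1 + p3.1 + p4.1 = 0;
  pent_sum2 : p0.2 + p1.2 + p2.2 + p3.2 + p4.2 = 0 }.

Lemma pent_rot D p0 p1 p2 p3 p4 : pent D p0 p1 p2 p3 p4 -> pent D p1 p2 p3 p4 p0.
Proof.
case=> [[? ? ? ? ?] [? ? ? ? ?] [? ? ? ? ?] [? ? ? ? ?] s1 s2]; split=> //.
  by rewrite -s1; ring.
by rewrite -s2; ring.
Qed.

Lemma crs_dot p q : dot p p = 1 -> dot q q = 1 -> crs p q ^+ 2 = 1 - dot p q ^+ 2.
Proof.
move=> n m; have -> : 1 = dot p p * dot q q by rewrite n m mulr1.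
by rewrite /crs /dot; ring.
Qed.

Lemma dot_via p q w : dot q q = 1 -> dot p w = dot p q * dot q w - crs p q * crs q w.
Proof.
move=> n; have -> : dot p w = dot p w * dot q q by rewrite n mulr1.
by rewrite /crs /dot; ring.
Qed.

(** By balance p3 + p4 and p0 + p1 + p2 have the same length. *)
Lemma pent_rel D p0 p1 p2 p3 p4 : pent D p0 p1 p2 p3 p4 ->
  crs p0 p1 * crs p1 p2 = (1 + dot p0 p1) * (1 + dot p1 p2) - 1 / 2 - dot p3 p4.
Proof.
case=> _ [n0 n1 n2 n3 n4] _ _ s1 s2.
have e : dot p0 p2 = dot p0 p1 * dot p1 p2 - crs p0 p1 * crs p1 p2 by exact: dot_via.
have E : 2 + 2 * dot p3 p4 = 3 + 2 * (dot p0 p1 + dot p1 p2 + dot p0 p2).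
  have -> : 2 + 2 * dot p3 p4 = (p3.1 + p4.1) ^+ 2 + (p3.2 + p4.2) ^+ 2.
    by move: n3 n4; rewrite /dot; clear; lra.
  have -> : 3 + 2 * (dot p0 p1 + dot p1 p2 + dot p0 p2) = (p0.1 + p1.1 + p2.1) ^+ 2 + (p0.2 + p1.2 + p2.2) ^+ 2.
    by move: n0 n1 n2; rewrite /dot; clear; lra.
  have -> : p3.1 + p4.1 = - (p0.1 + p1.1 + p2.1) by move: s1; clear; lra.
  have -> : p3.2 + p4.2 = - (p0.2 + p1.2 + p2.2) by move: s2; clear; lra.
  by rewrite !sqrrN.
by move: e E; clear; lra.
Qed.

Lemma pent_diag D p0 p1 p2 p3 p4 : pent D p0 p1 p2 p3 p4 ->
  dot p0 p2 = dot p3 p4 - dot p0 p1 - dot p1 p2 - 1 / 2.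
Proof.
move=> P; have r := pent_rel P; have [_ [_ n1 _ _ _] _ _ _ _] := P.
by rewrite (dot_via p0 p2 n1) r; field.
Qed.

Lemma pent_dot_ge D p0 p1 p2 p3 p4 : pent D p0 p1 p2 p3 p4 -> - (1 / 2) <= dot p0 p1.
Proof.
case=> _ [n0 n1 _ _ _] _ [c _ _ _ _] _ _; have := crs_dot n0 n1.
have e := h2 R; have hp := h_gt0 R.
by move: c e hp; clear; nra.
Qed.

Lemma pent_crs_le1 D p0 p1 p2 p3 p4 : pent D p0 p1 p2 p3 p4 -> crs p0 p1 <= 1.
Proof.
case=> _ [n0 n1 _ _ _] _ [c _ _ _ _] _ _; have := crs_dot n0 n1.
by clear; nra.
Qed.

(** Products of two sines are at least 3/4. Adding the relations [pent_rel] at [p0] and [p2] gives a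
    contradiction as soon as both cosines are below 1/6. *)
Lemma pent_adjacent D p0 p1 p2 p3 p4 : pent D p0 p1 p2 p3 p4 ->
  dot p0 p1 <= 16 / 100 -> dot p1 p2 <= 16 / 100 -> False.
Proof.
move=> P l0 l1.
have P1 := pent_rot P; have P2 := pent_rot P1; have P3 := pent_rot P2; have P4 := pent_rot P3.
have r4 := pent_rel P4; have r1 := pent_rel P1.
have b0 := pent_dot_ge P; have b1 := pent_dot_ge P1; have b2 := pent_dot_ge P2; have b4 := pent_dot_ge P4.
have [_ _ [d0 d1 d2 d3 d4] [c0 c1 c2 c3 c4] _ _] := P.
have m p q w w' : h <= crs p q -> h <= crs w w' -> 3 / 4 <= crs p q * crs w w'.
  move=> k k'; rewrite -(hh R).
  have hp := h_gt0 R; by move: k k' hp; clear; nra.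
have := m _ _ _ _ c4 c0; have := m _ _ _ _ c1 c2; rewrite r4 r1.
by move: l0 l1 b0 b1 b2 b4 d2 d4; clear; nra.
Qed.

(** Through [pent_rel] on both of its sides, a gap of at least 90 degrees would widen the two gaps
    at the opposite point [p3] beyond what [pent_adjacent] permits. *)
Lemma pent_pos D p0 p1 p2 p3 p4 : pent D p0 p1 p2 p3 p4 -> 0 < dot p0 p1.
Proof.
move=> P; rewrite ltNge; apply/negP => l0.
have P1 := pent_rot P; have P2 := pent_rot P1; have P3 := pent_rot P2; have P4 := pent_rot P3.
have r0 := pent_rel P; have r4 := pent_rel P4.
have b0 := pent_dot_ge P.
have [_ [n0 n1 n2 n3 n4] [d0 d1 d2 d3 d4] [c0 c1 c2 c3 c4] _ _] := P.
have q0 := crs_dot n0 n1.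
(* [x <= 1/2] gives [(1 + d) (1 + x) - s t <= (1 + d) 3/2 - s h], where [t] is the sine *)
have k (t x : R) : x <= 1 / 2 -> h <= t -> t ^+ 2 = 1 - x ^+ 2 ->
   (1 + dot p0 p1) * (1 + x) - 1 / 2 - crs p0 p1 * t <= 15 / 100.
  move=> lx ht et; have /andP[hb _] := h_bounds R.
  have t1 : t <= 1 by move: et hb ht; clear; nra.
  move: q0 b0 l0 c0 ht lx hb; clear.
  set d := dot p0 p1; set s := crs p0 p1; move=> q0 b0 l0 c0 ht lx hb.
  have s1 : 866 / 1000 <= s by lra.
  have sd : 1 + d / 2 <= s + 1 / 1000 by nra.
  have : s * (866 / 1000) <= s * t by nra.
  nra.
apply: (@pent_adjacent D p2 p3 p4 p0 p1) => //.
- have := k _ _ d4 c4 (crs_dot n4 n0).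
  have : crs p0 p1 * crs p4 p0 = crs p4 p0 * crs p0 p1 by ring.
  by move=> ->; rewrite r4; clear; lra.
- by have := k _ _ d1 c1 (crs_dot n1 n2); rewrite r0; clear; lra.
Qed.

(** Geometrically p0 + p2 = p1, hence p3 + p4 = - 2 p1 and p3 = p4. *)
Lemma pent_two_sixty D p0 p1 p2 p3 p4 : pent D p0 p1 p2 p3 p4 ->
  dot p0 p1 = 1 / 2 -> dot p1 p2 = 1 / 2 -> False.
Proof.
move=> P e0 e1; have r0 := pent_rel P.
have [_ _ [_ _ _ d3 _] _ _ _] := P.
have c0 := pent_crs_le1 P; have c1 := pent_crs_le1 (pent_rot P).
have [_ [n0 n1 n2 _ _] _ [k0 k1 _ _ _] _ _] := P.
have q0 := crs_dot n0 n1; have q1 := crs_dot n1 n2.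
have hp := h_gt0 R.
rewrite e0 e1 in r0 q0 q1.
have : crs p0 p1 = crs p1 p2.
  have s0 : 0 < crs p0 p1 by lra.
  have s1 : 0 < crs p1 p2 by lra.
  by move: q0 q1 s0 s1; clear; nra.
by move=> e; move: r0 q0 d3; rewrite -e; clear; lra.
Qed.

(** By [pent_rel] a wide gap next to one of 60 degrees widens the gap opposite to their common
    point. Here this happens twice, and the two gaps at [p4] are too wide together. *)
Lemma pent_gap_sixty_gap D p0 p1 p2 p3 p4 : pent D p0 p1 p2 p3 p4 ->
  dot p0 p1 < 13 / 100 -> dot p1 p2 = 1 / 2 -> dot p2 p3 < 13 / 100 -> False.
Proof.
move=> P l0 e1 l2; have P1 := pent_rot P; have P2 := pent_rot P1; have P3 := pent_rot P2; have P4 := pent_rot P3.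
have r0 := pent_rel P; have r1 := pent_rel P1; have r3 := pent_rel P3.
have [_ [n0 n1 n2 n3 n4] [_ _ _ d3 d4] [k0 k1 k2 k3 k4] _ _] := P.
have p3' := pent_pos P3; have p4' := pent_pos P4; have p0' := pent_pos P; have p2' := pent_pos P2.
have q0 := crs_dot n0 n1; have q2 := crs_dot n2 n3; have q3 := crs_dot n3 n4; have q4 := crs_dot n4 n0.
have /andP[hb _] := h_bounds R.
rewrite e1 in r0 r1 r3.
have D3 : dot p3 p4 <= 34 / 100.
  have s0 : 991 / 1000 <= crs p0 p1 by move: q0 k0 l0 p0' hb; clear; nra.
  have : 991 / 1000 * (866 / 1000) <= crs p0 p1 * crs p1 p2 by move: s0 k1 hb; clear; nra.
  by rewrite r0; move: l0; clear; lra.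
have D4 : dot p4 p0 <= 34 / 100.
  have s0 : 991 / 1000 <= crs p2 p3 by move: q2 k2 l2 p2' hb; clear; nra.
  have : 991 / 1000 * (866 / 1000) <= crs p1 p2 * crs p2 p3 by move: s0 k1 hb; clear; nra.
  by rewrite r1; move: l2; clear; lra.
have s3 : 94 / 100 <= crs p3 p4 by move: q3 k3 p3' D3 hb; clear; nra.
have s4 : 94 / 100 <= crs p4 p0 by move: q4 k4 p4' D4 hb; clear; nra.
have : 94 / 100 * (94 / 100) <= crs p3 p4 * crs p4 p0 by move: s3 s4; clear; nra.
by rewrite r3; move: D3 D4 p3' p4'; clear; nra.
Qed.

(** The core inequality of [pent_close], with the product of the two sines removed by squaring. *)
Lemma gap_estimate (d x : R) : 0 < d -> 13/100 <= x -> x <= 1/2 -> 3 / 2 * d + 4 / 3 * x <= 1 ->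
  (1 - d / 2 + d * x - x / 3)^+2 < (1 - d ^+ 2) * (1 - x ^+ 2).
Proof.
move=> d0 l u k.
(* The region is cut into boxes that are small enough for [nra]. *)
have [a|a] := lerP d (1/10); first by nra.
have [b|b] := lerP x (3/10); first by nra.
have [b'|b'] := lerP x (4/10); first by nra.
have [c|c] := lerP d (15/100); first by nra.
have [c'|c'] := lerP d (20/100); first by nra.
have [c''|c''] := lerP d (25/100); first by nra.
by nra.
Qed.

(* [2 p0 - p4] and [2 p1 - p2] are less than 1 apart *)
Lemma pent_close D p0 p1 p2 p3 p4 : pent D p0 p1 p2 p3 p4 ->
  13 / 100 <= dot p4 p0 -> 13 / 100 <= dot p1 p2 ->
  ((2 * p0.1 - p4.1) - (2 * p1.1 - p2.1)) ^+ 2 + ((2 * p0.2 - p4.2) - (2 * p1.2 - p2.2)) ^+ 2 < 1.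
Proof.
move=> P l4 l1; have P1 := pent_rot P; have P2 := pent_rot P1; have P3 := pent_rot P2; have P4 := pent_rot P3.
have [_ [n0 n1 n2 n3 n4] [d0 d1 d2 d3 d4] [k0 k1 k2 k3 k4] s1 s2] := P.
have r0 := pent_rel P; have r4 := pent_rel P4; have d0' := pent_pos P.
have f (s t x : R) : h <= s -> h <= t -> s ^+ 2 = 1 - dot p0 p1 ^+ 2 -> t ^+ 2 = 1 - x ^+ 2 ->
   13 / 100 <= x -> x <= 1 / 2 -> (1 + dot p0 p1) * (1 + x) - 1 / 2 - s * t <= 1 / 2 ->
   1 < dot p0 p1 / 2 - dot p0 p1 * x + x / 3 + s * t.
  move=> hs ht es et l u c; have hp := h_gt0 R.
  rewrite ltNge; apply/negP => le.
  have st0 : 0 <= s * t by apply: mulr_ge0; lra.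
  have st2 : (s * t) ^+ 2 = (1 - dot p0 p1 ^+ 2) * (1 - x ^+ 2) by rewrite exprMn es et.
  move: d0 d0' l u c le st0 st2; clear; set d := dot p0 p1; set q := s * t.
  clearbody d q; move=> d0 d0' l u c le q0 q2.
  have k : 3 / 2 * d + 4 / 3 * x <= 1 by lra.
  have : q ^+ 2 <= (1 - d / 2 + d * x - x / 3) ^+ 2 by nra.
  by rewrite q2 leNgt (gap_estimate d0' l u k).
have e0 := crs_dot n0 n1; have e1 := crs_dot n1 n2; have e4 := crs_dot n4 n0.
have c1 : (1 + dot p0 p1) * (1 + dot p1 p2) - 1 / 2 - crs p0 p1 * crs p1 p2 <= 1 / 2.
  by rewrite r0; move: d3; clear; lra.
have c4 : (1 + dot p0 p1) * (1 + dot p4 p0) - 1 / 2 - crs p0 p1 * crs p4 p0 <= 1 / 2.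
  by rewrite [crs p0 p1 * _]mulrC r4; move: d2; clear; lra.
have F1 := f _ _ _ k0 k1 e0 e1 l1 d1 c1; have F4 := f _ _ _ k0 k4 e0 e4 l4 d4 c4.
rewrite r0 in F1; rewrite [crs p0 p1 * _]mulrC r4 in F4.
have g02 := pent_diag P; have g41 := pent_diag P4; have g24 := pent_diag P2.
have -> : ((2 * p0.1 - p4.1) - (2 * p1.1 - p2.1)) ^+ 2 + ((2 * p0.2 - p4.2) - (2 * p1.2 - p2.2)) ^+ 2
  = 4 * dot p0 p0 + 4 * dot p1 p1 + dot p4 p4 + dot p2 p2 - 8 * dot p0 p1 - 2 * dot p2 p4
    - 4 * (dot p4 p0 - dot p0 p2 - dot p4 p1 + dot p1 p2) by rewrite /dot; ring.
rewrite n0 n1 n2 n4 g02 g41 g24.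
by move: F1 F4; clear; lra.
Qed.

(** If the two points coincide, the Cauchy-Schwarz inequality forces [dot p0 p1 = 1 / 2], and then
    p2 = p1 - p0 makes the next gap 60 degrees as well. *)
Lemma pent_far D p0 p1 p2 p3 p4 : pent D p0 p1 p2 p3 p4 ->
  2 * p0.1 - p4.1 = 2 * p1.1 - p2.1 -> 2 * p0.2 - p4.2 = 2 * p1.2 - p2.2 -> False.
Proof.
move=> P e1 e2; have [_ [n0 n1 n2 _ n4] [d0 d1 _ _ _] _ _ _] := P.
have E1 : p4.1 = p2.1 + 2 * (p0.1 - p1.1) by move: e1; clear; lra.
have E2 : p4.2 = p2.2 + 2 * (p0.2 - p1.2) by move: e2; clear; lra.
have e : dot p2 p0 - dot p2 p1 = 2 * dot p0 p1 - 2.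
  have : dot p4 p4 = dot p2 p2 + 4 * dot p0 p0 + 4 * dot p1 p1 - 8 * dot p0 p1 + 4 * (dot p2 p0 - dot p2 p1).
    by rewrite /dot E1 E2; ring.
  by rewrite n0 n1 n2 n4; clear; lra.
have s0 : 0 <= (2 - 2 * dot p0 p1) * (2 * dot p0 p1 - 1).
  have : (dot p2 p0 - dot p2 p1) ^+ 2 <= dot p2 p2 * (dot p0 p0 + dot p1 p1 - 2 * dot p0 p1).
    have -> : dot p2 p2 * (dot p0 p0 + dot p1 p1 - 2 * dot p0 p1) = (dot p2 p0 - dot p2 p1) ^+ 2
       + (crs p2 p0 - crs p2 p1) ^+ 2 by rewrite /dot /crs; ring.
    by rewrite lerDl sqr_ge0.
  by rewrite e n0 n1 n2; clear; lra.
have d0e : dot p0 p1 = 1 / 2 by move: s0 d0; clear; nra.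
apply: (pent_two_sixty P d0e).
have z : (p2.1 + (p0.1 - p1.1)) ^+ 2 + (p2.2 + (p0.2 - p1.2)) ^+ 2 = 0.
  have -> : (p2.1 + (p0.1 - p1.1)) ^+ 2 + (p2.2 + (p0.2 - p1.2)) ^+ 2 =
    dot p2 p2 + dot p0 p0 + dot p1 p1 - 2 * dot p0 p1 + 2 * (dot p2 p0 - dot p2 p1) by rewrite /dot; ring.
  by rewrite e n0 n1 n2 d0e; field.
move/eqP: z; rewrite paddr_eq0 ?sqr_ge0 // !sqrf_eq0 => /andP[/eqP z1' /eqP z2'].
have z1 : p2.1 = p1.1 - p0.1 by move: z1'; clear; lra.
have z2 : p2.2 = p1.2 - p0.2 by move: z2'; clear; lra.
have -> : dot p1 p2 = dot p1 p1 - dot p0 p1 by rewrite /dot z1 z2; ring.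
by rewrite n1 d0e; field.
Qed.

(** By balance the cross products with [w] sum to zero, so they change sign around the cycle. *)
Lemma pent_sector D p0 p1 p2 p3 p4 w : pent D p0 p1 p2 p3 p4 ->
  exists q0 q1 q2 q3 q4, [/\ pent D q0 q1 q2 q3 q4, 0 <= crs q0 w & 0 <= crs w q1].
Proof.
move=> P; have P1 := pent_rot P; have P2 := pent_rot P1; have P3 := pent_rot P2; have P4 := pent_rot P3.
have anti p q : crs p q = - crs q p by rewrite /crs; ring.
have s : crs p0 w + crs p1 w + crs p2 w + crs p3 w + crs p4 w = 0.
  have -> : crs p0 w + crs p1 w + crs p2 w + crs p3 w + crs p4 w =
    (p0.1 + p1.1 + p2.1 + p3.1 + p4.1) * w.2 - (p0.2 + p1.2 + p2.2 + p3.2 + p4.2) * w.1 by rewrite /crs; ring.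
  by rewrite (pent_sum1 P) (pent_sum2 P); ring.
have T q0 q1 q2 q3 q4 : pent D q0 q1 q2 q3 q4 -> 0 <= crs q0 w -> crs q1 w <= 0 ->
    exists q0 q1 q2 q3 q4, [/\ pent D q0 q1 q2 q3 q4, 0 <= crs q0 w & 0 <= crs w q1].
  by move=> Q l l'; exists q0, q1, q2, q3, q4; rewrite [crs w q1]anti oppr_ge0.
have [c0|c0] := lerP (crs p0 w) 0; have [c1|c1] := lerP (crs p1 w) 0;
have [c2|c2] := lerP (crs p2 w) 0; have [c3|c3] := lerP (crs p3 w) 0;
have [c4|c4] := lerP (crs p4 w) 0; try (by apply: (T _ _ _ _ _ P) => //; apply: ltW);
  try (by apply: (T _ _ _ _ _ P1) => //; apply: ltW);
  try (by apply: (T _ _ _ _ _ P2) => //; apply: ltW);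
  try (by apply: (T _ _ _ _ _ P3) => //; apply: ltW);
  try (by apply: (T _ _ _ _ _ P4) => //; apply: ltW).
  apply: (T _ _ _ _ _ P) => //; move: s c0 c1 c2 c3 c4; clear; lra.
by exfalso; move: s c0 c1 c2 c3 c4; clear; lra.
Qed.

(** All gaps are acute, so a point at distance at least 1 from both neighbours that bound its sector
    has squared norm at least 2. *)
Lemma pent_isolated D p0 p1 p2 p3 p4 x y r : separated D -> pent D p0 p1 p2 p3 p4 -> D x y ->
  x ^+ 2 + y ^+ 2 = r -> 1 < r -> r <= 87 / 50 -> False.
Proof.
move=> sD P f n r1 r2.
have [q0 [q1 [q2 [q3 [q4 [Q c0 c1]]]]]] := pent_sector (x, y) P.
have [[g0 g1 _ _ _] [n0 n1 _ _ _] _ [k0 _ _ _ _] _ _] := Q.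
have dp := pent_pos Q; have hp := h_gt0 R.
have n0' : q0.1 ^+ 2 + q0.2 ^+ 2 = 1 by rewrite -n0 /dot; ring.
have n1' : q1.1 ^+ 2 + q1.2 ^+ 2 = 1 by rewrite -n1 /dot; ring.
have b0 := separated_half sD g0 f n0' n r1.
have b1 := separated_half sD g1 f n1' n r1.
have k0' : 0 < crs q0 q1 by lra.
(* [(x, y) = a q0 + b q1] with [a, b >= 0] and [a + b >= 2] *)
have E : crs q0 q1 * r = crs (x, y) q1 * (q0.1 * x + q0.2 * y) + crs q0 (x, y) * (q1.1 * x + q1.2 * y).
  by rewrite -n /crs /=; ring.
have E2 : crs q0 q1 ^+ 2 * r = crs (x, y) q1 ^+ 2 + crs q0 (x, y) ^+ 2 + 2 * (crs (x, y) q1 * crs q0 (x, y)) * dot q0 q1.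
  have -> : crs (x, y) q1 ^+ 2 + crs q0 (x, y) ^+ 2 + 2 * (crs (x, y) q1 * crs q0 (x, y)) * dot q0 q1 =
    crs (x, y) q1 ^+ 2 * dot q0 q0 + crs q0 (x, y) ^+ 2 * dot q1 q1 + 2 * (crs (x, y) q1 * crs q0 (x, y)) * dot q0 q1.
    by rewrite n0 n1 !mulr1.
  by rewrite -n /crs /dot /=; ring.
move: E E2 c0 c1 b0 b1 dp k0' r1 r2; clear.
move: (crs q0 q1) (crs (x, y) q1) (crs q0 (x, y)) (q0.1 * x + q0.2 * y) (q1.1 * x + q1.2 * y) (dot q0 q1) => s a b A B d.
move=> E E2 b0 a0 hA hB d0 s0 r1 r2.
have k : 2 * s <= a + b.
  have : s * r <= (a + b) * (r / 2).
    have : a * A <= a * (r / 2) by apply: ler_wpM2l.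
    have : b * B <= b * (r / 2) by apply: ler_wpM2l.
    by move: E; clear; lra.
  have r0 : 0 < r by lra.
  by move=> l; rewrite -(ler_pM2r r0); move: l; clear; lra.
have ab : 0 <= a * b by exact: mulr_ge0.
have : (2 * s) ^+ 2 <= (a + b) ^+ 2 by move: k s0; clear; nra.
have : 0 <= a * b * d by apply: mulr_ge0 => //; exact: ltW.
have : s ^+ 2 * r <= s ^+ 2 * (87 / 50) by apply: ler_wpM2l => //; exact: sqr_ge0.
have : 0 < s ^+ 2 by exact: exprn_gt0.
have := sqr_ge0 (a - b).
by move: E2; clear; lra.
Qed.
End Pentagon.

(** * Exclusion of unit circles with five points *)

Section NoPentagon.
Variable R : realType.
Implicit Types (F D : R -> R -> Prop) (x y a b u v r : R) (p q w : R * R).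
Notation h := (h R).

Lemma crs_ge p q : dot p p = 1 -> dot q q = 1 -> dot p q <= 1 / 2 -> - (1 / 2) <= dot p q ->
  0 < crs p q -> h <= crs p q.
Proof.
move=> n m d d' c; have e := crs_dot n m; have e2 := h2 R; have hp := h_gt0 R.
by move: d d' c e e2 hp; clear; nra.
Qed.

Lemma unit_pair D x1 y1 x2 y2 : separated D -> D 1 0 -> upper D 1 [:: (x1, y1); (x2, y2)] ->
  [/\ [/\ D x1 y1, x1 ^+ 2 + y1 ^+ 2 = 1 & 0 < y1], [/\ D x2 y2, x2 ^+ 2 + y2 ^+ 2 = 1 & 0 < y2],
      x1 <= - (1 / 2), - (1 / 2) < x2 <= 1 / 2 & x1 * x2 + y1 * y2 <= 1 / 2].
Proof.
move=> sD D1 ug.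
have [f1 n1 p1] : [/\ D x1 y1, x1 ^+ 2 + y1 ^+ 2 = 1 & 0 < y1] by apply: (iffLR (ug.2 _ _)); rewrite mem_head.
have [f2 n2 p2] : [/\ D x2 y2, x2 ^+ 2 + y2 ^+ 2 = 1 & 0 < y2] by apply: (iffLR (ug.2 _ _)); rewrite !inE eqxx orbT.
have [//|[? [? [//]]]|[a [b [c [d [[<- _ <- _] x1l x2l l]]]]]] := unit_upper sD D1 ug.
have dt : x1 * x2 + y1 * y2 <= 1 / 2.
  have : x1 * x2 + y1 * y2 <= 1 - 1 / 2 by apply: (separated_dot sD f1 f2 n1 n2); lra.
  by clear; lra.
split=> //; rewrite x2l andbT ltNge; apply/negP => x2s.
by have := no_third_top n1 n2 p1 p2 l x2s; move: dt; clear; lra.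
Qed.

Lemma five_pent D : separated D -> D 1 0 -> five D ->
  exists p1 p2 p3 p4, pent D (1, 0) p1 p2 p3 p4.
Proof.
move=> sD D1 [x1 [y1 [x2 [y2 [u1 [v1 [u2 [v2 [ug ug' e1 e2 nG]]]]]]]]].
have sM := separated_mirror sD.
have M1 : mirror D 1 0 by rewrite /mirror oppr0.
have [[f1 n1 p1] [f2 n2 p2] l1 /andP[l2 l2'] d12] := unit_pair sD D1 ug.
have [[g1 m1 q1] [g2 m2 q2] k1 /andP[k2 k2'] d34] := unit_pair sM M1 ug'.
have e := h2 R; have hp := h_gt0 R.
exists (x2, y2), (x1, y1), (u1, - v1), (u2, - v2).
have N0 : dot ((1, 0) : R * R) (1, 0) = 1 by rewrite /dot /=; ring.
have N1 : dot (x2, y2) (x2, y2) = 1 by rewrite /dot /= -n2; ring.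
have N2 : dot (x1, y1) (x1, y1) = 1 by rewrite /dot /= -n1; ring.
have N3 : dot (u1, - v1) (u1, - v1) = 1 by rewrite /dot /= -m1; ring.
have N4 : dot (u2, - v2) (u2, - v2) = 1 by rewrite /dot /= -m2; ring.
have d23 : x1 * u1 + y1 * - v1 <= 1 / 2.
  have m1' : u1 ^+ 2 + (- v1) ^+ 2 = 1 by rewrite sqrrN.
  have : x1 * u1 + y1 * - v1 <= 1 - 1 / 2 by apply: (separated_dot sD f1 g1 n1 m1'); lra.
  by clear; lra.
have Y2 : h <= y2 by move: n2 e hp l2 l2' p2; clear; nra.
have V2 : h <= v2 by move: m2 e hp k2 k2' q2; clear; nra.
have Y1 : y1 <= h by move: n1 e hp l1 p1; clear; nra.
have V1 : v1 <= h by move: m1 e hp k1 q1; clear; nra.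
have C a b c d : a <= - (1 / 2) -> a ^+ 2 + b ^+ 2 = 1 -> 0 < b -> b <= h -> - (1 / 2) < c -> c <= 1 / 2 -> h <= d -> 0 < d -> 0 < c * b - d * a /\ - (1 / 2) <= a * c + b * d.
  move=> la na b0 bh lc lc' hd d0; split.
    have : h / 2 <= d * - a by move: la hd hp; clear; nra.
    have : - (h / 2) < c * b by move: lc b0 bh hp; clear; nra.
    by clear; lra.
  have bd : 0 < b * d by exact: mulr_gt0.
  have a1 : - 1 <= a by move: na; clear; nra.
  by move: bd a1 la lc lc'; clear; nra.
have [c12 b12] := C _ _ _ _ l1 n1 p1 Y1 l2 l2' Y2 p2.
have [c34 b34] := C _ _ _ _ k1 m1 q1 V1 k2 k2' V2 q2.
split=> //=.
- by split=> //; rewrite /dot /=; move: l2 l2' k2 k2' d12 d34 d23; clear; lra.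
- split; apply: crs_ge => //; rewrite /dot /crs /=; try by move: l1 l2 l2' k1 k2 k2' p1 p2 q1 q2 d12 d34 d23 b12 b34 c12 c34; clear; lra.
  + move: Y1 V1 l1 k1 hp e p1 q1; clear; nra.
  + by move: l1 k1 p1 q1; clear; nra.
- by move: e1; clear; lra.
- by move: e2; clear; lra.
Qed.

(** The unit circle around [p0] is antipodal: a triangle there would give the origin degree two or
    three in contradiction to [p1], and five points are excluded by [q] and [pent_isolated]. Now
    [antipodal_near] reflects [w] in [p0]. The squared distance from [p0] is 2 minus twice the
    cosine, which equals 87/50 at the cosine 13/100. *)
Lemma pent_neighbour D p0 p1 p2 p3 p4 q : good D -> D 0 0 -> pent D p0 p1 p2 p3 p4 ->
  D q.1 q.2 -> dot q q = 1 -> 13 / 100 <= dot p0 q -> dot p0 q < 1 / 2 ->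
  forall w, D w.1 w.2 -> dot w w = 1 -> 13 / 100 <= dot p0 w -> dot p0 w <= 1 / 2 ->
  D (2 * p0.1 - w.1) (2 * p0.2 - w.2).
Proof.
move=> gD D0 P Dq nq lq uq w Dw nw lw uw.
have [[f0 f1 _ _ _] [n0 n1 _ _ _] [d0 _ _ _ _] _ _ _] := P.
have n0' : p0.1 ^+ 2 + p0.2 ^+ 2 = 1 by rewrite -n0 /dot; ring.
pose T := turn p0.1 p0.2 D.
have gT : good T by exact: good_turn.
have T0 : T 0 0 by rewrite /T /turn !mulr0 subr0 addr0.
have T1 : T 1 0 by rewrite /T /turn !mulr0 !mulr1 subr0 addr0.
have gB := good_back gT; have [sB _] := gB.
have B1 : back T 1 0 by rewrite /back subrr oppr0.
have B0 : back T 0 0 by rewrite /back subr0 oppr0.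
have bB := balanced_origin gB B0.
have BE z : back T (1 - dot p0 z) (crs z p0) <-> D z.1 z.2.
  rewrite /back /T /turn.
  have -> : p0.1 * (1 - (1 - dot p0 z)) - p0.2 * - crs z p0 = dot p0 p0 * z.1 by rewrite /dot /crs; ring.
  have -> : p0.2 * (1 - (1 - dot p0 z)) + p0.1 * - crs z p0 = dot p0 p0 * z.2 by rewrite /dot /crs; ring.
  by rewrite n0 !mul1r.
have BN z : dot z z = 1 -> (1 - dot p0 z) ^+ 2 + crs z p0 ^+ 2 = 2 - 2 * dot p0 z.
  by move=> nz; rewrite (crs_dot nz n0) [dot z p0](_ : _ = dot p0 z); [ring|rewrite /dot; ring].
have rq : 1 < 2 - 2 * dot p0 q by lra.
have rq' : 2 - 2 * dot p0 q <= 87 / 50 by lra.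
have BT : back (back T) 1 0 by rewrite backK.
have aB : antipodal (back T) 1.
  have [//|tB|fB] := unit_types sB bB B1.
  - exfalso; have d0' := pent_pos P.
    have T1n : T (dot p0 p1) (crs p0 p1).
      rewrite /T /turn.
      have -> : p0.1 * dot p0 p1 - p0.2 * crs p0 p1 = dot p0 p0 * p1.1 by rewrite /dot /crs; ring.
      have -> : p0.2 * dot p0 p1 + p0.1 * crs p0 p1 = dot p0 p0 * p1.2 by rewrite /dot /crs; ring.
      by rewrite n0 !mul1r.
    have BB : back (back T) (dot p0 p1) (crs p0 p1) by rewrite backK.
    have Bn : dot p0 p1 ^+ 2 + crs p0 p1 ^+ 2 = 1 by rewrite (crs_dot n0 n1); ring.
    have [[_ _ _ t]|[_ t]] := tri_neighbour gB B0 tB.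
      by have [[e _]|[e _]|[e _]] := t _ _ BB Bn; move: e d0 d0'; clear; lra.
    have z := t _ _ BB Bn; have [_ _ _ [k _ _ _ _] _ _] := P.
    by have := h_gt0 R; move: z k; clear; lra.
  - have [q1 [q2 [q3 [q4 Q]]]] := five_pent sB B1 fB.
    exfalso; apply: (pent_isolated sB Q _ (BN q nq) rq rq').
    exact/BE.
have Bm : back T (- 1) 0 by rewrite -oppr0; apply: aB => //; rewrite expr1n expr0n addr0.
suff : back T (- (1 - dot p0 w)) (- crs w p0).
  rewrite /back /T /turn.
  have -> : p0.1 * (1 - - (1 - dot p0 w)) - p0.2 * - - crs w p0 = 2 * p0.1 - dot p0 p0 * w.1 by rewrite /dot /crs; ring.
  have -> : p0.2 * (1 - - (1 - dot p0 w)) + p0.1 * - - crs w p0 = 2 * p0.2 - dot p0 p0 * w.2 by rewrite /dot /crs; ring.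
  by rewrite n0 !mul1r.
have Bw : back T (1 - dot p0 w) (crs w p0) by exact/BE.
have [e|ne] := eqVneq (dot p0 w) (1 / 2).
  by apply: aB => //; rewrite BN // e; field.
have r1 : 1 < 2 - 2 * dot p0 w.
  have : dot p0 w < 1 / 2 by rewrite lt_neqAle ne.
  by clear; lra.
have r2 : 2 - 2 * dot p0 w <= 87 / 50 by lra.
exact: (antipodal_near sB bB B1 Bm r1 r2 Bw (BN _ nw)).
Qed.

Lemma dotC p q : dot p q = dot q p :> R.
Proof. by rewrite /dot; ring. Qed.

(** The reflections of [p4] in [p0] and of [p2] in [p1] are too close by [pent_close], but distinct
    by [pent_far]. Either alternative of the last hypothesis supplies the witness [q] that
    [pent_neighbour] needs at both points. *)
Lemma pent_conflict D p0 p1 p2 p3 p4 : good D -> D 0 0 -> pent D p0 p1 p2 p3 p4 ->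
  13 / 100 <= dot p4 p0 -> 13 / 100 <= dot p1 p2 ->
  (13 / 100 <= dot p0 p1 /\ dot p0 p1 < 1 / 2) \/ (dot p4 p0 < 1 / 2 /\ dot p1 p2 < 1 / 2) -> False.
Proof.
move=> gD D0 P l4 l1 H; have P1 := pent_rot P.
have [[f0 f1 f2 _ f4] [n0 n1 n2 _ n4] [d0 d1 _ _ d4] _ _ _] := P.
have A0 : D (2 * p0.1 - p4.1) (2 * p0.2 - p4.2).
  case: H => [[h1 h2]|[h1 h2]].
    by apply: (@pent_neighbour D p0 p1 p2 p3 p4 p1); rewrite // dotC.
  by apply: (@pent_neighbour D p0 p1 p2 p3 p4 p4); rewrite // dotC.
have A1 : D (2 * p1.1 - p2.1) (2 * p1.2 - p2.2).
  case: H => [[h1 h2]|[h1 h2]].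
    by apply: (@pent_neighbour D p1 p2 p3 p4 p0 p0); rewrite // dotC.
  by apply: (@pent_neighbour D p1 p2 p3 p4 p0 p2).
have [sD _] := gD.
have [e1 e2] := sD _ _ _ _ A0 A1 (pent_close P l4 l1).
exact: pent_far P e1 e2.
Qed.

Lemma no_five D : good D -> D 0 0 -> D 1 0 -> ~ five D.
Proof.
move=> gD D0 D1 fD; have [sD _] := gD.
have [p1 [p2 [p3 [p4 P]]]] := five_pent sD D1 fD; set p0 := (1, 0) : R * R in P.
have P1 := pent_rot P; have P2 := pent_rot P1; have P3 := pent_rot P2; have P4 := pent_rot P3.
(* Gaps are wide ([g]), of exactly 60 degrees ([e]) or in between. The facts below exclude every
   cyclic pattern of five gaps. *)
pose g p q := dot p q < 13 / 100; pose e p q := dot p q == 1 / 2.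
have ge p q : g p q -> e p q = false.
  by move=> l; apply/eqP => E; move: l; rewrite /g E; lra.
have gg q0 q1 q2 q3 q4 : pent D q0 q1 q2 q3 q4 -> g q0 q1 && g q1 q2 = false.
  by move=> Q; apply/negP => /andP[l l']; apply: (pent_adjacent Q); rewrite /g in l l'; lra.
have ee q0 q1 q2 q3 q4 : pent D q0 q1 q2 q3 q4 -> e q0 q1 && e q1 q2 = false.
  by move=> Q; apply/negP => /andP[/eqP l /eqP l']; apply: (pent_two_sixty Q).
have geg q0 q1 q2 q3 q4 : pent D q0 q1 q2 q3 q4 -> [&& g q0 q1, e q1 q2 & g q2 q3] = false.
  by move=> Q; apply/negP => /and3P[l /eqP l' l'']; apply: (pent_gap_sixty_gap Q).
have C q0 q1 q2 q3 q4 : pent D q0 q1 q2 q3 q4 ->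
   [&& ~~ g q4 q0, ~~ g q1 q2 & (~~ g q0 q1 && ~~ e q0 q1) || (~~ e q4 q0 && ~~ e q1 q2)] = false.
  move=> Q; apply/negP; rewrite /g -!leNgt => /and3P[l4 l1 H].
  have [_ _ [d0 d1 _ _ d4] _ _ _] := Q.
  apply: (pent_conflict gD D0 Q l4 l1); case/orP: H => /andP[h1 h2]; [left|right].
    by split=> //; rewrite lt_neqAle d0 andbT.
  by split; rewrite lt_neqAle ?d1 ?d4 andbT.
move: (gg _ _ _ _ _ P) (gg _ _ _ _ _ P1) (gg _ _ _ _ _ P2) (gg _ _ _ _ _ P3) (gg _ _ _ _ _ P4).
move: (ee _ _ _ _ _ P) (ee _ _ _ _ _ P1) (ee _ _ _ _ _ P2) (ee _ _ _ _ _ P3) (ee _ _ _ _ _ P4).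
move: (geg _ _ _ _ _ P) (geg _ _ _ _ _ P1) (geg _ _ _ _ _ P2) (geg _ _ _ _ _ P3) (geg _ _ _ _ _ P4).
move: (C _ _ _ _ _ P) (C _ _ _ _ _ P1) (C _ _ _ _ _ P2) (C _ _ _ _ _ P3) (C _ _ _ _ _ P4).
move: (@ge p0 p1) (@ge p1 p2) (@ge p2 p3) (@ge p3 p4) (@ge p4 p0); clear.
case: (g p0 p1); case: (g p1 p2); case: (g p2 p3); case: (g p3 p4); case: (g p4 p0) => //=;
case: (e p0 p1) => //=; case: (e p1 p2) => //=; case: (e p2 p3) => //=; case: (e p3 p4) => //=;
case: (e p4 p0) => //=; by do ?[move=> /(_ isT)//|move=> _].
Qed.
End NoPentagon.

(** * Neighbours of threefold vertices *)

Section FarNeighbour.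
Variable R : realType.
Implicit Types (F D : R -> R -> Prop) (x y a b u v r : R) (p q w : R * R) (t : seq (R * R)).
Notation h := (h R).

Lemma close_in_box (x y x' y' lo hi l u : R) : x ^+ 2 + y ^+ 2 = 3 -> x' ^+ 2 + y' ^+ 2 = 3 ->
  0 < y -> 0 < y' -> lo <= x <= hi -> lo <= x' <= hi -> hi <= 0 -> 0 <= l -> 0 <= u ->
  l ^+ 2 <= 3 - lo ^+ 2 -> 3 - hi ^+ 2 <= u ^+ 2 -> (hi - lo) ^+ 2 + (u - l) ^+ 2 < 1 ->
  (x - x') ^+ 2 + (y - y') ^+ 2 < 1.
Proof.
move=> n n' p p' /andP[a b] /andP[a' b'] h0 l0 u0 hl hu s; apply: (le_lt_trans _ s).
have B (z w : R) : z ^+ 2 + w ^+ 2 = 3 -> 0 < w -> lo <= z -> z <= hi -> l <= w /\ w <= u.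
  move=> m w0 z1 z2; have z3 : z ^+ 2 <= lo ^+ 2 by move: z1 z2 h0; clear; nra.
  have z4 : hi ^+ 2 <= z ^+ 2 by move: z1 z2 h0; clear; nra.
  by move: m w0 z3 z4 hl hu l0 u0; clear; split; nra.
have [y1 y2] := B _ _ n p a b; have [y3 y4] := B _ _ n' p' a' b'.
have dx : (x - x') ^+ 2 <= (hi - lo) ^+ 2 by move: a b a' b'; clear; nra.
have dy : (y - y') ^+ 2 <= (u - l) ^+ 2 by move: y1 y2 y3 y4; clear; nra.
exact: lerD.
Qed.

Definition negs t := filter (fun p => p.1 < 0) t.

Lemma upper_uniq F r t : upper F r t -> uniq t.
Proof. by move=> [so _]; apply: (@map_uniq _ _ fst); exact: lt_sorted_uniq. Qed.

(** Cut at abscissa - 9/10, both pieces of the left arc have diameter less than 1. *)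
Lemma upper_negs F t : separated F -> upper F 3 t -> (forall p, p \in t -> - (3 / 2) <= p.1) ->
  [\/ negs t = [::], exists p, negs t = [:: p] /\ p \in t |
      exists p q, [/\ negs t = [:: p; q], p \in t, q \in t & p.1 != q.1]].
Proof.
move=> sF ut lo.
have N p : p \in negs t -> [/\ F p.1 p.2, p.1 ^+ 2 + p.2 ^+ 2 = 3, 0 < p.2, - (3 / 2) <= p.1 & p.1 < 0].
  rewrite mem_filter => /andP[l pt]; have := lo p pt; case: p l pt => a b l /(ut.2)[f n c] d.
  by split.
have un : uniq (negs t) by apply: filter_uniq; exact: upper_uniq ut.
have inj p q : p \in negs t -> q \in negs t -> p.1 = q.1 -> p = q.
  move=> /N[_ n c _ _] /N[_ n' c' _ _] e; apply/pair_eqP; split=> //.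
  by rewrite e in n; move: n n' c c'; clear; nra.
have T p : p \in negs t -> p \in t by rewrite mem_filter => /andP[].
have cl p q (lo' hi l u : R) : p \in negs t -> q \in negs t -> p != q ->
   lo' <= p.1 <= hi -> lo' <= q.1 <= hi -> hi <= 0 -> 0 <= l -> 0 <= u ->
  l ^+ 2 <= 3 - lo' ^+ 2 -> 3 - hi ^+ 2 <= u ^+ 2 -> (hi - lo') ^+ 2 + (u - l) ^+ 2 < 1 -> False.
  move=> pn qn ne c c' h0 l0 u0 hl hu s.
  have [f n k _ _] := N _ pn; have [f' n' k' _ _] := N _ qn.
  have [e1 e2] := sF _ _ _ _ f f' (close_in_box n n' k k' c c' h0 l0 u0 hl hu s).
  by move/negP: ne; apply; apply/eqP/pair_eqP.
case E : (negs t) => [|p [|q [|w s]]].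
- by constructor 1.
- by constructor 2; exists p; split=> //; apply: T; rewrite E mem_head.
- constructor 3; exists p, q; split=> //; try by apply: T; rewrite E !inE eqxx ?orbT.
  apply/eqP => e; have : p = q by apply: inj => //; rewrite E !inE eqxx ?orbT.
  by move=> epq; move: un; rewrite E epq /= inE eqxx.
exfalso.
have pn : p \in negs t by rewrite E !inE eqxx ?orbT.
have qn : q \in negs t by rewrite E !inE eqxx ?orbT.
have wn : w \in negs t by rewrite E !inE eqxx ?orbT.
have [pq pw qw] : [/\ p != q, p != w & q != w].
  by move: un; rewrite E /= !inE !negb_or => /andP[/and3P[-> -> _] /andP[/andP[-> _] _]].
have L z z' : z \in negs t -> z' \in negs t -> z != z' -> z.1 <= - (9 / 10) -> z'.1 <= - (9 / 10) -> False.
  move=> zn zn' ne c c'; apply: (@cl z z' (- (3 / 2)) (- (9 / 10)) (866 / 1000) (1483 / 1000)) => //; try by clear; lra.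
    by have [_ _ _ -> _] := N _ zn.
  by have [_ _ _ -> _] := N _ zn'.
have U z z' : z \in negs t -> z' \in negs t -> z != z' -> - (9 / 10) <= z.1 -> - (9 / 10) <= z'.1 -> False.
  move=> zn zn' ne c c'; apply: (@cl z z' (- (9 / 10)) 0 (1479 / 1000) (1733 / 1000)) => //; try by clear; lra.
    by have [_ _ _ _ k] := N _ zn; rewrite c ltW.
  by have [_ _ _ _ k] := N _ zn'; rewrite c' ltW.
have [c1|/ltW c1] := lerP p.1 (- (9 / 10)); have [c2|/ltW c2] := lerP q.1 (- (9 / 10)).
- exact: L pn qn pq c1 c2.
- have [c3|/ltW c3] := lerP w.1 (- (9 / 10)); first exact: L pn wn pw c1 c3.
  exact: U qn wn qw c2 c3.
- have [c3|/ltW c3] := lerP w.1 (- (9 / 10)); first exact: L qn wn qw c2 c3.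
  exact: U pn wn pw c1 c3.
exact: U pn qn pq c1 c2.
Qed.

Lemma sum_ge_negs t p : uniq t -> p \in t -> 0 <= p.1 ->
  p.1 + \sum_(q <- negs t) q.1 <= \sum_(q <- t) q.1.
Proof.
move=> ut pt p0; rewrite [X in _ <= X](big_rem _ pt) /=; apply: lerD => //.
have -> : \sum_(q <- negs t) q.1 = \sum_(q <- negs (rem p t)) q.1.
  rewrite (rem_filter p ut) /negs -filter_predI; congr (\sum_(q <- _) _).
  apply: eq_filter => q /=; case: (q =P p) => [->|_]; last by rewrite andbT.
  by rewrite andbF ltNge p0.
rewrite big_filter; elim: (rem p t) => [|q s IH]; first by rewrite !big_nil.
rewrite !big_cons; case: ifP => q0; first by rewrite lerD2l.
by apply: le_trans IH _; rewrite lerDr leNgt q0.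
Qed.


Lemma three_half_h : (3 / 2) ^+ 2 + h ^+ 2 = 3 :> R.
Proof. by rewrite h2; field. Qed.

Lemma deg2_mirror D : deg2 D -> deg2 (mirror D).
Proof.
move=> [d1 d]; split; first by rewrite /mirror oppr0.
by move=> x y f n; apply/eqP; rewrite -oppr_eq0; apply/eqP; apply: (d x) => //; rewrite sqrrN.
Qed.

Lemma deg2_shell D x y : separated D -> D 1 0 -> deg2 D -> D x y -> x ^+ 2 + y ^+ 2 = 3 ->
  - (3 / 2) <= x /\ x <= 3 / 2.
Proof.
move=> sD D1 [Dm _] f n; have r1 : 1 < 3 :> R by lra.
have k1 : 1 * x + 0 * y <= 3 / 2 by apply: (separated_half sD D1 f _ n r1); ring.
have k2 : - 1 * x + 0 * y <= 3 / 2 by apply: (separated_half sD Dm f _ n r1); ring.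
by split; lra.
Qed.

(** Two negative abscissae with sum at most - 3/2 would both lie between - 115/100 and - 35/100, on
    an arc of diameter less than 1. So [(3 / 2, h)] outweighs them. *)
Lemma upper_sum D t : separated D -> D 1 0 -> deg2 D -> D (3 / 2) h -> upper D 3 t ->
  (forall p, p \in t -> - (115 / 100) < p.1) -> 0 < \sum_(p <- t) p.1.
Proof.
move=> sD D1 dD Da ut lo.
have lo' p : p \in t -> - (3 / 2) <= p.1 by move=> /lo; clear; lra.
have at_ : (3 / 2, h) \in t by apply/ut.2; split; [|exact: three_half_h|exact: h_gt0].
have a0 : 0 <= 3 / 2 :> R by lra.
apply: lt_le_trans (sum_ge_negs (upper_uniq ut) at_ a0) => /=.
have [->|[p [-> pt]]|[p [q [-> pt qt pq]]]] := upper_negs sD ut lo'.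
- by rewrite big_nil; lra.
- by rewrite big_seq1; have := lo p pt; clear; lra.
rewrite !big_cons big_nil addr0.
have := lo p pt; have := lo q qt.
case: p q pt qt pq => [a b] [c d] /= /(ut.2)[f n k] /(ut.2)[f' n' k'] ne lc la.
have dd := separated_ge sD f f' ne.
rewrite ltNge; apply/negP => l.
have : (a - c) ^+ 2 + (b - d) ^+ 2 < 1.
  by apply: (@close_in_box a b c d (- (115 / 100)) (- (35 / 100)) (1295 / 1000) (1697 / 1000)) => //; try (by clear; lra); apply/andP; split; move: lc la l; clear; lra.
by move: dd; clear; lra.
Qed.

(** Here the origin has degree two, and [(3 / 2, h)], [(3 / 2, - h)] are the further neighbours of
    the threefold point [(1, 0)]. Their weight has to be balanced far to the left. *)
Lemma deg2_far_point D : separated D -> balanced0 D -> D 1 0 -> deg2 D -> D (3 / 2) h -> D (3 / 2) (- h) ->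
  exists x y, [/\ D x y, x ^+ 2 + y ^+ 2 = 3 & x <= - (115 / 100)].
Proof.
move=> sD bD D1 dD Da Db.
have [t [t' [z [[ut ut' hz e1 e2] _]]]] := balanced_split 3 bD.
have z0 : z = [::].
  case: z hz {e1} => // x z hz; have [f n] := iffLR (hz x) (mem_head x z).
  have n' : x ^+ 2 + 0 ^+ 2 = 3 by rewrite n; ring.
  by exfalso; have [] := deg2_shell sD D1 dD f n'; move: n; clear; nra.
rewrite {}z0 big_nil addr0 in e1.
have [/hasP[[x y] pt l]|/hasPn H] := boolP (has (fun p => p.1 <= - (115 / 100)) t).
  by have [f n _] := iffLR (ut.2 _ _) pt; exists x, y.
have [/hasP[[x y] pt l]|/hasPn H'] := boolP (has (fun p => p.1 <= - (115 / 100)) t').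
  by have [f n _] := iffLR (ut'.2 _ _) pt; exists x, (- y); rewrite sqrrN.
exfalso.
have M1 : mirror D 1 0 by rewrite /mirror oppr0.
have S : 0 < \sum_(p <- t) p.1 by apply: (upper_sum sD D1 dD) => // p /H; rewrite -ltNge.
have S' : 0 < \sum_(p <- t') p.1.
  by apply: (upper_sum (separated_mirror sD) M1 (deg2_mirror dD)) => // p /H'; rewrite -ltNge.
by move: e1 S S'; clear; lra.
Qed.

Lemma upper_sum_far D t : separated D -> D 1 0 -> deg2 D -> D (3 / 2) h -> upper D 3 t ->
  - (11 / 10) < \sum_(p <- t) p.1.
Proof.
move=> sD D1 dD Da ut.
have lo p : p \in t -> - (3 / 2) <= p.1.
  by case: p => x y /(ut.2)[f n _]; have [] := deg2_shell sD D1 dD f n.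
have at_ : (3 / 2, h) \in t by apply/ut.2; split; [|exact: three_half_h|exact: h_gt0].
have a0 : 0 <= 3 / 2 :> R by lra.
apply: lt_le_trans (sum_ge_negs (upper_uniq ut) at_ a0) => /=.
have [->|[p [-> pt]]|[p [q [-> pt qt pq]]]] := upper_negs sD ut lo.
- by rewrite big_nil; lra.
- by rewrite big_seq1; have := lo p pt; clear; lra.
rewrite !big_cons big_nil addr0.
have := lo p pt; have := lo q qt.
case: p q pt qt pq => [a b] [c d] /= /(ut.2)[f n k] /(ut.2)[f' n' k'] ne lc la.
have dd := separated_ge sD f f' ne.
rewrite ltNge; apply/negP => l.
have : (a - c) ^+ 2 + (b - d) ^+ 2 < 1.
  by apply: (@close_in_box a b c d (- (3 / 2)) (- (11 / 10)) (866 / 1000) (1338 / 1000)) => //; try (by clear; lra); apply/andP; split; move: lc la l; clear; lra.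
by move: dd; clear; lra.
Qed.

Lemma upper_sum_near D t : separated D -> D 1 0 -> deg2 D -> D (3 / 2) h -> upper D 3 t ->
  (forall p, p \in t -> - (3 / 10) < p.1) -> 11 / 10 < \sum_(p <- t) p.1.
Proof.
move=> sD D1 dD Da ut lo.
have lo' p : p \in t -> - (3 / 2) <= p.1 by move=> /lo; clear; lra.
have at_ : (3 / 2, h) \in t by apply/ut.2; split; [|exact: three_half_h|exact: h_gt0].
have a0 : 0 <= 3 / 2 :> R by lra.
apply: lt_le_trans (sum_ge_negs (upper_uniq ut) at_ a0) => /=.
have N p : p \in negs t -> p.1 < 0 by rewrite mem_filter => /andP[].
have [->|[p [-> pt]]|[p [q [E pt qt pq]]]] := upper_negs sD ut lo'.
- by rewrite big_nil; lra.
- by rewrite big_seq1; have := lo p pt; clear; lra.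
exfalso; have := N p; have := N q; rewrite E !inE !eqxx orbT => /(_ isT) + /(_ isT).
have := lo p pt; have := lo q qt.
case: p q pt qt pq {E} => [a b] [c d] /= /(ut.2)[f n k] /(ut.2)[f' n' k'] ne lc la uc ua.
have dd := separated_ge sD f f' ne.
have : (a - c) ^+ 2 + (b - d) ^+ 2 < 1.
  by apply: (@close_in_box a b c d (- (3 / 10)) 0 (17 / 10) (1733 / 1000)) => //; try (by clear; lra); apply/andP; split; move: lc la uc ua; clear; lra.
by move: dd; clear; lra.
Qed.

(* The reflection of [(x1, y1)] in the far neighbour [(- 1, 0)] leaves room for no shell points
   on the lower left. *)
Lemma far_conflict (x1 y1 x y : R) : x1 ^+ 2 + y1 ^+ 2 = 3 -> x ^+ 2 + y ^+ 2 = 3 -> 0 < y1 -> 0 < y ->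
  - (3 / 2) < x1 -> x1 <= - (115 / 100) -> - (3 / 2) <= x -> x <= - (3 / 10) ->
  (- 2 - x1 - x) ^+ 2 + (- y1 - - y) ^+ 2 < 1.
Proof.
move=> n1 n p1 p l1 u1 l u.
have -> : (- 2 - x1 - x) ^+ 2 + (- y1 - - y) ^+ 2 = 4 + 4 * x1 + 4 * x + (x1 ^+ 2 + y1 ^+ 2) + (x ^+ 2 + y ^+ 2) + 2 * (x1 * x - y1 * y) by ring.
rewrite n1 n.
suff : 9 / 2 + 2 * x1 + 2 * x + x1 * x < y1 * y by clear; lra.
have a : 0 <= (x1 + 3 / 2) * (- (3 / 10) - x) by apply: mulr_ge0; move: l1 u; clear; lra.
have y1l : 866 / 1000 < y1 by move: n1 p1 l1 u1; clear; nra.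
have yl : 866 / 1000 <= y by move: n p l u; clear; nra.
have k : 0 < 9 / 2 + 2 * x1 + 2 * x + x1 * x \/ 9 / 2 + 2 * x1 + 2 * x + x1 * x <= 0 by case: ltrP; [left|right].
case: k => [k|k]; last by apply: le_lt_trans k _; apply: mulr_gt0.
suff : (9 / 2 + 2 * x1 + 2 * x + x1 * x) ^+ 2 < (y1 * y) ^+ 2.
  have yy : 0 < y1 * y by apply: mulr_gt0.
  by move: k yy; clear; nra.
have -> : (y1 * y) ^+ 2 = (3 - x1 ^+ 2) * (3 - x ^+ 2) by rewrite exprMn; congr (_ * _); [move: n1|move: n]; clear; lra.
rewrite -subr_gt0.
have -> : (3 - x1 ^+ 2) * (3 - x ^+ 2) - (9 / 2 + 2 * x1 + 2 * x + x1 * x) ^+ 2 =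
  (x1 + 3 / 2) * (- x1) + (x + 3 / 2) * (- x) + (x1 + 3 / 2) * (x + 3 / 2) * (- 5 - 4 * x1 - 4 * x) by field.
have k1 : 0 < (x1 + 3 / 2) * (- x1) by apply: mulr_gt0; move: l1 u1; clear; lra.
have k2 : 0 <= (x + 3 / 2) * (- x) by apply: mulr_ge0; move: l u; clear; lra.
have k3 : 0 <= (x1 + 3 / 2) * (x + 3 / 2) * (- 5 - 4 * x1 - 4 * x) by apply: mulr_ge0; [apply: mulr_ge0|]; move: l1 u1 l u; clear; lra.
by move: k1 k2 k3; clear; lra.
Qed.

(** If the far neighbour is antipodal, the reflection of the given point in it clears the lower left
    of the circle by [far_conflict]. The abscissae below then sum to more than 11/10, those above to
    more than - 11/10. *)
Lemma deg2_far_unit D x1 y1 : good D -> D 0 0 -> D 1 0 -> deg2 D -> D (3 / 2) h -> D (3 / 2) (- h) ->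
  D x1 y1 -> x1 ^+ 2 + y1 ^+ 2 = 3 -> 0 < y1 -> x1 <= - (115 / 100) -> antipodal (shift (- 1) 0 D) 1 -> False.
Proof.
move=> gD D0 D1 dD Da Db f n p1 l aK; have [sD _] := gD; have [Dm dd] := dD.
have bD := balanced_origin gD D0.
have gK := good_shift (- 1) 0 gD; have [sK _] := gK.
have KE x y : shift (- 1) 0 D x y <-> D (x - 1) y by rewrite /shift add0r addrC.
have K1 : shift (- 1) 0 D 1 0 by rewrite /shift addNr addr0.
have K0 : shift (- 1) 0 D 0 0 by rewrite /shift !addr0.
have bK := balanced_origin gK K0.
have [l1 _] := deg2_shell sD D1 dD f n.
have fK : shift (- 1) 0 D (x1 + 1) y1 by apply/KE; rewrite addrK.
have nK : (x1 + 1) ^+ 2 + y1 ^+ 2 = 4 + 2 * x1 by move: n; clear; lra.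
(* In this case the point is a unit neighbour of [(- 1, 0)], and its reflection would be a neighbour
   of the origin off the axis. *)
have [e|ne] := eqVneq x1 (- (3 / 2)).
  have n1 : (x1 + 1) ^+ 2 + y1 ^+ 2 = 1 by rewrite nK e; field.
  have /KE g := aK _ _ fK n1.
  have gn : (- (x1 + 1) - 1) ^+ 2 + (- y1) ^+ 2 = 1.
    have -> : (- (x1 + 1) - 1) ^+ 2 + (- y1) ^+ 2 = x1 ^+ 2 + y1 ^+ 2 + 4 * x1 + 4 by ring.
    by rewrite n e; field.
  by have /eqP := dd _ _ g gn; rewrite oppr_eq0 => /eqP y0; rewrite y0 ltxx in p1.
have l2 : - (3 / 2) < x1 by rewrite lt_neqAle eq_sym ne.
have Km : shift (- 1) 0 D (- 1) 0.
  by have := aK 1 0 K1; rewrite oppr0 expr1n expr0n addr0 => /(_ erefl).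
have r1 : 1 < 4 + 2 * x1 by lra.
have r2 : 4 + 2 * x1 <= 87 / 50 by lra.
have /KE Z := antipodal_near sK bK K1 Km r1 r2 fK nK.
have Zn : (- (x1 + 1) - 1) ^+ 2 + (- y1) ^+ 2 = 7 + 4 * x1 by move: n; clear; lra.
have H x y : D x (- y) -> x ^+ 2 + y ^+ 2 = 3 -> 0 < y -> - (3 / 10) < x.
  move=> g m y0; rewrite ltNge; apply/negP => u.
  have m' : x ^+ 2 + (- y) ^+ 2 = 3 by rewrite sqrrN.
  have [lx _] := deg2_shell sD D1 dD g m'.
  have c := far_conflict n m p1 y0 l2 l lx u.
  have [] := sD _ _ _ _ Z g; first by congr (_ < 1): c; ring.
  by move=> e1 e2; move: Zn; rewrite e1 e2 sqrrN m; move: l; clear; lra.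
have [t [t' [z [[ut ut' hz e1 e2] _]]]] := balanced_split 3 bD.
have z0 : z = [::].
  case: z hz {e1} => // x z hz; have [g m] := iffLR (hz x) (mem_head x z).
  have m' : x ^+ 2 + 0 ^+ 2 = 3 by rewrite m; ring.
  by exfalso; have [] := deg2_shell sD D1 dD g m'; move: m; clear; nra.
rewrite {}z0 big_nil addr0 in e1.
have M1 : mirror D 1 0 by rewrite /mirror oppr0.
have S := upper_sum_far sD D1 dD Da ut.
have S' : 11 / 10 < \sum_(p <- t') p.1.
  apply: (upper_sum_near (separated_mirror sD) M1 (deg2_mirror dD)) => //.
  by move=> [x y] /(ut'.2)[g m y0]; exact: H g m y0.
by move: e1 S S'; clear; lra.
Qed.

Lemma deg2_far_tri D : good D -> D 0 0 -> D 1 0 -> deg2 D -> D (3 / 2) h -> D (3 / 2) (- h) ->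
  tri (shift (- 1) 0 D).
Proof.
move=> gD D0 D1 dD Da Db; have [sD _] := gD; have [Dm dd] := dD.
have bD := balanced_origin gD D0.
have gK := good_shift (- 1) 0 gD; have [sK _] := gK.
have K1 : shift (- 1) 0 D 1 0 by rewrite /shift addNr addr0.
have K0 : shift (- 1) 0 D 0 0 by rewrite /shift !addr0.
have bK := balanced_origin gK K0.
have [aK|//|fK] := unit_types sK bK K1; last by have := no_five gK K0 K1 fK.
exfalso; have [x [y [f n l]]] := deg2_far_point sD bD D1 dD Da Db.
have [ys|ys|ye] := ltrgtP 0 y.
- exact: (deg2_far_unit gD D0 D1 dD Da Db f n ys l aK).
- apply: (@deg2_far_unit (mirror D) x (- y)) => //; rewrite /mirror ?oppr0 ?opprK ?sqrrN ?oppr_gt0 //.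
  + exact: good_mirror.
  + exact: deg2_mirror.
  + move=> a b; rewrite /shift => g m; have := aK a (- b); rewrite /shift !sqrrN /mirror in g *.
    by rewrite add0r in g; rewrite !add0r opprK => /(_ g m).
rewrite -ye in f n; have [] := deg2_shell sD D1 dD f n; move: n l; clear; nra.
Qed.
End FarNeighbour.

(** * All neighbours of a threefold vertex have the same degree *)

Section MixedNeighbours.
Variable R : realType.
Implicit Types (F D : R -> R -> Prop) (x y a b u v r : R) (p q w : R * R) (t : seq (R * R)).
Notation h := (h R).

Definition tw D := turn (- (1 / 2)) h D.

Lemma twE D x y : back (tw D) (1 - (- (1 / 2) * x + h * y)) (h * x + 1 / 2 * y) <-> D x y.
Proof.
rewrite /back /tw turn_rxy.
have -> : 1 - (1 - (- (1 / 2) * x + h * y)) = - (1 / 2) * x + h * y by ring.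
have -> : - (h * x + 1 / 2 * y) = - h * x - 1 / 2 * y by ring.
by rewrite rx3 ry3.
Qed.

Lemma tw_norm x y : (1 - (- (1 / 2) * x + h * y)) ^+ 2 + (h * x + 1 / 2 * y) ^+ 2 =
  1 - 2 * (- (1 / 2) * x + h * y) + (x ^+ 2 + y ^+ 2).
Proof. by rewrite -(rxy_norm2 x y); field. Qed.

(** Equality would mean distance 1 from the neighbour [(- (1 / 2), h)], in a direction off its
    axis. *)
Lemma deg2_strict D x y : deg2 (back (tw D)) -> D x y -> x ^+ 2 + y ^+ 2 = 3 ->
  - (1 / 2) * x + h * y <> 3 / 2.
Proof.
move=> [_ d] /(iffRL (twE _ _ _)) f n e; have nn := tw_norm x y.
have n1 : (1 - (- (1 / 2) * x + h * y)) ^+ 2 + (h * x + 1 / 2 * y) ^+ 2 = 1 by rewrite nn n e; field.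
have y0 := d _ _ f n1; rewrite y0 e in n1.
by move: n1; clear; nra.
Qed.

(** The reflection in the neighbour [(- (1 / 2), h)], on whose near shells [antipodal_near]
    applies. *)
Lemma deg2_reflect D x y : good D -> D 0 0 -> tri D -> deg2 (back (tw D)) -> D x y ->
  1 < 1 - 2 * (- (1 / 2) * x + h * y) + (x ^+ 2 + y ^+ 2) ->
  1 - 2 * (- (1 / 2) * x + h * y) + (x ^+ 2 + y ^+ 2) <= 87 / 50 ->
  D (- 1 - x) (2 * h - y).
Proof.
move=> gD D0 tD dA f r1 r2.
have gT := good_turn (half_h R) gD; have gB := good_back gT; have [sB _] := gB.
have [T1 _ _ _] := tri_turn tD.
have T0 : tw D 0 0 by rewrite /tw /turn !mulr0 subr0 addr0.
have B1 : back (tw D) 1 0 by rewrite /back subrr oppr0.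
have B0 : back (tw D) 0 0 by rewrite /back subr0 oppr0.
have bB := balanced_origin gB B0; have [Bm _] := dA.
move/(iffRL (twE _ _ _)): f => f; have g := antipodal_near sB bB B1 Bm r1 r2 f (tw_norm x y).
apply/(iffLR (twE _ _ _)); congr (back (tw D) _ _): g.
  have -> : 1 - (- (1 / 2) * (- 1 - x) + h * (2 * h - y)) = 1 / 2 - 2 * (h * h) - x / 2 + h * y by field.
  by rewrite hh; field.
by field.
Qed.

Lemma along_across x y : (- (1 / 2) * x + h * y) ^+ 2 + (h * x + 1 / 2 * y) ^+ 2 = x ^+ 2 + y ^+ 2.
Proof. by rewrite -(rxy_norm2 x y); field. Qed.

Lemma sum_le_pos (T : eqType) (s : seq T) (f : T -> R) (A B : pred T) :
  (forall i, i \in s -> A i -> ~~ B i) -> (forall i, i \in s -> ~~ A i -> ~~ B i -> f i <= 0) ->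
  \sum_(i <- s) f i <= \sum_(i <- filter A s) f i + \sum_(i <- filter B s) f i.
Proof.
elim: s => [|x s IH] H H'; first by rewrite !big_nil addr0.
rewrite big_cons.
have IH1 : \sum_(i <- s) f i <= \sum_(i <- filter A s) f i + \sum_(i <- filter B s) f i.
  by apply: IH => i si; [apply: H|apply: H']; rewrite inE si orbT.
have := H x (mem_head _ _); have := H' x (mem_head _ _); rewrite /=.
case: (A x) (B x) => -[] //=; rewrite ?big_cons.
- by move=> _ /(_ isT).
- by move=> _ _; move: IH1; clear; lra.
- by move=> _ _; move: IH1; clear; lra.
- by move=> /(_ isT isT) + _; move: IH1; clear; lra.
Qed.

(** Project the circle [r = 3] onto the direction of the second arm. The two threefold neighbours
    contribute - 3/2 twice, while on each side of this direction only one point with positive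
    projection fits, and its projection is less than 3/2. *)
Lemma mixed_triple D : good D -> D 0 0 -> tri D -> D (3 / 2) h -> D (3 / 2) (- h) ->
  deg2 (back (tw D)) -> D 0 (- (2 * h)) -> D (- (3 / 2)) (- h) -> False.
Proof.
move=> gD D0 tD Y1 Y2 dA Y3 Y4; have [sD _] := gD; have bD := balanced_origin gD D0.
have hb := h_bounds R; have e2 := h2 R; have ee := hh R.
have r1 : 1 < 3 :> R by lra.
have [s [[us hs] s1 s2]] := bD 3.
pose al p := - (1 / 2) * p.1 + h * p.2; pose ac p := h * p.1 + 1 / 2 * p.2.
have N p : p \in s -> [/\ D p.1 p.2, al p ^+ 2 + ac p ^+ 2 = 3 & al p < 3 / 2].
  move=> /hs[f n]; have [_ b _] := tri_bounds sD tD f n r1; split=> //.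
    by rewrite along_across.
  rewrite lt_neqAle; apply/andP; split; last by rewrite /al; move: b; clear; lra.
  by apply/eqP; exact: deg2_strict dA f n.
have nY1 : (3 / 2) ^+ 2 + h ^+ 2 = 3 by rewrite e2; field.
have nY2 : (3 / 2) ^+ 2 + (- h) ^+ 2 = 3 by rewrite sqrrN.
have nY3 : 0 ^+ 2 + (- (2 * h)) ^+ 2 = 3 by rewrite sqrrN exprMn e2; field.
have nY4 : (- (3 / 2)) ^+ 2 + (- h) ^+ 2 = 3 by rewrite !sqrrN.
have m2 : (3 / 2, - h) \in s by apply/hs.
have m3 : (0, - (2 * h)) \in s by apply/hs.
have a2 : al (3 / 2, - h) = - (3 / 2) by rewrite /al /= mulrN ee; field.
have a3 : al (0, - (2 * h)) = - (3 / 2).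
  have -> : al (0, - (2 * h)) = - 2 * (h * h) by rewrite /al /=; ring.
  by rewrite ee; field.
have far p : p \in s -> 0 < al p -> 95 / 100 <= al p /\ 3 / 4 < ac p ^+ 2 /\ ac p ^+ 2 <= 210 / 100.
  move=> ps a0; have [f n lt] := N p ps.
  have k1 : p.1 * (3 / 2) + p.2 * h <= 3 - 1 / 2.
    apply: (separated_dot sD f Y1 _ nY1); first by case/hs: ps.
    move=> [ex ey]; move: a0; rewrite /al ex ey ee; clear; lra.
  have k4 : p.1 * - (3 / 2) + p.2 * - h <= 3 - 1 / 2.
    apply: (separated_dot sD f Y4 _ nY4); first by case/hs: ps.
    move=> [ex ey]; move: a0; rewrite /al ex ey !mulrN ee; clear; lra.
  have c : 2 * h * ac p = p.1 * (3 / 2) + p.2 * h.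
    have -> : 2 * h * ac p = 2 * (h * h) * p.1 + h * p.2 by rewrite /ac; field.
    by rewrite ee; field.
  have c2 : 3 * ac p ^+ 2 = (2 * h * ac p) ^+ 2.
    have -> : (2 * h * ac p) ^+ 2 = 4 * (h * h) * ac p ^+ 2 by ring.
    by rewrite ee; field.
  have : (2 * h * ac p) ^+ 2 <= 25 / 4 by rewrite c; move: k1 k4; clear; nra.
  by rewrite -c2; move: n a0 lt; clear; split; [|split]; nra.
have U p q : p \in s -> q \in s -> 0 < al p -> 0 < al q -> 0 <= ac p * ac q -> p = q.
  move=> ps qs ap aq c; have [f n lt] := N p ps; have [f' n' lt'] := N q qs.
  have [l [k1 k2]] := far p ps ap; have [l' [k1' k2']] := far q qs aq.
  have d : (al p - al q) ^+ 2 + (ac p - ac q) ^+ 2 < 1.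
    have da : (al p - al q) ^+ 2 <= 31 / 100 by move: l l' lt lt'; clear; nra.
    have dc : (ac p - ac q) ^+ 2 <= 40 / 100.
      move: k1 k2 k1' k2' c; clear; move: (ac p) (ac q) => a b k1 k2 k1' k2' c.
      have : 3 / 4 <= a * b by nra.
      have [ab|ab] := lerP (a ^+ 2) (b ^+ 2); nra.
    by move: da dc; clear; lra.
  suff : p.1 = q.1 /\ p.2 = q.2 by move/pair_eqP.
  apply: (sD _ _ _ _ f f').
  have -> : (p.1 - q.1) ^+ 2 + (p.2 - q.2) ^+ 2 = (al p - al q) ^+ 2 + (ac p - ac q) ^+ 2.
    by rewrite -along_across /al /ac; congr (_ ^+ 2 + _ ^+ 2); ring.
  exact: d.
pose P p := (0 < al p) && (0 <= ac p); pose Q p := (0 < al p) && (ac p < 0).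
have sum0 : \sum_(p <- s) al p = 0.
  by rewrite big_split /= -!mulr_sumr s1 s2 !mulr0 addr0.
have m3' : (0, - (2 * h)) \in rem (3 / 2, - h) s.
  rewrite (mem_rem_uniq _ us) inE /= m3 andbT; apply/eqP => -[e _]; move: e; clear; lra.
have u' : uniq (rem (3 / 2, - h) s) by exact: rem_uniq.
move: sum0; rewrite (big_rem _ m2) /= (big_rem _ m3') /= a2 a3 => sum0.
set s' := rem _ _ in sum0.
have ss p : p \in s' -> p \in s by move=> /mem_rem/mem_rem.
have us' : uniq s' by rewrite !rem_uniq.
have : \sum_(p <- s') al p <= \sum_(p <- filter P s') al p + \sum_(p <- filter Q s') al p.
  apply: sum_le_pos => p ps; first by rewrite /P /Q => /andP[-> c] /=; rewrite -leNgt.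
  by rewrite /P /Q; case: ltrP => //= _; rewrite -ltNge => ->.
have bd W : (forall p q, p \in filter W s' -> q \in filter W s' -> p = q) ->
    (forall p, p \in filter W s' -> al p < 3 / 2) -> \sum_(p <- filter W s') al p < 3 / 2.
  move=> H H'; have [->|[p eP]] := all_eq_size (filter_uniq W us') H.
    by rewrite big_nil; clear; lra.
  by rewrite eP big_seq1; apply: H'; rewrite eP mem_head.
have bP : \sum_(p <- filter P s') al p < 3 / 2.
  apply: bd => [p q|p]; rewrite !mem_filter.
    move=> /andP[/andP[a c] /ss ps] /andP[/andP[a' c'] /ss qs]; apply: U => //; exact: mulr_ge0.
  by move=> /andP[_ /ss /N[]].
have bQ : \sum_(p <- filter Q s') al p < 3 / 2.
  apply: bd => [p q|p]; rewrite !mem_filter.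
    move=> /andP[/andP[a c] /ss ps] /andP[/andP[a' c'] /ss qs]; apply: U => //.
    by rewrite -mulrNN mulr_ge0 // oppr_ge0 ltW.
  by move=> /andP[_ /ss /N[]].
by move: sum0 bP bQ; clear; lra.
Qed.

Lemma one_extra (T : eqType) (l : seq T) (m : T) : uniq l -> m \in l ->
  (forall p q : T, p \in l -> q \in l -> p != m -> q != m -> p = q) ->
  (forall f : T -> R, \sum_(p <- l) f p = f m) \/
  exists z, [/\ z \in l, z != m & forall f : T -> R, \sum_(p <- l) f p = f m + f z].
Proof.
move=> ul ml H; have ur : uniq (rem m l) by rewrite rem_uniq.
have mr (p : T) : p \in rem m l -> p \in l /\ p != m.
  by rewrite mem_rem_uniq // inE => /andP[].
have [e|[z e]] := all_eq_size ur (fun (p q : T) ps qs => H p q (mr p ps).1 (mr q qs).1 (mr p ps).2 (mr q qs).2).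
  by left=> f; rewrite (big_rem _ ml) /= e big_nil addr0.
have [zl zm] : z \in l /\ z != m by apply: mr; rewrite e mem_head.
by right; exists z; split=> // f; rewrite (big_rem _ ml) /= e big_seq1.
Qed.

Lemma three_gaps (a b c m g : R) : m < g -> a <= m -> - m <= a ->
  b <= m -> - m <= b -> c <= m -> - m <= c ->
  g <= a - b \/ g <= b - a -> g <= c - a \/ g <= a - c -> g <= c - b \/ g <= b - c -> False.
Proof. by move=> ? ? ? ? ? ? ? [] ? [] ? [] ?; lra. Qed.

Lemma left_pair (x y x' y' : R) : x ^+ 2 + y ^+ 2 = 3 -> x' ^+ 2 + y' ^+ 2 = 3 ->
  x < - (3 / 2) -> x' < - (3 / 2) -> y' <= y -> 1 <= (x - x') ^+ 2 + (y - y') ^+ 2 ->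
  97 / 100 <= y - y'.
Proof.
move=> n n' l l' yy k; have b : - (1733 / 1000) <= x by move: n; clear; nra.
have b' : - (1733 / 1000) <= x' by move: n'; clear; nra.
have : (x - x') ^+ 2 <= 55 / 1000 by move: l l' b b'; clear; nra.
by move: k yy; clear; nra.
Qed.

(** The two neighbours of degree two make the bounds strict, so the circle [r = 3] splits into a
    left arc and two right arcs; a right arc holds its given point and at most one more. Balance
    needs exactly two left points and an extra point on each right arc. Then the reflection of the
    upper extra point in a neighbour of degree two comes too close to a left point. *)
Lemma mixed_deg2 D : good D -> D 0 0 -> tri D -> D (3 / 2) h -> D (3 / 2) (- h) ->
  deg2 (back (tw D)) -> deg2 (back (tw (mirror D))) -> False.
Proof.
move=> gD D0 tD Y1 Y2 dA dA'; have [sD _] := gD; have bD := balanced_origin gD D0.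
have gM := good_mirror gD; have tM := tri_mirror tD.
have M0 : mirror D 0 0 by rewrite /mirror oppr0.
have e2 := h2 R; have ee := hh R; have hp := h_gt0 R; have /andP[hb hb'] := h_bounds R.
have r1 : 1 < 3 :> R by lra.
have [s [[us hs] s1 s2]] := bD 3.
have nY1 : (3 / 2) ^+ 2 + h ^+ 2 = 3 by rewrite e2; field.
have nY2 : (3 / 2) ^+ 2 + (- h) ^+ 2 = 3 by rewrite sqrrN.
have N p : p \in s -> [/\ D p.1 p.2, p.1 ^+ 2 + p.2 ^+ 2 = 3, p.1 <= 3 / 2,
    - (1 / 2) * p.1 + h * p.2 < 3 / 2 & - (1 / 2) * p.1 - h * p.2 < 3 / 2].
  move=> /hs[f n]; have [b0 b1 b2] := tri_bounds sD tD f n r1.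
  have fM : mirror D p.1 (- p.2) by rewrite /mirror opprK.
  have nM : p.1 ^+ 2 + (- p.2) ^+ 2 = 3 by rewrite sqrrN.
  split=> //; [by move: b0; clear; lra| |]; rewrite lt_neqAle; apply/andP; split; try by move: b1 b2; clear; lra.
    by apply/eqP; exact: deg2_strict dA f n.
  by apply/eqP; have := deg2_strict dA' fM nM; rewrite mulrN.
have m1 : (3 / 2, h) \in s by apply/hs.
have m2 : (3 / 2, - h) \in s by apply/hs.
have trich p : p \in s -> p.1 < - (3 / 2) \/ 0 < p.1 /\ 3 / 4 <= p.2 ^+ 2.
  move=> /N[_ n b l1 l2]; move: n b l1 l2; clear -ee; move: p.1 p.2 => x y n b l1 l2.
  have k : (h * y) ^+ 2 < (3 / 2 + x / 2) ^+ 2 by move: l1 l2; clear; nra.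
  have k2 : (h * y) ^+ 2 = 3 / 4 * y ^+ 2 by rewrite -ee; ring.
  rewrite k2 in k; have [x0|x0] := ltrP 0 x; first by right; split=> //; move: n b x0; clear; nra.
  by left; move: n k x0; clear; nra.
pose A p := p.1 < - (3 / 2); pose B p := (0 < p.1) && (0 < p.2); pose C p := (0 < p.1) && (p.2 < 0).
have one p : p \in s -> (A p + B p + C p = 1)%N.
  move=> /trich[l|[l q]]; rewrite /A /B /C.
    by rewrite l (_ : (0 < p.1) = false) //; apply/negbTE; rewrite -leNgt; move: l; clear; lra.
  rewrite l (_ : (p.1 < - (3 / 2)) = false) /=; last by apply/negbTE; rewrite -leNgt; move: l; clear; lra.
  by have [//|//|z] := ltrgtP 0 p.2; rewrite -z in q; exfalso; move: q; clear; nra.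
have e1 := sum_three fst one; have e2' := sum_three snd one; rewrite s1 in e1; rewrite s2 in e2'.
have hi p : p \in s -> B p -> p != (3 / 2, h) -> p.1 <= 78 / 100 /\ 154 / 100 <= p.2.
  move=> ps /andP[l q] ne; have [f n b l1 l2] := N p ps.
  have k : p.1 * (3 / 2) + p.2 * h <= 3 - 1 / 2.
    by apply: (separated_dot sD f Y1 n nY1) => -[ex ey]; move/eqP: ne; apply; apply/pair_eqP.
  have k' : p.1 * (3 / 2) + p.2 * (866 / 1000) <= 5 / 2 by move: k hb q; clear; nra.
  have x1 : p.1 <= 78 / 100.
    move: n b k' l q; clear; move: p.1 p.2 => x y n b k l q; rewrite leNgt; apply/negP => c.
    have : (y * (866 / 1000)) ^+ 2 <= (5 / 2 - x * (3 / 2)) ^+ 2 by nra.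
    by nra.
  by split=> //; move: n x1 l q; clear; nra.
have lo p : p \in s -> C p -> p != (3 / 2, - h) -> p.1 <= 78 / 100 /\ p.2 <= - (154 / 100).
  move=> ps /andP[l q] ne; have [f n b l1 l2] := N p ps.
  have k : p.1 * (3 / 2) + p.2 * - h <= 3 - 1 / 2.
    by apply: (separated_dot sD f Y2 n nY2) => -[ex ey]; move/eqP: ne; apply; apply/pair_eqP.
  have k' : p.1 * (3 / 2) - p.2 * (866 / 1000) <= 5 / 2 by move: k hb q; clear; nra.
  have x1 : p.1 <= 78 / 100.
    move: n b k' l q; clear; move: p.1 p.2 => x y n b k l q; rewrite leNgt; apply/negP => c.
    have : (y * (866 / 1000)) ^+ 2 <= (5 / 2 - x * (3 / 2)) ^+ 2 by nra.
    by nra.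
  by split=> //; move: n x1 l q; clear; nra.
have y3 p : p \in s -> p.2 <= 1733 / 1000 /\ - (1733 / 1000) <= p.2.
  by move=> /N[_ n _ _ _]; move: n; clear; split; nra.
have clo p q : p \in s -> q \in s -> (p.1 - q.1) ^+ 2 + (p.2 - q.2) ^+ 2 < 1 -> p = q.
  by move=> /N[f _ _ _ _] /N[f' _ _ _ _] l; apply/pair_eqP; apply: (sD _ _ _ _ f f').
have clo2 p q : p \in s -> q \in s -> p != q -> 1 <= (p.1 - q.1) ^+ 2 + (p.2 - q.2) ^+ 2.
  by move=> ps qs ne; rewrite leNgt; apply/negP => l; rewrite (clo p q ps qs l) eqxx in ne.
have small (p : R * R) : p \in s -> A p -> p.2 <= 867 / 1000 /\ - (867 / 1000) <= p.2.
  move=> /N[_ _ _ l1 l2]; rewrite /A => l.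
  have k : h * p.2 <= h * h by move: l1 l; rewrite ee; clear; lra.
  have k' : h * (- p.2) <= h * h by move: l2 l; rewrite ee mulrN; clear; lra.
  by rewrite (ler_pM2l hp) in k; rewrite (ler_pM2l hp) in k'; move: k k' hb'; clear; split; lra.
(* One point alone does not weigh enough. Three do not fit: their ordinates have absolute value at
   most 867/1000 but mutual differences of at least 97/100. *)
have sA : \sum_(p <- filter A s) p.1 <= - 3 -> exists w w', [/\ w \in s /\ w' \in s, A w /\ A w',
    97 / 100 <= w.2 - w'.2, \sum_(p <- filter A s) p.1 = w.1 + w'.1 &
    \sum_(p <- filter A s) p.2 = w.2 + w'.2].
  have : uniq (filter A s) by rewrite filter_uniq.
  have : forall p : R * R, p \in filter A s -> p \in s /\ A p by move=> p; rewrite mem_filter => /andP[].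
  have gap (p q : R * R) : p \in s -> q \in s -> A p -> A q -> p != q -> q.2 <= p.2 -> 97 / 100 <= p.2 - q.2.
    move=> ps qs pA qA ne l; have [_ n _ _ _] := N p ps; have [_ n' _ _ _] := N q qs.
    exact: (left_pair n n' pA qA l (clo2 p q ps qs ne)).
  case: (filter A s) => [|w [|w' l]] H u.
  - by rewrite big_nil => e; exfalso; move: e; clear; lra.
  - rewrite big_seq1; have [ws _] := H w (mem_head _ _); have [_ n _ _ _] := N w ws.
    by move=> e; exfalso; move: n e; clear; nra.
  have [ws wA] := H w (mem_head _ _).
  have [ws' wA'] : w' \in s /\ A w' by apply: H; rewrite !inE eqxx orbT.
  have [w1 w2] := small w ws wA; have [w3 w4] := small w' ws' wA'.
  move: u => /= /andP[]; rewrite inE => /norP[ne nl] /andP[nl' _].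
  have g : 97 / 100 <= w.2 - w'.2 \/ 97 / 100 <= w'.2 - w.2.
    have [l1|/ltW l1] := lerP w'.2 w.2; [left|right]; apply: gap => //.
    by rewrite eq_sym.
  case: l H nl nl' => [|p l] H nl nl'; last first.
    have [ps pA] : p \in s /\ A p by apply: H; rewrite !inE eqxx !orbT.
    have [p1 p2] := small p ps pA.
    have [np np'] : p != w /\ p != w'.
      by move: nl nl'; rewrite !inE => /norP[? _] /norP[? _]; rewrite [p == w]eq_sym [p == w']eq_sym.
    have g1 : 97 / 100 <= p.2 - w.2 \/ 97 / 100 <= w.2 - p.2.
      have [l1|/ltW l1] := lerP w.2 p.2; [left|right]; apply: gap => //.
      by rewrite eq_sym.
    have g2 : 97 / 100 <= p.2 - w'.2 \/ 97 / 100 <= w'.2 - p.2.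
      have [l1|/ltW l1] := lerP w'.2 p.2; [left|right]; apply: gap => //.
      by rewrite eq_sym.
    have mg : 867 / 1000 < 97 / 100 :> R by clear; lra.
    by case: (three_gaps mg w1 w2 w3 w4 p1 p2 g g1 g2).
  move=> _; rewrite !big_cons !big_nil !addr0.
  case: g => g; [by exists w, w'|exists w', w; split=> //; by rewrite addrC].
have uB : (forall f : R * R -> R, \sum_(p <- filter B s) f p = f (3 / 2, h)) \/
    exists z, [/\ z \in s /\ 0 < z.1, 154 / 100 <= z.2 & forall f : R * R -> R, \sum_(p <- filter B s) f p = f (3 / 2, h) + f z].
  have mB : (3 / 2, h) \in filter B s by rewrite mem_filter /B /= hp m1 !andbT; clear; lra.
  have mr (p : R * R) : p \in filter B s -> p != (3 / 2, h) -> [/\ p \in s, 0 < p.1, p.1 <= 78 / 100 & 154 / 100 <= p.2].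
    rewrite mem_filter => /andP[pB ps] ne.
    by have [? ?] := hi p ps pB ne; have /andP[? ?] := pB; split.
  have mB' (p q : R * R) : p \in filter B s -> q \in filter B s -> p != (3 / 2, h) -> q != (3 / 2, h) -> p = q.
    move=> /mr H /mr H' /H[ps p1 p2 p3] /H'[qs q1 q2 q3]; apply: clo => //.
    have [k1 _] := y3 p ps; have [k2 _] := y3 q qs.
    by move: p1 p2 p3 q1 q2 q3 k1 k2; clear; nra.
  have [e|[z [zs zn e]]] := one_extra (filter_uniq _ us) mB mB'.
  - by left.
  - by right; have [? ? _ ?] := mr z zs zn; exists z; split.
have uC : (forall f : R * R -> R, \sum_(p <- filter C s) f p = f (3 / 2, - h)) \/
    exists z, [/\ z \in s /\ 0 < z.1, z.2 <= - (154 / 100) & forall f : R * R -> R, \sum_(p <- filter C s) f p = f (3 / 2, - h) + f z].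
  have mC : (3 / 2, - h) \in filter C s by rewrite mem_filter /C /= oppr_lt0 hp m2 !andbT; clear; lra.
  have mr (p : R * R) : p \in filter C s -> p != (3 / 2, - h) -> [/\ p \in s, 0 < p.1, p.1 <= 78 / 100 & p.2 <= - (154 / 100)].
    rewrite mem_filter => /andP[pB ps] ne.
    by have [? ?] := lo p ps pB ne; have /andP[? ?] := pB; split.
  have mC' (p q : R * R) : p \in filter C s -> q \in filter C s -> p != (3 / 2, - h) -> q != (3 / 2, - h) -> p = q.
    move=> /mr H /mr H' /H[ps p1 p2 p3] /H'[qs q1 q2 q3]; apply: clo => //.
    have [_ k1] := y3 p ps; have [_ k2] := y3 q qs.
    by move: p1 p2 p3 q1 q2 q3 k1 k2; clear; nra.
  have [e|[z [zs zn e]]] := one_extra (filter_uniq _ us) mC mC'.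
  - by left.
  - by right; have [? ? _ ?] := mr z zs zn; exists z; split.
case: uB => [eB|[z [[zs z1] z2 eB]]]; case: uC => [eC|[z' [[zs' z1'] z2' eC]]];
  rewrite (eB fst) (eC fst) /= in e1; rewrite (eB snd) (eC snd) /= in e2'.
- have [|w [w' [_ [k k'] _ eA _]]] := sA; first by move: e1; clear; lra.
  by exfalso; rewrite eA in e1; move: e1 k k'; rewrite /A; clear; lra.
- have [|w [w' [[ws ws'] [wA wA'] g _ eA]]] := sA; first by move: e1 z1'; clear; lra.
  have [a1 _] := small w ws wA.
  by exfalso; rewrite eA in e2'; move: e2' z2' g a1; clear; lra.
- have [|w [w' [[ws ws'] [wA wA'] g _ eA]]] := sA; first by move: e1 z1; clear; lra.
  have [_ a1] := small w' ws' wA'.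
  by exfalso; rewrite eA in e2'; move: e2' z2 g a1; clear; lra.
have [|w [w' [[ws ws'] [wA wA'] g eA _]]] := sA; first by move: e1 z1 z1'; clear; lra.
rewrite eA in e1 => {eA e2'}.
have [f n b l1 l2] := N z zs; have [fw nw _ _ _] := N w ws; have [fw' nw' _ _ _] := N w' ws'.
have zx : z.1 <= 33 / 100.
  have q : 47 / 100 <= w.2 ^+ 2 + w'.2 ^+ 2.
    have g2 : (97 / 100) ^+ 2 <= (w.2 - w'.2) ^+ 2 by move: g; clear; nra.
    by have := sqr_ge0 (w.2 + w'.2); move: g2; clear; nra.
  have k2 : (w.1 + w'.1) ^+ 2 <= 1106 / 100.
    by have := sqr_ge0 (w.1 - w'.1); move: nw nw' q; clear; lra.
  have e : w.1 + w'.1 + (z.1 + z'.1 + 3) = 0 by move: e1; clear; lra.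
  by rewrite leNgt; apply/negP => l; move: k2 e z1' l; clear; nra.
have zy : 17 / 10 <= z.2 by move: n z1 zx z2; clear; nra.
have zh : z.2 <= 2 * h by move: n e2 hp z1 z2; clear; nra.
have zh' : 2 * h - z.2 <= 1 / 10 by move: zy hb'; clear; lra.
have o1 : 1 < 1 - 2 * (- (1 / 2) * z.1 + h * z.2) + (z.1 ^+ 2 + z.2 ^+ 2) by rewrite n; move: l1; clear; lra.
have o2 : 1 - 2 * (- (1 / 2) * z.1 + h * z.2) + (z.1 ^+ 2 + z.2 ^+ 2) <= 87 / 50.
  have : (866 / 1000) * (17 / 10) <= h * z.2 by move: hb zy hp; clear; nra.
  by rewrite n; move: zx; clear; lra.
have Z := deg2_reflect gD D0 tD dA f o1 o2.
have fin (v : R * R) : D v.1 v.2 -> v.1 ^+ 2 + v.2 ^+ 2 = 3 -> v.1 < - (3 / 2) -> 1 / 10 <= v.2 -> False.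
  move=> fv nv vx vy; have [] := sD _ _ _ _ fv Z.
    have q1 : (v.2 - (2 * h - z.2)) ^+ 2 <= v.2 ^+ 2 by move: zh zh' vy; clear; nra.
    have q2 : (v.1 - (- 1 - z.1)) ^+ 2 <= (v.1 + 1) ^+ 2 by move: vx zx z1; clear; nra.
    by move: nv q1 q2 vx; clear; lra.
  by move: vx zx; clear; lra.
by apply: (fin w) => //; have [_ a1] := small w' ws' wA'; move: g a1; clear; lra.
Qed.
End MixedNeighbours.

(** * Honeycombs *)

Section FrameGroup.
Variable R : realType.
Implicit Types (F D : R -> R -> Prop) (x y a b u v r : R) (p q w : R * R) (t : seq (R * R)).
Notation h := (h R).

Lemma pred2_ext F D : (forall x y, F x y <-> D x y) -> F = D.
Proof. by move=> e; apply/funext => x; apply/funext => y; apply/propext. Qed.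

Lemma tw_mirror D : tw (mirror D) = mirror (tw (tw D)).
Proof.
apply: pred2_ext => x y; rewrite /tw /mirror !turn_rxy rx2 ry2.
have -> : rx x y = - (1 / 2) * x + h * - y by rewrite /rx; ring.
by have -> : - ry x y = - h * x - 1 / 2 * - y by rewrite /ry; ring.
Qed.

Lemma tw3 D : tw (tw (tw D)) = D.
Proof. by apply: pred2_ext => x y; rewrite /tw !turn_rxy; case: (rotK x y) => -> ->. Qed.

Lemma back_mirror D : back (mirror D) = mirror (back D).
Proof. by []. Qed.

Lemma good_tw D : good D -> good (tw D).
Proof. exact: good_turn (half_h R). Qed.

Lemma tw_origin D : D 0 0 -> tw D 0 0.
Proof. by rewrite /tw turn_rxy /rx /ry !mulr0 subr0 addr0. Qed.

Lemma tri_all D : good D -> D 0 0 -> tri D -> tri (back D) -> tri (back (tw D)).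
Proof.
move=> gD D0 tD tB.
have gT := good_tw gD; have T0 := tw_origin D0; have tT := tri_turn tD.
have gT2 := good_tw gT; have T20 := tw_origin T0; have tT2 := tri_turn tT.
have [//|dA] := tri_neighbour gT T0 tT; exfalso.
have half E : tri (back E) -> E (3 / 2) h /\ E (3 / 2) (- h).
  move=> [_ b1 b2 _]; rewrite /back !opprK in b1 b2.
  have e : 1 + 1 / 2 = 3 / 2 :> R by field.
  by rewrite e in b1 b2.
have [Y1 Y2] := half D tB.
have [tA'|dA'] := tri_neighbour gT2 T20 tT2.
  have [Y3 Y4] := half (tw (tw D)) tA'; have hh := hh R.
  apply: (mixed_triple gD D0 tD Y1 Y2 dA).
    move: Y3; rewrite /tw !turn_rxy rx2 ry2; congr (D _ _).
      have -> : - (1 / 2) * (3 / 2) + h * h = h * h - 3 / 4 :> R by field.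
      by rewrite hh subrr.
    by field.
  move: Y4; rewrite /tw !turn_rxy rx2 ry2; congr (D _ _).
    have -> : - (1 / 2) * (3 / 2) + h * - h = - (h * h) - 3 / 4 :> R by field.
    by rewrite hh; field.
  by field.
apply: (mixed_deg2 gD D0 tD Y1 Y2 dA).
by rewrite tw_mirror back_mirror; apply: deg2_mirror.
Qed.

(* Frames are written [(a, b, u, v)]: origin [(a, b)], first axis [(u, v)]. [reach l] is the
   group of frames generated by a rotation by 120 degrees and a half turn about the midpoint
   [(l/2, 0)]. *)
Inductive reach (l : R) : R -> R -> R -> R -> Prop :=
| reach_id : reach l 0 0 1 0
| reach_rot a b u v : reach l a b u v -> reach l a b (- (1 / 2) * u - h * v) (h * u - 1 / 2 * v)
| reach_step a b u v : reach l a b u v -> reach l (a + l * u) (b + l * v) (- u) (- v).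

Lemma reach_eq l a b u v a' b' u' v' : reach l a b u v -> a = a' -> b = b' -> u = u' -> v = v' ->
  reach l a' b' u' v'.
Proof. by move=> r <- <- <- <-. Qed.

Lemma reach_unit l a b u v : reach l a b u v -> u ^+ 2 + v ^+ 2 = 1.
Proof.
elim=> [|{}a {}b {}u {}v _ e|{}a {}b {}u {}v _ e]; rewrite ?sqrrN //; first by rewrite expr1n expr0n addr0.
apply: etrans e; rewrite -(rxy_norm u v) /rx /ry; congr (_ + _ ^+ 2); by field.
Qed.

Lemma reach_comp l a b u v a' b' u' v' : reach l a b u v -> reach l a' b' u' v' ->
  reach l (a + (u * a' - v * b')) (b + (v * a' + u * b')) (u * u' - v * v') (v * u' + u * v').
Proof.
move=> f; elim=> [|{}a' {}b' {}u' {}v' _ IH|{}a' {}b' {}u' {}v' _ IH].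
- by apply: (reach_eq f); ring.
- by apply: (reach_eq (reach_rot IH)); ring.
- by apply: (reach_eq (reach_step IH)); ring.
Qed.

Lemma reach_inv l a b u v : reach l a b u v ->
  reach l (- (u * a + v * b)) (v * a - u * b) u (- v).
Proof.
elim=> [|{}a {}b {}u {}v f IH|{}a {}b {}u {}v f IH].
- by apply: (reach_eq (reach_id l)); ring.
- have hh := hh R.
  have w2 := reach_comp (reach_rot (reach_rot (reach_id l))) IH.
  have e : - (1 / 2) * (- (1 / 2) * 1 - h * 0) - h * (h * 1 - 1 / 2 * 0) = - (1 / 2).
    have -> : - (1 / 2) * (- (1 / 2) * 1 - h * 0) - h * (h * 1 - 1 / 2 * 0) = 1 / 4 - h * h by field.
    by rewrite hh; field.
  have e' : h * (- (1 / 2) * 1 - h * 0) - 1 / 2 * (h * 1 - 1 / 2 * 0) = - h by field.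
  by rewrite e e' in w2; apply: (reach_eq w2); field.
- have n := reach_unit f.
  have w := reach_comp (reach_step (reach_id l)) IH; apply: (reach_eq w); try ring.
  have -> : - (- u * (a + l * u) + - v * (b + l * v)) = u * a + v * b + l * (u ^+ 2 + v ^+ 2) by ring.
  by rewrite n; ring.
Qed.

Definition orb (l p q x y : R) := exists a b u v, reach l a b u v /\
  x = a + (u * p - v * q) /\ y = b + (v * p + u * q).

Lemma orb_act l (p q a b u v x y : R) : reach l a b u v ->
  orb l p q (a + (u * x - v * y)) (b + (v * x + u * y)) <-> orb l p q x y.
Proof.
move=> f; split=> [[a' [b' [u' [v' [g [e1 e2]]]]]]|[a' [b' [u' [v' [g [-> ->]]]]]]]; last first.
  by do 4 eexists; split; [exact: reach_comp f g|split; ring].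
have n := reach_unit f.
do 4 eexists; split; first exact: reach_comp (reach_inv f) g.
have k c : c = (u ^+ 2 + v ^+ 2) * c by rewrite n mul1r.
split.
  rewrite [x]k; have -> : (u ^+ 2 + v ^+ 2) * x = u * (a + (u * x - v * y)) + v * (b + (v * x + u * y)) - (u * a + v * b) by ring.
  by rewrite e1 e2; ring.
rewrite [y]k; have -> : (u ^+ 2 + v ^+ 2) * y = u * (b + (v * x + u * y)) - v * (a + (u * x - v * y)) + (v * a - u * b) by ring.
by rewrite e1 e2; ring.
Qed.

Definition invariant l D := forall a b u v x y, reach l a b u v ->
  D (a + (u * x - v * y)) (b + (v * x + u * y)) <-> D x y.

(** Conjugation by a frame that carries [(p, q)] to the given point. Plane rotations commute, so [c]
    and [s] stay the same. *)
Lemma invariant_rotation l D (p q a b c s x0 y0 : R) : invariant l D -> reach l a b c s ->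
  p = a + (c * p - s * q) -> q = b + (s * p + c * q) -> orb l p q x0 y0 ->
  forall x y, D (x0 + x) (y0 + y) <-> D (x0 + (c * x - s * y)) (y0 + (s * x + c * y)).
Proof.
move=> inv g ep eq [a' [b' [u [v [f [-> ->]]]]]] x y.
have n := reach_unit f.
have k z : z = (u ^+ 2 + v ^+ 2) * z by rewrite n mul1r.
pose x' := u * x + v * y; pose y' := u * y - v * x.
have -> : x = u * x' - v * y' by rewrite {1}[x]k /x' /y'; ring.
have -> : y = v * x' + u * y' by rewrite {1}[y]k /x' /y'; ring.
have -> : a' + (u * p - v * q) + (u * x' - v * y') = a' + (u * (p + x') - v * (q + y')) by ring.
have -> : b' + (v * p + u * q) + (v * x' + u * y') = b' + (v * (p + x') + u * (q + y')) by ring.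
rewrite (inv _ _ _ _ _ _ f) -(inv _ _ _ _ (p + x') (q + y') g) -(inv _ _ _ _ _ _ f).
have -> : a + (c * (p + x') - s * (q + y')) = p + (c * x' - s * y') by rewrite {2}ep; ring.
have -> : b + (s * (p + x') + c * (q + y')) = q + (s * x' + c * y') by rewrite {2}eq; ring.
have -> : a' + (u * (p + (c * x' - s * y')) - v * (q + (s * x' + c * y'))) =
  a' + (u * p - v * q) + (c * (u * x' - v * y') - s * (v * x' + u * y')) by ring.
by have -> : b' + (v * (p + (c * x' - s * y')) + u * (q + (s * x' + c * y'))) =
  b' + (v * p + u * q) + (s * (u * x' - v * y') + c * (v * x' + u * y')) by ring.
Qed.

Definition frame a b u v D := turn u v (shift a b D).

Lemma frame_rot a b u v D :
  frame a b (- (1 / 2) * u - h * v) (h * u - 1 / 2 * v) D = tw (frame a b u v D).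
Proof.
by apply: pred2_ext => x y; rewrite /frame /tw /turn /shift; split; congr (D _ _); ring.
Qed.

Definition back_by l D x y := D (l - x) (- y).

Lemma frame_step l a b u v D :
  frame (a + l * u) (b + l * v) (- u) (- v) D = back_by l (frame a b u v D).
Proof.
by apply: pred2_ext => x y; rewrite /frame /back_by /turn /shift; split; congr (D _ _); ring.
Qed.

Lemma frame_id D : frame 0 0 1 0 D = D.
Proof.
by apply: pred2_ext => x y; rewrite /frame /turn /shift !mul0r !mul1r !add0r subr0.
Qed.

(** This spreads a local pattern over the plane: it has to survive only the two generators. *)
Lemma reach_ind_frame l (N : (R -> R -> Prop) -> Prop) D a b u v :
  (forall E, N E -> N (tw E)) -> (forall E, N E -> N (back_by l E)) -> N D ->
  reach l a b u v -> N (frame a b u v D).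
Proof.
move=> Nt Nb ND; elim=> [|{}a {}b {}u {}v _ IH|{}a {}b {}u {}v _ IH].
- by rewrite frame_id.
- by rewrite frame_rot; apply: Nt.
- by rewrite frame_step; apply: Nb.
Qed.
End FrameGroup.

(** * Configurations that contain a honeycomb *)

Section Honeycomb.
Variable R : realType.
Implicit Types (F D E : R -> R -> Prop) (x y a b u v r : R) (p q w : R * R) (s t : seq (R * R)).
Notation h := (h R).

Lemma truncn_close (x y : R) : 0 <= x -> 0 <= y -> Num.truncn x = Num.truncn y -> (x - y) ^+ 2 < 1.
Proof.
move=> /truncn_itv/andP[a b] /truncn_itv/andP[c d] e; rewrite e in a b.
by move: a b c d; rewrite -natr1; move: (_%:R) => n; clear; nra.
Qed.

(** Without a minimum there would be descending chains of every length, but a separated set has at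
    most one point in each cell of side 1/2. *)
Lemma bounded_min F (B : R) (phi : R * R -> R) : separated F ->
  (forall p, F p.1 p.2 -> [/\ - B <= p.1, p.1 <= B, - B <= p.2 & p.2 <= B]) ->
  (exists x y, F x y) -> exists p, F p.1 p.2 /\ forall q, F q.1 q.2 -> phi p <= phi q.
Proof.
move=> sF bF [x0 [y0 f0]]; apply: contrapT => /forallNP no.
have down p : F p.1 p.2 -> exists q, F q.1 q.2 /\ phi q < phi p.
  move=> f; apply: contrapT => /forallNP g; apply: (no p); split=> // q fq.
  by rewrite leNgt; apply/negP => l; apply: (g q).
have chain n : exists p s, [/\ size s = n, uniq (p :: s), forall q, q \in p :: s -> F q.1 q.2 &
    forall q, q \in s -> phi p < phi q].
  elim: n => [|n [p [s [<- us fs ls]]]].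
    by exists (x0, y0), [::]; split=> // q; rewrite inE => /eqP->.
  have [q [fq lq]] := down p (fs p (mem_head _ _)).
  have lt w : w \in p :: s -> phi q < phi w.
    by rewrite inE => /orP[/eqP->//|/ls]; exact: lt_trans.
  exists q, (p :: s); split=> //; last by move=> w; rewrite inE => /orP[/eqP->|/fs].
  by rewrite cons_uniq us andbT; apply/negP => /lt; rewrite ltxx.
pose M := Num.truncn (4 * B).
pose g p : 'I_M.+1 * 'I_M.+1 := (inord (Num.truncn (2 * (p.1 + B))), inord (Num.truncn (2 * (p.2 + B)))).
have ltM (x : R) : - B <= x -> x <= B -> (Num.truncn (2 * (x + B)) < M.+1)%N.
  by move=> l l'; rewrite ltnS /M; apply: le_truncn; lra.
have [p [s [ss us fs _]]] := chain #|{: 'I_M.+1 * 'I_M.+1}|.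
have ug : uniq (map g (p :: s)).
  rewrite map_inj_in_uniq // => q w /fs fq /fs fw.
  have [q1 q2 q3 q4] := bF _ fq; have [w1 w2 w3 w4] := bF _ fw.
  case=> /(congr1 val) /= e1 /(congr1 val) /= e2.
  rewrite !inordK in e1; try exact: ltM.
  rewrite !inordK in e2; try exact: ltM.
  apply/pair_eqP; apply: sF fq fw _.
  have := truncn_close _ _ e1; have := truncn_close _ _ e2.
  have n0 c : - B <= c -> 0 <= 2 * (c + B) by move=> l; lra.
  rewrite !n0 // => /(_ isT isT) + /(_ isT isT); clear; nra.
have := max_card (mem (map g (p :: s))); rewrite (card_uniqP ug) size_map /= ss.
by rewrite ltnn.
Qed.

Lemma nearest F : separated F -> (exists x y, F x y) ->
  exists x y, F x y /\ forall x' y', F x' y' -> x ^+ 2 + y ^+ 2 <= x' ^+ 2 + y' ^+ 2.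
Proof.
move=> sF [x0 [y0 f0]]; set B := x0 ^+ 2 + y0 ^+ 2.
pose F' x y := F x y /\ x ^+ 2 + y ^+ 2 <= B.
have sF' : separated F' by move=> x y x' y' [f _] [f' _]; exact: sF.
have bF' p : F' p.1 p.2 -> [/\ - (B + 1) <= p.1, p.1 <= B + 1, - (B + 1) <= p.2 & p.2 <= B + 1].
  by case=> _ l; move: l (sqr_ge0 p.1) (sqr_ge0 p.2); clear; split; nra.
have [|[x y] /= [[f l] m]] := bounded_min (fun p => p.1 ^+ 2 + p.2 ^+ 2) sF' bF'.
  by exists x0, y0.
exists x, y; split=> // x' y' f'; have [l'|/ltW l'] := lerP (x' ^+ 2 + y' ^+ 2) B.
  by apply: (m (x', y')).
exact: le_trans l l'.
Qed.

Lemma orb0 l : orb l 0 0 0 (0 : R).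
Proof. by exists 0, 0, 1, 0; split; [exact: reach_id|split; ring]. Qed.

(** The nearest orbit point is moved to the origin, so that the given point falls into the Voronoi
    cell of the origin. *)
Lemma nearest_frame (l x y : R) : separated (orb l 0 0) -> exists a b u v wx wy,
  [/\ reach l a b u v, x = a + (u * wx - v * wy), y = b + (v * wx + u * wy) &
   forall z1 z2, orb l 0 0 z1 z2 -> wx ^+ 2 + wy ^+ 2 <= (wx - z1) ^+ 2 + (wy - z2) ^+ 2].
Proof.
move=> sK; have [|c [d [K m]]] := nearest (separated_shift (a := x) (b := y) sK).
  by exists (- x), (- y); rewrite /shift !subrr; exact: orb0.
have [a [b [u [v [f [e1 e2]]]]]] := K; have n := reach_unit f.
rewrite !mulr0 subrr addr0 in e1; rewrite !mulr0 !addr0 in e2.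
have k z : z = (u ^+ 2 + v ^+ 2) * z by rewrite n mul1r.
exists a, b, u, v, (u * (x - a) + v * (y - b)), (u * (y - b) - v * (x - a)); split=> //.
- rewrite [x in LHS](_ : _ = a + (x - a)); last by ring.
  by rewrite [in LHS](k (x - a)); ring.
- rewrite [y in LHS](_ : _ = b + (y - b)); last by ring.
  by rewrite [in LHS](k (y - b)); ring.
move=> z1 z2 /(orb_act _ _ _ _ f) K'.
have K2 : shift x y (orb l 0 0) (a + (u * z1 - v * z2) - x) (b + (v * z1 + u * z2) - y).
  by rewrite /shift [x + _]addrC [y + _]addrC !subrK.
have := m _ _ K2.
have -> : c = a - x by move: e1; clear; lra.
have -> : d = b - y by move: e2; clear; lra.
have <- : (u ^+ 2 + v ^+ 2) * ((a - x) ^+ 2 + (b - y) ^+ 2) = (u * (x - a) + v * (y - b)) ^+ 2 + (u * (y - b) - v * (x - a)) ^+ 2 by ring.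
have -> : u * (x - a) + v * (y - b) - z1 = - (u * (a + (u * z1 - v * z2) - x) + v * (b + (v * z1 + u * z2) - y)).
  by rewrite {1}[z1]k; ring.
have -> : u * (y - b) - v * (x - a) - z2 = - (u * (b + (v * z1 + u * z2) - y) - v * (a + (u * z1 - v * z2) - x)).
  by rewrite {1}[z2]k; ring.
have -> : forall c d, (- (u * c + v * d)) ^+ 2 + (- (u * d - v * c)) ^+ 2 = (u ^+ 2 + v ^+ 2) * (c ^+ 2 + d ^+ 2) by move=> *; ring.
by rewrite n !mul1r.
Qed.

Lemma orb_arms (l : R) : [/\ orb l 0 0 l 0, orb l 0 0 (- (1 / 2) * l) (h * l) & orb l 0 0 (- (1 / 2) * l) (- (h * l))].
Proof.
have pos a b u v : reach l a b u v -> orb l 0 0 a b.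
  by move=> f; exists a, b, u, v; split=> //; rewrite !mulr0 subrr !addr0.
have r1 := reach_rot (reach_id l).
have r2 : reach l 0 0 (- (1 / 2)) (- h).
  apply: (reach_eq (reach_rot r1)) => //; last by field.
  have -> : - (1 / 2) * (- (1 / 2) * 1 - h * 0) - h * (h * 1 - 1 / 2 * 0) = 1 / 4 - h * h by field.
  by rewrite hh; field.
split.
- by apply: pos; apply: (reach_eq (reach_step (reach_id l))) => //; ring.
- by apply: pos; apply: (reach_eq (reach_step r1)) => //; ring.
- by apply: pos; apply: (reach_eq (reach_step r2)) => //; ring.
Qed.

Lemma tri_cap (t x y : R) : in_tri t x y -> x ^+ 2 + y ^+ 2 <= 4 * t ^+ 2.
Proof.
case=> b0 b1 b2; have e : (h * y) ^+ 2 = 3 / 4 * y ^+ 2 by rewrite exprMn h2.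
by move: b0 b1 b2 e; move: (h * y) => z; clear; nra.
Qed.

Definition nice E := [/\ good E, E 0 0, tri E & tri (back E)].

Lemma nice_tw E : nice E -> nice (tw E).
Proof.
by case=> g e t b; split; [exact: good_tw|exact: tw_origin|exact: tri_turn|exact: tri_all].
Qed.

Lemma nice_back E : nice E -> nice (back_by 1 E).
Proof.
case=> g e t b; have [d _ _ _] := t; split; [exact: good_back| |exact: b|].
  by rewrite /back_by subr0 oppr0.
by rewrite -[back_by 1 E]/(back E) (pred2_ext (@backK _ E)).
Qed.

Lemma frame_origin a b u v D : frame a b u v D 0 0 = D a b.
Proof. by rewrite /frame /turn /shift !mulr0 subrr !addr0. Qed.

(** The Voronoi cell of a vertex lies in a triangle whose vertices have distance 1 from it. A point
    of [E] in the cell is therefore the vertex itself or one of the unit neighbours listed by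
    [tri]. *)
Lemma honeycomb E x y : nice E -> E x y <-> orb 1 0 0 x y.
Proof.
move=> nE.
have KE a b : orb 1 0 0 a b -> E a b.
  move=> [a' [b' [u [v [f [-> ->]]]]]]; rewrite !mulr0 subrr !addr0 -(frame_origin a' b' u v).
  by have [] := reach_ind_frame nice_tw nice_back nE f.
split; last exact: KE.
move=> Exy; have [[sE _] _ _ _] := nE.
have sK : separated (orb 1 0 0 : R -> R -> Prop) by move=> a b a' b' /KE f /KE f'; exact: sE.
have [a [b [u [v [wx [wy [f ex ey m]]]]]]] := nearest_frame x y sK.
have [[sE' _] E0 tE' _] := reach_ind_frame nice_tw nice_back nE f.
set E' := frame a b u v E in sE' E0 tE'.
have f' : E' wx wy.
  by rewrite /E' /frame /turn /shift -ex -ey.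
rewrite ex ey (orb_act _ _ _ _ f).
have [a1 a2 a3] := orb_arms (1 : R); rewrite !mulr1 in a1 a2 a3.
have k1 := m _ _ a1; have k2 := m _ _ a2; have k3 := m _ _ a3; have hh := hh R.
have cap : wx ^+ 2 + wy ^+ 2 <= 4 * (1 / 2) ^+ 2.
  by apply: tri_cap; split; [move: k1|move: k2 hh|move: k3 hh]; clear; lra.
have {}cap : wx ^+ 2 + wy ^+ 2 <= 1 by move: cap; clear; lra.
have [e|ne] := eqVneq (wx ^+ 2 + wy ^+ 2) 1.
  by have [_ _ _ ] := tE'; case/(_ _ _ f' e) => -[-> ->].
have [] := sE' _ _ _ _ f' E0; first by rewrite !subr0 lt_neqAle ne.
by move=> -> ->; exact: orb0.
Qed.

Lemma nice_symmetric E x0 y0 : nice E -> E x0 y0 -> exists c s : R, [/\ c ^+ 2 + s ^+ 2 = 1, c <> 1 &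
  forall x y, E (x0 + x) (y0 + y) <-> E (x0 + (c * x - s * y)) (y0 + (s * x + c * y))].
Proof.
move=> nE /(honeycomb _ _ nE) K.
have inv : invariant 1 E.
  by move=> a b u v x y f; rewrite !honeycomb //; exact: orb_act.
have g := reach_rot (reach_id (1 : R)).
exists (- (1 / 2) * 1 - h * 0), (h * 1 - 1 / 2 * 0); split.
- exact: reach_unit g.
- by rewrite mulr0 subr0 => e; move: e; clear; lra.
by apply: (invariant_rotation inv g _ _ K); rewrite !mulr0 ?subrr ?addr0.
Qed.
End Honeycomb.

(** * Shells around three collinear points *)

Section ThreeTops.
Variable R : realType.
Implicit Types (F D E : R -> R -> Prop) (x y a b u v r : R) (p q w : R * R) (t : seq (R * R)).

(** Since (y' - y) (y + y') = x^2 - x'^2, a large sum of heights makes a chord nearly horizontal. *)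
Lemma chord_gap (x y x' y' r S M d : R) : x ^+ 2 + y ^+ 2 = r -> x' ^+ 2 + y' ^+ 2 = r ->
  0 < S -> S <= y + y' -> - M <= x ^+ 2 - x' ^+ 2 -> x ^+ 2 - x' ^+ 2 <= M -> 0 <= M ->
  1 <= (x - x') ^+ 2 + (y - y') ^+ 2 -> 0 <= d -> d ^+ 2 * S ^+ 2 + M ^+ 2 <= S ^+ 2 ->
  x <= x' -> d <= x' - x.
Proof.
move=> n n' S0 Sy m1 m2 M0 k d0 e l.
have e1 : (y' - y) * (y + y') = x ^+ 2 - x' ^+ 2 by move: n n'; clear; nra.
have q : (y - y') ^+ 2 * S ^+ 2 <= M ^+ 2.
  have -> : (y - y') ^+ 2 * S ^+ 2 = (y' - y) ^+ 2 * S ^+ 2 by ring.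
  have : (y' - y) ^+ 2 * S ^+ 2 <= ((y' - y) * (y + y')) ^+ 2.
    by rewrite exprMn ler_wpM2l ?sqr_ge0 // ler_sqr ?nnegrE; lra.
  by rewrite e1; move: m1 m2 M0; clear; nra.
have S2 : 0 < S ^+ 2 by rewrite exprn_gt0.
have : d ^+ 2 <= (x' - x) ^+ 2.
  rewrite -(ler_pM2r S2); have -> : (x' - x) ^+ 2 * S ^+ 2 = (x - x') ^+ 2 * S ^+ 2 by ring.
  by move: k e q S2; clear; nra.
by rewrite ler_sqr ?nnegrE //; lra.
Qed.

Lemma sqr_lower (d y : R) : 0 <= d -> 0 <= y -> d ^+ 2 <= y ^+ 2 -> d <= y.
Proof. by move=> d0 y0; rewrite ler_sqr ?nnegrE. Qed.

(** The outer abscissae have absolute value at most r / 2. Hence gaps of 93/100 exclude r < 8/5 and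
    gaps of 92/100 exclude r < 9/5. Beyond that, gaps of 89/100 within the width 2 fix the three
    positions. *)
Lemma three_tops F r x1 y1 x2 y2 x3 y3 : separated F -> 1 <= r -> window F r ->
  upper F r [:: (x1, y1); (x2, y2); (x3, y3)] ->
  [/\ - (11 / 100) <= x2, x2 <= 11 / 100, 3 / 4 <= x3, x3 <= 1 & - 1 <= x1 /\ x1 <= - (3 / 4)].
Proof.
move=> sF r1 w [so ut].
have P x y : (x, y) \in [:: (x1, y1); (x2, y2); (x3, y3)] ->
    [/\ F x y, x ^+ 2 + y ^+ 2 = r, 0 < y, r <= 2 * y ^+ 2 & x ^+ 2 <= y ^+ 2].
  by move=> /ut[f n p]; have [] := window_flat r1 w f n; split.
have [f1 n1 p1 s1 t1] : [/\ F x1 y1, x1 ^+ 2 + y1 ^+ 2 = r, 0 < y1, r <= 2 * y1 ^+ 2 & x1 ^+ 2 <= y1 ^+ 2].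
  by apply: P; rewrite !inE eqxx.
have [f2 n2 p2 s2 t2] : [/\ F x2 y2, x2 ^+ 2 + y2 ^+ 2 = r, 0 < y2, r <= 2 * y2 ^+ 2 & x2 ^+ 2 <= y2 ^+ 2].
  by apply: P; rewrite !inE eqxx ?orbT.
have [f3 n3 p3 s3 t3] : [/\ F x3 y3, x3 ^+ 2 + y3 ^+ 2 = r, 0 < y3, r <= 2 * y3 ^+ 2 & x3 ^+ 2 <= y3 ^+ 2].
  by apply: P; rewrite !inE eqxx ?orbT.
move: so => /=; rewrite andbT => /andP[l12 l23].
have d12 := separated_ge sF f1 f2 (negbT (lt_eqF l12)).
have d23 := separated_ge sF f2 f3 (negbT (lt_eqF l23)).
have g12 := flat_arc_gap n1 n2 l12 p1 p2 t1 t2 d12.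
have g23 := flat_arc_gap n2 n3 l23 p2 p3 t2 t3 d23.
have [w1 v1] := w _ _ f1 n1; have [w3 v3] := w _ _ f3 n3; have [w2 _] := w _ _ f2 n2.
have b1 : - 1 <= x1 by move: w1; clear; nra.
have b3 : x3 <= 1 by move: w3; clear; nra.
have c1 : - r <= 2 * x1 by move: v1 r1; clear; nra.
have c3 : 2 * x3 <= r by move: v3 r1; clear; nra.
have a2 : - (3 / 10) <= x2 /\ x2 <= 3 / 10 by move: g12 g23 b1 b3; clear; lra.
have q2 : x2 ^+ 2 <= 9 / 100 by move: a2; clear; case; nra.
have o2 := sqr_ge0 x2; have o1 := sqr_ge0 x1; have o3 := sqr_ge0 x3.
(* successively sharper gaps *)
have gap S M d : 0 < S -> 0 <= M -> 0 <= d -> d ^+ 2 * S ^+ 2 + M ^+ 2 <= S ^+ 2 ->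
    S <= y1 + y2 -> S <= y2 + y3 -> x1 ^+ 2 <= M -> x3 ^+ 2 <= M -> x2 ^+ 2 <= M ->
    d <= x2 - x1 /\ d <= x3 - x2.
  move=> S0 M0 d0 e S1 S2 m1 m3 m2; split.
    by apply: (@chord_gap _ _ _ _ r S M d n1 n2) => //; [move: m2 o1|move: m1 o2|]; clear -l12; lra.
  by apply: (@chord_gap _ _ _ _ r S M d n2 n3) => //; [move: m3 o2|move: m2 o3|]; clear -l23; lra.
have lo A B : 0 <= A /\ 0 <= B -> A ^+ 2 <= r - x1 ^+ 2 -> A ^+ 2 <= r - x3 ^+ 2 -> B ^+ 2 <= r - x2 ^+ 2 ->
    A + B <= y1 + y2 /\ A + B <= y2 + y3.
  move=> [A0 B0] e1 e3 e2.
  have k1 : A <= y1 by apply: sqr_lower (ltW p1) _ => //; move: e1 n1; clear; lra.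
  have k2 : B <= y2 by apply: sqr_lower (ltW p2) _ => //; move: e2 n2; clear; lra.
  have k3 : A <= y3 by apply: sqr_lower (ltW p3) _ => //; move: e3 n3; clear; lra.
  by move: k1 k2 k3; clear; lra.
have r18 : 9 / 5 <= r.
  rewrite leNgt; apply/negP => r2; have [r3|r3] := ltrP r (8 / 5).
    have [k1 k2] : 86 / 100 + 95 / 100 <= y1 + y2 /\ 86 / 100 + 95 / 100 <= y2 + y3.
      by apply: lo; [by clear; lra|move: v1|move: v3|]; move: r1 r3 q2; clear; nra.
    have [] := @gap (181 / 100) (64 / 100) (93 / 100).
    - by clear; lra.
    - by clear; lra.
    - by clear; lra.
    - by clear; lra.
    - by move: k1; clear; lra.
    - by move: k2; clear; lra.
    - by move: v1 r3 r1; clear; nra.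
    - by move: v3 r3 r1; clear; nra.
    - by move: q2; clear; lra.
    by move: c1 c3 r3; clear; lra.
  have [k1 k2] : 97 / 100 + 122 / 100 <= y1 + y2 /\ 97 / 100 + 122 / 100 <= y2 + y3.
    by apply: lo; [by clear; lra|move: v1|move: v3|]; move: r2 r3 q2; clear; nra.
  have [] := @gap (219 / 100) (81 / 100) (92 / 100).
  - by clear; lra.
  - by clear; lra.
  - by clear; lra.
  - by clear; lra.
  - by move: k1; clear; lra.
  - by move: k2; clear; lra.
  - by move: v1 r2 r1; clear; nra.
  - by move: v3 r2 r1; clear; nra.
  - by move: q2; clear; lra.
  by move: c1 c3 r2; clear; lra.
have u x : x ^+ 2 <= 1 -> 4 * x ^+ 2 <= r ^+ 2 -> (98 / 100) ^+ 2 <= r - x ^+ 2.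
  by move: r18; clear; have [l|l] := lerP 2 r; nra.
have [k1 k2] : 98 / 100 + 13 / 10 <= y1 + y2 /\ 98 / 100 + 13 / 10 <= y2 + y3.
  by apply: lo; [by clear; lra|exact: u|exact: u|move: q2 r18; clear; nra].
have [] := @gap (228 / 100) 1 (89 / 100).
- by clear; lra.
- by clear; lra.
- by clear; lra.
- by clear; lra.
- by move: k1; clear; lra.
- by move: k2; clear; lra.
- by [].
- by [].
- by [].
by move: b1 b3; clear; split; [lra|lra|lra|lra|split; lra].
Qed.

(* [m] is a point of the nearest shell around (1, 0). *)
Lemma near_middle (r h1 c x2 y2 X m : R) : r - 1 <= h1 -> h1 <= r + 1 - 2 * c -> 3 / 4 <= c ->
  - (11 / 100) <= x2 -> x2 <= 11 / 100 -> x2 ^+ 2 + y2 ^+ 2 = r -> 0 < y2 -> 0 < m ->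
  (X - 1) ^+ 2 + m ^+ 2 = h1 -> 0 <= X -> X <= 1 / 2 -> 1 <= X ^+ 2 + m ^+ 2 ->
  (X - x2) ^+ 2 + (m - y2) ^+ 2 < 1.
Proof.
move=> l1 l2 c1 b1 b2 n y0 m0 nm X0 X1 k.
have q2 : x2 ^+ 2 <= 2 / 100 by move: b1 b2; clear; nra.
have hi : y2 ^+ 2 <= m ^+ 2 + 1 + (1 - X) ^+ 2 by move: l1 n nm (sqr_ge0 x2); clear; lra.
have mb : 1 - X ^+ 2 <= m.
  have [q0 q1] : 0 <= X ^+ 2 /\ X ^+ 2 <= 1 by move: X0 X1; clear; split; nra.
  apply: sqr_lower (ltW m0) _; first by move: q1; clear; lra.
  by move: k q0 q1; move: (X ^+ 2) => z; clear; nra.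
have qX : 1 / 4 <= (X - 1) ^+ 2 by move: X0 X1; clear; nra.
have lo : m <= y2 by apply: sqr_lower (ltW m0) (ltW y0) _; move: l2 c1 nm n q2 qX; clear; lra.
have up : y2 <= m + 74 / 100.
  rewrite leNgt; apply/negP => l.
  have : (m + 74 / 100) ^+ 2 < y2 ^+ 2 by move: l m0; clear; nra.
  by move: hi mb X0 X1; clear; nra.
have dx : (X - x2) ^+ 2 <= 373 / 1000 by move: X0 X1 b1 b2; clear; nra.
by move: dx lo up; clear; nra.
Qed.

Lemma near_right (r h1 c y3 X m : R) : r - 1 <= h1 -> h1 <= r + 1 - 2 * c -> 3 / 4 <= c -> c <= 1 ->
  1 <= h1 -> c ^+ 2 + y3 ^+ 2 = r -> 0 < y3 -> 0 < m -> (X - 1) ^+ 2 + m ^+ 2 = h1 ->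
  1 / 2 <= X -> X <= 3 / 2 -> (X - c) ^+ 2 + (m - y3) ^+ 2 < 1.
Proof.
move=> l1 l2 c1 c2 h1g n y0 m0 nm X0 X1.
have qX : (X - 1) ^+ 2 <= 1 / 4 by move: X0 X1; clear; nra.
have mb : 86 / 100 <= m by apply: sqr_lower (ltW m0) _; [lra|move: nm qX h1g; clear; lra].
have yb : 96 / 100 <= y3.
  by apply: sqr_lower (ltW y0) _; [lra|move: n l2 h1g c1 c2; clear; nra].
have e : (m - y3) * (m + y3) = h1 - r + c ^+ 2 - (X - 1) ^+ 2 by move: nm n; clear; lra.
have [e1 e2] : - (69 / 100) <= (m - y3) * (m + y3) /\ (m - y3) * (m + y3) <= 69 / 100.
  by rewrite e; move: l1 l2 qX c1 c2 (sqr_ge0 (X - 1)); clear; split; nra.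
have dy : (m - y3) ^+ 2 <= 16 / 100.
  have [f1 f2] : - (4 / 10) <= m - y3 /\ m - y3 <= 4 / 10.
    by move: e1 e2 mb yb; clear; split; nra.
  by move: f1 f2; clear; nra.
have dx : (X - c) ^+ 2 <= 57 / 100 by move: X0 X1 c1 c2; clear; nra.
by move: dx dy; clear; lra.
Qed.

(** The middle point of the triple blocks the abscissae up to 1/2, and the right point blocks those
    up to 3/2 except for itself. *)
Lemma near_cases F (r h1 x1 y1 x2 y2 x3 y3 X m : R) : separated F -> 1 <= r -> window F r ->
  upper F r [:: (x1, y1); (x2, y2); (x3, y3)] ->
  (forall a b, F a b -> 1 <= a ^+ 2 + b ^+ 2) ->
  (forall a b, F a b -> h1 <= (a - 1) ^+ 2 + b ^+ 2) -> 1 <= h1 -> r - 1 <= h1 ->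
  F X m -> (X - 1) ^+ 2 + m ^+ 2 = h1 -> 0 <= X -> 0 < m -> 3 / 2 < X \/ X = x3 /\ m = y3.
Proof.
move=> sF r1 w ut d0 d1 h1g l1 f nm X0 m0.
have [b1 b2 c1 c2 _] := three_tops sF r1 w ut; have [so um] := ut.
have [f2 n2 p2] : [/\ F x2 y2, x2 ^+ 2 + y2 ^+ 2 = r & 0 < y2] by apply/um; rewrite !inE eqxx ?orbT.
have [f3 n3 p3] : [/\ F x3 y3, x3 ^+ 2 + y3 ^+ 2 = r & 0 < y3] by apply/um; rewrite !inE eqxx ?orbT.
have l2 : h1 <= r + 1 - 2 * x3 by have := d1 _ _ f3; move: n3; clear; lra.
have [X1|X1] := lerP X (1 / 2).
  exfalso; have [e1 e2] := sF _ _ _ _ f f2 (near_middle l1 l2 c1 b1 b2 n2 p2 m0 nm X0 X1 (d0 _ _ f)).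
  by move: nm; rewrite e1 e2; move: so l2 n2 => /= /andP[_ /andP[l _]]; move: l; clear; lra.
have [X2|X2] := lerP X (3 / 2); last by left.
by right; apply: sF f f3 _; apply: (near_right l1 l2 c1 c2 h1g n3) => //; exact: ltW.
Qed.
End ThreeTops.

(** * Symmetry of a circle between two adjacent centres *)

Section SymmetricShell.
Variable R : realType.
Implicit Types (F D E : R -> R -> Prop) (x y a b u v r : R) (p q w : R * R) (t : seq (R * R)).

Lemma sum_ge_size (T : eqType) (s : seq T) (f : T -> R) (e : R) :
  (forall p : T, p \in s -> - e <= f p) -> - (e * (size s)%:R) <= \sum_(p <- s) f p.
Proof.
elim: s => [|p s IH] H; first by rewrite big_nil mulr0 oppr0.
rewrite big_cons [(size _)%:R]/= -natr1 mulrDr mulr1 opprD addrC.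
by apply: lerD; [apply: H; rewrite mem_head|apply: IH => q qs; apply: H; rewrite inE qs orbT].
Qed.

Lemma sum_ge_one (T : eqType) (s : seq T) (f : T -> R) (p : T) : p \in s ->
  (forall q : T, q \in s -> 0 <= f q) -> f p <= \sum_(q <- s) f q.
Proof.
move=> ps H; rewrite (big_rem _ ps) /= lerDl big_seq; apply: sumr_ge0 => q /mem_rem; exact: H.
Qed.

(** Look at the nearest circle around [(1, 0)]. By [near_cases] it consists of at most the right
    points of the two triples and of points further right than 3/2. A single one of the latter would
    outweigh the former, so there are none. The others do not lie right of the centre, and balance
    puts them on the vertical line through it. *)
Lemma nearest_center F r x1 y1 x2 y2 x3 y3 u1 v1 u2 v2 u3 v3 : separated F -> 1 <= r -> window F r ->
  upper F r [:: (x1, y1); (x2, y2); (x3, y3)] ->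
  upper (mirror F) r [:: (u1, v1); (u2, v2); (u3, v3)] ->
  balanced0 F -> balanced0 (shift 1 0 F) ->
  (forall a b, F a b -> 1 <= a ^+ 2 + b ^+ 2) ->
  (forall a b, F a b -> 1 <= (a - 1) ^+ 2 + b ^+ 2) ->
  (forall a b, F a b -> r - 1 <= (a - 1) ^+ 2 + b ^+ 2) -> x3 = 1 /\ u3 = 1.
Proof.
move=> sF r1 w ut ut' bF bF1 d0 d1 dr.
have [_ _ c1 c2 _] := three_tops sF r1 w ut.
have [_ _ c1' c2' _] := three_tops (separated_mirror sF) r1 (window_mirror w) ut'.
have [f3 _ p3] : [/\ F x3 y3, x3 ^+ 2 + y3 ^+ 2 = r & 0 < y3] by apply/(ut.2); rewrite !inE eqxx ?orbT.
have [_ _ q3] : [/\ mirror F u3 v3, u3 ^+ 2 + v3 ^+ 2 = r & 0 < v3] by apply/(ut'.2); rewrite !inE eqxx ?orbT.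
have [|a [b [fab mn]]] := nearest (separated_shift (a := 1) (b := 0) sF).
  by exists (x3 - 1), y3; rewrite /shift addrC subrK add0r.
set h1 := a ^+ 2 + b ^+ 2 in mn.
rewrite /shift add0r in fab.
have e1 c : 1 + c - 1 = c :> R by rewrite addrC addKr.
have h1g : 1 <= h1 by have := d1 _ _ fab; rewrite e1.
have hr : r - 1 <= h1 by have := dr _ _ fab; rewrite e1.
have d1' c d : F c d -> h1 <= (c - 1) ^+ 2 + d ^+ 2.
  by move=> f; apply: mn; rewrite /shift addrC subrK add0r.
have [s [[us hs] s1 s2]] := bF1 h1.
have P p : p \in s -> F (1 + p.1) p.2 /\ p.1 ^+ 2 + p.2 ^+ 2 = h1.
  by move=> /hs; rewrite /shift add0r.
(* A point left of the origin has, by balance about the origin, a companion on the right that is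
   nearer to [(1, 0)]. *)
have pos p : p \in s -> 0 <= 1 + p.1.
  move=> /P[f n]; rewrite leNgt; apply/negP => l.
  have [|x' [y' [f' n' l']]] := @balanced_opposite _ _ (- 1) 0 _ _ bF f; first by move: l; clear; lra.
  by have := d1' _ _ f'; move: n n' l l'; clear; lra.
have near p : p \in s -> [\/ 1 / 2 < p.1, p = (x3 - 1, y3) | p = (u3 - 1, - v3)].
  move=> ps; have [f n] := P p ps; have p0 := pos p ps.
  have n' : (1 + p.1 - 1) ^+ 2 + p.2 ^+ 2 = h1 by rewrite e1.
  have [ys|ys|yz] := ltrgtP 0 p.2.
  - have [l|[l1 l2]] := near_cases sF r1 w ut d0 d1' h1g hr f n' p0 ys.
      by constructor 1; move: l; clear; lra.
    by constructor 2; apply/pair_eqP => /=; split=> //; rewrite -l1; ring.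
  - have m0 c d : mirror F c d -> 1 <= c ^+ 2 + d ^+ 2 by move=> /d0; rewrite sqrrN.
    have m1 c d : mirror F c d -> h1 <= (c - 1) ^+ 2 + d ^+ 2 by move=> /d1'; rewrite sqrrN.
    have mf : mirror F (1 + p.1) (- p.2) by rewrite /mirror opprK.
    have mn' : (1 + p.1 - 1) ^+ 2 + (- p.2) ^+ 2 = h1 by rewrite sqrrN.
    have ny : 0 < - p.2 by rewrite oppr_gt0.
    have [l|[l1 l2]] := near_cases (separated_mirror sF) r1 (window_mirror w) ut' m0 m1 h1g hr mf mn' p0 ny.
      by constructor 1; move: l; clear; lra.
    by constructor 3; apply/pair_eqP => /=; split; [rewrite -l1; ring|rewrite -l2 opprK].
  - constructor 1; have := d0 _ _ f; rewrite -yz !expr0n !addr0 in n *.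
    by move: n h1g p0; clear; nra.
have small p : p \in s -> p.1 <= 1 / 2.
  move=> ps; rewrite leNgt; apply/negP => l.
  pose A q := 1 / 2 < q.1 :> R; pose B q := ~~ A q.
  have : \sum_(q <- s) q.1 = \sum_(q <- s | A q) q.1 + \sum_(q <- s | B q) q.1 by exact: bigID.
  rewrite s1 -[X in _ = X + _]big_filter -[X in _ = _ + X]big_filter => e.
  have a1 : p.1 <= \sum_(q <- filter A s) q.1.
    apply: sum_ge_one => [|q]; first by rewrite mem_filter ps andbT.
    by rewrite mem_filter /A => /andP[k _]; move: k; clear; lra.
  have sub : (size (filter B s) <= 2)%N.
    apply: (@uniq_leq_size _ _ [:: (x3 - 1, y3); (u3 - 1, - v3)]); first by rewrite filter_uniq.
    move=> q; rewrite mem_filter /B /A => /andP[k /near[k'|->|->]]; rewrite ?inE ?eqxx ?orbT //.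
    by rewrite k' in k.
  have a2 : - (1 / 4 * (size (filter B s))%:R) <= \sum_(q <- filter B s) q.1.
    apply: sum_ge_size => q; rewrite mem_filter /B /A => /andP[k /near[k'|->|->]] /=.
    - by rewrite k' in k.
    - by move: c1; clear; lra.
    - by move: c1'; clear; lra.
  have : (size (filter B s))%:R <= 2 :> R by rewrite ler_nat.
  by move: e a1 a2 l; clear; lra.
have two p : p \in s -> p = (x3 - 1, y3) \/ p = (u3 - 1, - v3).
  move=> ps; have [l|->|->] := near p ps; [|by left|by right].
  by have := small p ps; rewrite leNgt l.
have zero p : p \in s -> p.1 = 0.
  have le0 q : q \in s -> q.1 <= 0 by move=> /two[]-> /=; rewrite subr_le0.
  move=> ps; apply/eqP; rewrite eq_le le0 //=.
  have := @sum_ge_one _ s (fun q => - q.1) p ps; rewrite sumrN s1 oppr0 oppr_le0; apply=> q qs.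
  by rewrite oppr_ge0 le0.
have mab : (a, b) \in s by apply/hs; split=> //; rewrite /shift add0r.
have az : a = 0 := zero _ mab.
have bz : b != 0.
  by apply/eqP => bz; move: h1g; rewrite /h1 az bz expr0n /= addr0; clear; lra.
have both : (exists p, p \in s /\ 0 < p.2) /\ (exists p, p \in s /\ p.2 < 0).
  have fs : shift 1 0 F a b by rewrite /shift add0r.
  have [bs|bs|be] := ltrgtP 0 b; last by rewrite -be eqxx in bz.
    split; first by exists (a, b).
    have [|x' [y' [f' n' l']]] := @balanced_opposite _ _ 0 1 _ _ bF1 fs; first by rewrite mul0r mul1r add0r.
    by exists (x', y'); split; [apply/hs|move: l' => /=; rewrite mul0r mul1r add0r].
  split; last by exists (a, b).
  have [|x' [y' [f' n' l']]] := @balanced_opposite _ _ 0 (- 1) _ _ bF1 fs; first by rewrite mul0r mulN1r add0r oppr_gt0.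
  by exists (x', y'); split; [apply/hs|move: l' => /=; rewrite mul0r mulN1r add0r oppr_lt0].
have [[p [ps pp]] [q [qs qn]]] := both; split.
  have := zero p ps; have [e|e] := two p ps; rewrite e /= in pp *; first by move/subr0_eq.
  by rewrite oppr_gt0 in pp; move: pp q3; clear; lra.
have := zero q qs; have [e|e] := two q qs; rewrite e /= in qn *; last by move/subr0_eq.
by move: qn p3; clear; lra.
Qed.

Definition opp F x y := F (- x) (- y).

Lemma separated_opp F : separated F -> separated (opp F).
Proof.
move=> sF x y x' y' f f' l; have [] := sF _ _ _ _ f f'; first by move: l; clear; nra.
by move=> /oppr_inj -> /oppr_inj ->.
Qed.

Lemma oppE F : opp F = turn (- 1) 0 F.
Proof.
apply/funext => x; apply/funext => y; rewrite /opp /turn.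
by congr (F _ _); ring.
Qed.

Lemma unit_opp : (- 1) ^+ 2 + 0 ^+ 2 = 1 :> R.
Proof. by ring. Qed.

Lemma balanced_opp F : balanced0 F -> balanced0 (opp F).
Proof. by move=> bF; rewrite oppE; apply: balanced0_turn bF; exact: unit_opp. Qed.

Lemma upper_opp F r x1 y1 x2 y2 x3 y3 : upper (mirror F) r [:: (x1, y1); (x2, y2); (x3, y3)] ->
  upper (opp F) r [:: (- x3, y3); (- x2, y2); (- x1, y1)].
Proof.
move=> [so um]; split; first by move: so => /=; rewrite !ltrN2 !andbT => /andP[-> ->].
move=> x y; have k (c d : R) : ((x, y) == (- c, d)) = ((- x, y) == (c, d)) by rewrite !xpair_eqE eqr_oppLR.
have -> : ((x, y) \in [:: (- x3, y3); (- x2, y2); (- x1, y1)]) =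
    ((- x, y) \in [:: (x1, y1); (x2, y2); (x3, y3)]).
  by rewrite !inE !k; do 3 case: (_ == _).
by rewrite um sqrrN.
Qed.

(** If the circle is not antipodal, [nearest_center] on both sides places the outer points of both
    triples at abscissae 1 and - 1. An outermost point is then a corner of this rectangle. *)
Lemma sym_shell F r x y : separated F -> balanced0 F -> balanced0 (shift 1 0 F) ->
  balanced0 (shift (- 1) 0 F) ->
  (forall a b, F a b -> 1 <= a ^+ 2 + b ^+ 2) ->
  (forall a b, F a b -> 1 <= (a - 1) ^+ 2 + b ^+ 2) ->
  (forall a b, F a b -> 1 <= (a + 1) ^+ 2 + b ^+ 2) ->
  (forall a b, F a b -> r - 1 <= (a - 1) ^+ 2 + b ^+ 2) ->
  (forall a b, F a b -> r - 1 <= (a + 1) ^+ 2 + b ^+ 2) ->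
  F x y -> x ^+ 2 + y ^+ 2 = r -> (forall a b, F a b -> a ^+ 2 + b ^+ 2 = r -> a ^+ 2 <= x ^+ 2) ->
  F (- x) (- y).
Proof.
move=> sF bF b1 b2 d0 d1 d2 l1 l2 f n mx.
have r1 : 1 <= r by rewrite -n; exact: d0 f.
have w : window F r.
  move=> a b g m; have := d1 _ _ g; have := d2 _ _ g; have := l1 _ _ g; have := l2 _ _ g.
  by move: m r1; clear; split; nra.
have [an|[x1 [y1 [x2 [y2 [x3 [y3 [u1 [v1 [u2 [v2 [u3 [v3 [ut ut' _ _]]]]]]]]]]]]]] := window_cases sF bF r1 w.
  exact: an.
have [ex eu] := nearest_center sF r1 w ut ut' bF b1 d0 d1 l1.
have wo : window (opp F) r.
  by move=> a b g m; have := w _ _ g; rewrite !sqrrN; apply.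
have ut2 : upper (mirror (opp F)) r [:: (- x3, y3); (- x2, y2); (- x1, y1)].
  have -> : mirror (opp F) = opp (mirror F) by [].
  apply: upper_opp; suff -> : mirror (mirror F) = F by [].
  by apply/funext => a; apply/funext => b; rewrite /mirror opprK.
have bs : balanced0 (shift 1 0 (opp F)).
  apply: balanced0_ext (balanced_opp b2) => a b; rewrite /opp /shift !add0r; split; congr (F _ _); ring.
have [|||ex' eu'] := nearest_center (separated_opp sF) r1 wo (upper_opp ut') ut2 (balanced_opp bF) bs.
- by move=> a b /d0; rewrite !sqrrN.
- by move=> a b /d2; rewrite sqrrN; have -> : (- a + 1) ^+ 2 = (a - 1) ^+ 2 by ring.
- by move=> a b /l2; rewrite sqrrN; have -> : (- a + 1) ^+ 2 = (a - 1) ^+ 2 by ring.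
have T p : p \in [:: (x1, y1); (x2, y2); (x3, y3)] -> [/\ F p.1 p.2, p.1 ^+ 2 + p.2 ^+ 2 = r & 0 < p.2].
  by case: p => c d /(ut.2).
have T' p : p \in [:: (u1, v1); (u2, v2); (u3, v3)] -> [/\ F p.1 (- p.2), p.1 ^+ 2 + p.2 ^+ 2 = r & 0 < p.2].
  by case: p => c d /(ut'.2).
have [f1 n1 p1] := T _ (mem_head _ _); have [f1' n1' p1'] := T' _ (mem_head _ _).
have [f3 n3 p3] : [/\ F x3 y3, x3 ^+ 2 + y3 ^+ 2 = r & 0 < y3] by apply/(ut.2); rewrite !inE eqxx ?orbT.
have [f3' n3' p3'] : [/\ mirror F u3 v3, u3 ^+ 2 + v3 ^+ 2 = r & 0 < v3] by apply/(ut'.2); rewrite !inE eqxx ?orbT.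
rewrite /= in f1 n1 p1 f1' n1' p1'; rewrite /mirror in f3'.
have x1e : x1 = - 1 by move: eu'; clear; lra.
have u1e : u1 = - 1 by move: ex'; clear; lra.
rewrite {ex' eu' T T'} ex eu x1e u1e in f1 n1 f1' n1' f3 n3 f3' n3'.
have x2e : x ^+ 2 = 1.
  apply/eqP; rewrite eq_le; apply/andP; split; first by have [] := w _ _ f n.
  by have := mx _ _ f3 n3; rewrite expr1n.
have same c d : d ^+ 2 = r - 1 -> c ^+ 2 = r - 1 -> 0 < c -> 0 < d -> c = d.
  by move=> e1 e2 c0 d0'; move: e1 e2 c0 d0'; clear; nra.
have y2e : y ^+ 2 = r - 1 by move: n x2e; clear; lra.
have g1 : y1 ^+ 2 = r - 1 by move: n1; clear; lra.
have g2 : v1 ^+ 2 = r - 1 by move: n1'; clear; lra.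
have g3 : y3 ^+ 2 = r - 1 by move: n3; clear; lra.
have g4 : v3 ^+ 2 = r - 1 by move: n3'; clear; lra.
have y0 : y != 0 by apply/eqP => yz; move: g1 p1 y2e; rewrite yz; clear; nra.
have [ys|ys|ye] := ltrgtP 0 y; last by rewrite -ye eqxx in y0.
  move/eqP: x2e; rewrite sqrf_eq1 => /orP[]/eqP ->.
    by rewrite (same y v1).
  by rewrite opprK (same y v3).
have ny : (- y) ^+ 2 = r - 1 by rewrite sqrrN.
have ny0 : 0 < - y by rewrite oppr_gt0.
move/eqP: x2e; rewrite sqrf_eq1 => /orP[]/eqP ->.
  by rewrite (same (- y) y1).
by rewrite opprK (same (- y) y3).
Qed.
End SymmetricShell.

(** * Transfer of nearest points from one centre to the next *)

Section Transfer.
Variable R : realType.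
Implicit Types (F D E : R -> R -> Prop) (x y a b u v r : R) (p q w : R * R) (t : seq (R * R)).

Lemma rightmost F r a b : separated F -> F a b -> a ^+ 2 + b ^+ 2 = r ->
  exists x y, [/\ F x y, x ^+ 2 + y ^+ 2 = r & forall c d, F c d -> c ^+ 2 + d ^+ 2 = r -> c <= x].
Proof.
move=> sF f n; pose F' x y := F x y /\ x ^+ 2 + y ^+ 2 = r.
have sF' : separated F' by move=> x y x' y' [g _] [g' _]; exact: sF.
have bF' p : F' p.1 p.2 -> [/\ - (r + 1) <= p.1, p.1 <= r + 1, - (r + 1) <= p.2 & p.2 <= r + 1].
  by case=> _ l; move: l (sqr_ge0 p.1) (sqr_ge0 p.2); clear; split; nra.
have [|[x y] /= [[g m] mn]] := bounded_min (fun p => - p.1) sF' bF'; first by exists a, b.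
by exists x, y; split=> // c d g' m'; have := mn (c, d) (conj g' m'); rewrite lerN2.
Qed.

Definition three_centers F := [/\ separated F, balanced0 F, balanced0 (shift 1 0 F),
  balanced0 (shift (- 1) 0 F) & [/\ forall a b, F a b -> 1 <= a ^+ 2 + b ^+ 2,
  forall a b, F a b -> 1 <= (a - 1) ^+ 2 + b ^+ 2 & forall a b, F a b -> 1 <= (a + 1) ^+ 2 + b ^+ 2]].

Lemma three_centers_opp F : three_centers F -> three_centers (opp F).
Proof.
move=> [sF b0 b1 b2 [d0 d1 d2]]; split.
- exact: separated_opp.
- exact: balanced_opp.
- apply: balanced0_ext (balanced_opp b2) => a b; rewrite /opp /shift !add0r; split; congr (F _ _); ring.
- apply: balanced0_ext (balanced_opp b1) => a b; rewrite /opp /shift !add0r; split; congr (F _ _); ring.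
split=> a b.
- by move=> /d0; rewrite !sqrrN.
- by move=> /d2; rewrite sqrrN; have -> : (- a + 1) ^+ 2 = (a - 1) ^+ 2 by ring.
- by move=> /d1; rewrite sqrrN; have -> : (- a - 1) ^+ 2 = (a + 1) ^+ 2 by ring.
Qed.

Definition near_left F h x y := [/\ F x y, (x + 1) ^+ 2 + y ^+ 2 = h &
  forall a b, F a b -> h <= (a + 1) ^+ 2 + b ^+ 2].

(** By balance about [(- 1, 0)], the rightmost of the nearest points does not lie left of this
    centre, which provides the bound r - 1 of [sym_shell]. *)
Definition last_left F h x y := near_left F h x y /\
  forall a b, F a b -> (a + 1) ^+ 2 + b ^+ 2 = h -> a <= x.

Lemma last_left_exists F a b : three_centers F -> F a b -> exists h x y, last_left F h x y.
Proof.
move=> [sF _ _ b2 _] f; have sS := separated_shift (a := - 1) (b := 0) sF.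
have e c : - 1 + c + 1 = c :> R by rewrite addrAC addNr add0r.
have [|c [d [g mn]]] := nearest sS.
  by exists (a + 1), b; rewrite /shift add0r [- 1 + _]addrC addrK.
have [x [y [g' n' mx]]] := rightmost sS g erefl.
have mn' a' b' : F a' b' -> c ^+ 2 + d ^+ 2 <= (a' + 1) ^+ 2 + b' ^+ 2.
  by move=> f'; apply: mn; rewrite /shift add0r [- 1 + _]addrC addrK.
exists (c ^+ 2 + d ^+ 2), (- 1 + x), y; rewrite /shift add0r in g'; split.
  by split=> //; rewrite e.
move=> a' b' f' n2; have := mx (a' + 1) b'; rewrite /shift add0r (_ : - 1 + (a' + 1) = a'); last by ring.
by move=> /(_ f' n2); clear; lra.
Qed.

(** The point is outermost on its circle around the origin: one further out would be nearer than the
    minimal distance to [(- 1, 0)] or [(1, 0)]. *)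
Lemma transfer_le F h x y : three_centers F -> last_left F h x y ->
  (forall a b, F a b -> h <= (a - 1) ^+ 2 + b ^+ 2) -> F (- x) (- y).
Proof.
move=> [sF b0 b1 b2 [d0 d1 d2]] [[f n mn] mx] l.
have x1 : - 1 <= x.
  rewrite leNgt; apply/negP => x1.
  have fs : shift (- 1) 0 F (x + 1) y by rewrite /shift add0r [- 1 + _]addrC addrK.
  have [|x' [y' [f' n' l']]] := @balanced_opposite _ _ (- 1) 0 _ _ b2 fs; first by move: x1; clear; lra.
  rewrite /shift add0r n in f' n'.
  have := mx _ _ f'; rewrite (_ : - 1 + x' + 1 = x'); last by ring.
  by move=> /(_ n'); move: l' x1; clear; lra.
apply: (sym_shell sF b0 b1 b2 d0 d1 d2 _ _ f erefl) => a b g.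
- by have := l _ _ g; move: n x1; clear; lra.
- by have := mn _ _ g; move: n x1; clear; lra.
move=> m; have k1 := l _ _ g; have k2 := mn _ _ g.
have [e1 e2] : x <= a /\ a <= - x by move: k1 k2 m n; clear; split; lra.
by move: e1 e2; clear; nra.
Qed.

(** The smaller of the minimal distances from [(- 1, 0)] and [(1, 0)] is transferred to the other
    centre by [transfer_le], so the two agree. *)
Lemma transfer F h x y : three_centers F -> last_left F h x y ->
  [/\ F (- x) (- y), forall a b, F a b -> h <= (a - 1) ^+ 2 + b ^+ 2 &
    forall a b, F a b -> (a - 1) ^+ 2 + b ^+ 2 = h -> - x <= a].
Proof.
move=> tF lF; have tO := three_centers_opp tF; have [[f n mn] mx] := lF.
have fo : opp F (- x) (- y) by rewrite /opp !opprK.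
have [h' [x' [y' lO]]] := last_left_exists tO fo; have [[f' n' mn'] mx'] := lO.
have sq c : (- c + 1) ^+ 2 = (c - 1) ^+ 2 :> R by ring.
have sq' c : (- c - 1) ^+ 2 = (c + 1) ^+ 2 :> R by ring.
have m1 a b : F a b -> h' <= (a - 1) ^+ 2 + b ^+ 2.
  by move=> g; have := mn' (- a) (- b); rewrite /opp !opprK sq sqrrN; apply.
have hh' : h <= h'.
  rewrite leNgt; apply/negP => l; have g : F x' y'.
    rewrite -[x']opprK -[y']opprK; apply: (transfer_le tO lO) => a b g.
    by have := mn _ _ g; rewrite sq sqrrN => k; exact: le_trans (ltW l) k.
  by have := mn _ _ g; rewrite n' leNgt l.
have le a b : F a b -> h <= (a - 1) ^+ 2 + b ^+ 2 by move=> /m1; exact: le_trans.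
split=> //; first exact: transfer_le tF lF le.
have g := transfer_le tF lF le.
have eh : h' = h.
  by apply/eqP; rewrite eq_le hh' andbT; have := m1 _ _ g; rewrite sqrrN sq' n.
have g' : F x' y'.
  rewrite -[x']opprK -[y']opprK; apply: (transfer_le tO lO) => a b k.
  by have := mn _ _ k; rewrite sq sqrrN eh.
have xx : x' <= x by apply: mx g' _; rewrite n' eh.
move=> a b k m; have := mx' (- a) (- b); rewrite /opp !opprK sq sqrrN eh => /(_ k m).
by move: xx; clear; lra.
Qed.
End Transfer.

(** * Honeycombs with halved edges *)

Section HalvedHoneycomb.
Variable R : realType.
Implicit Types (F D E K : R -> R -> Prop) (x y a b u v r : R) (p q w : R * R) (t : seq (R * R)).
Notation h := (h R).

Lemma rotation_fixed (c s X Y : R) : c ^+ 2 + s ^+ 2 = 1 -> c <> 1 -> X = c * X - s * Y ->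
  Y = s * X + c * Y -> X = 0 /\ Y = 0.
Proof.
move=> cs c1 eX eY.
have d0 : (1 - c) ^+ 2 + s ^+ 2 != 0.
  have -> : (1 - c) ^+ 2 + s ^+ 2 = 2 * (1 - c) by move: cs; clear; lra.
  by apply/eqP => e; apply: c1; move: e; clear; lra.
have X0 : X = 0.
  apply: (mulfI d0); rewrite mulr0; have e1 : (1 - c) * X = - (s * Y) by move: eX; clear; lra.
  have e2 : (1 - c) * Y = s * X by move: eY; clear; lra.
  have -> : ((1 - c) ^+ 2 + s ^+ 2) * X = (1 - c) * ((1 - c) * X) + s * (s * X) by ring.
  by rewrite e1 -e2; ring.
have Y0 : Y = 0.
  apply: (mulfI d0); rewrite mulr0; have e1 : (1 - c) * X = - (s * Y) by move: eX; clear; lra.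
  have e2 : (1 - c) * Y = s * X by move: eY; clear; lra.
  have -> : ((1 - c) ^+ 2 + s ^+ 2) * Y = (1 - c) * ((1 - c) * Y) + s * (s * Y) by ring.
  have -> : s * Y = - ((1 - c) * X) by rewrite e1 opprK.
  by rewrite e2; ring.
by [].
Qed.

(** The rotation permutes the points of [K] on each circle, so their sum is fixed by it and
    vanishes. *)
Lemma balanced_diff E K (c s : R) : c ^+ 2 + s ^+ 2 = 1 -> c <> 1 ->
  (forall x y, K x y -> K (c * x - s * y) (s * x + c * y)) -> (forall x y, K x y -> E x y) ->
  balanced0 E -> balanced0 (fun x y => E x y /\ ~ K x y).
Proof.
move=> cs c1 rK KE bE r; have [l [[ul hl] s1 s2]] := bE r.
pose k p := `[< K p.1 p.2 >]; pose g p := (c * p.1 - s * p.2, s * p.1 + c * p.2).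
pose A := filter k l; pose B := filter (fun p => ~~ k p) l.
have gi : injective g.
  move=> p q [e1 e2]; apply/pair_eqP.
  have [] := @unit_sq_inj _ c s (p.1 - q.1) (p.2 - q.2) cs; last by move=> /subr0_eq-> /subr0_eq->.
    by move: e1; clear; lra.
  by move: e2; clear; lra.
have uA : uniq A by rewrite filter_uniq.
have gA : perm_eq (map g A) A.
  have sub : {subset map g A <= A}.
    move=> q /mapP[p]; rewrite mem_filter => /andP[/asboolP kp /hl[_ n]] ->.
    rewrite mem_filter; apply/andP; split; first by apply/asboolP; exact: rK.
    apply/hl; split; first by apply: KE; exact: rK.
    rewrite /= -n; have -> : (c * p.1 - s * p.2) ^+ 2 + (s * p.1 + c * p.2) ^+ 2 =
      (c ^+ 2 + s ^+ 2) * (p.1 ^+ 2 + p.2 ^+ 2) by ring.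
    by rewrite cs mul1r.
  have ug : uniq (map g A) by rewrite map_inj_uniq.
  have [|_ e] := uniq_min_size ug sub; first by rewrite size_map.
  by apply: uniq_perm => // q; rewrite e.
set X := \sum_(p <- A) p.1; set Y := \sum_(p <- A) p.2.
have eX : X = c * X - s * Y.
  by rewrite {1}/X -(perm_big _ gA) big_map /= sumrB -!mulr_sumr.
have eY : Y = s * X + c * Y.
  by rewrite {1}/Y -(perm_big _ gA) big_map /= big_split /= -!mulr_sumr.
have [X0 Y0] := rotation_fixed cs c1 eX eY.
have split_sum (f : R * R -> R) : \sum_(p <- l) f p = \sum_(p <- A) f p + \sum_(p <- B) f p.
  by rewrite (bigID k) /= !big_filter.
exists B; split.
- split; first by rewrite filter_uniq.
  move=> p; rewrite mem_filter; split; first by move=> /andP[/asboolPn nk /hl[]].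
  by move=> [[e nk] n]; apply/andP; split; [apply/asboolPn|apply/hl].
- by have := split_sum fst; rewrite s1 -/X X0 add0r.
- by have := split_sum snd; rewrite s2 -/Y Y0 add0r.
Qed.

Definition nice2 E := [/\ good E, E 0 0, tri E & deg2 (back E)].

Lemma tri_not_deg2 E : tri E -> deg2 E -> False.
Proof.
by move=> [_ b _ _] [_ d]; have := d _ _ b (half_h R); have := h_gt0 R; clear; lra.
Qed.

Lemma nice2_tw E : nice2 E -> nice2 (tw E).
Proof.
case=> g e t d; have g1 := good_tw g; have e1 := tw_origin e; have t1 := tri_turn t.
split=> //; have [t2|//] := tri_neighbour g1 e1 t1.
have t3 := tri_all g1 e1 t1 t2.
have := tri_all (good_tw g1) (tw_origin e1) (tri_turn t1) t3; rewrite tw3 => t4.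
by have := tri_not_deg2 t4 d.
Qed.

(** The frame at the far end of the doubled edge, which is threefold by [deg2_far_tri]. *)
Lemma nice2_back E : nice2 E -> nice2 (back_by 2 E).
Proof.
case=> g e t d; have [t1 t2 t3 _] := t.
have eo : back_by 2 E = turn (- 1) 0 (shift 2 0 E).
  by apply: pred2_ext => x y; rewrite /back_by /turn /shift; split; congr (E _ _); ring.
have es : back_by 2 E = shift (- 1) 0 (back E).
  by apply: pred2_ext => x y; rewrite /back_by /back /shift; split; congr (E _ _); ring.
have half : 1 - 3 / 2 = - (1 / 2) :> R by field.
split.
- by rewrite eo; apply: good_turn (good_shift 2 0 g); exact: unit_opp.
- by have [b _] := d; move: b; rewrite /back_by /back; congr (E _ _); ring.
- rewrite es; apply: deg2_far_tri => //.
  + exact: good_back.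
  + by rewrite /back subr0 oppr0.
  + by rewrite /back subrr oppr0.
  + by rewrite /back half.
  + by rewrite /back half opprK.
have [_ d'] := d; split.
  by move: e; rewrite /back /back_by; congr (E _ _); ring.
move=> x y f n; have := d' (- x) (- y); rewrite !sqrrN => /(_ _ n) H.
apply/eqP; rewrite -oppr_eq0; apply/eqP; apply: H.
by move: f; rewrite /back /back_by; congr (E _ _); ring.
Qed.

(* Vertices and edge midpoints of a honeycomb with edges of length 2; its hexagons have the centres
   [orb 2 (- 2) 0]. *)
Definition lattice x y := orb 2 0 0 x y \/ orb 2 1 0 x y.
Definition extra E x y := E x y /\ ~ lattice x y.

Lemma lattice_act a b u v x y : reach 2 a b u v ->
  lattice (a + (u * x - v * y)) (b + (v * x + u * y)) <-> lattice x y.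
Proof. by move=> f; rewrite /lattice !orb_act. Qed.

Lemma lattice_sub E x y : nice2 E -> lattice x y -> E x y.
Proof.
move=> nE [] [a [b [u [v [f [-> ->]]]]]]; have [_ E0 [E1 _ _ _] _] := reach_ind_frame nice2_tw nice2_back nE f.
  by rewrite !mulr0 subrr !addr0 -(frame_origin a b u v).
exact: E1.
Qed.

Lemma extra_frame E a b u v : reach 2 a b u v -> extra (frame a b u v E) = frame a b u v (extra E).
Proof.
move=> f; apply: pred2_ext => x y; rewrite /extra /frame /turn /shift.
by rewrite (lattice_act _ _ f).
Qed.

Lemma lattice_points : [/\ lattice 0 0, lattice 1 0, lattice 2 0, lattice (- (1 / 2)) h & lattice (- (1 / 2)) (- h)].
Proof.
have i := reach_id (2 : R); have r1 := reach_rot i; have r2 := reach_rot r1.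
split; [left|right|left|right|right].
- exact: orb0.
- by do 4 eexists; split; [exact: i|split; ring].
- by have [] := orb_arms (2 : R).
- by do 4 eexists; split; [exact: r1|split; ring].
- do 4 eexists; split; [exact: r2|split; last by field].
  have -> : 0 + ((- (1 / 2) * (- (1 / 2) * 1 - h * 0) - h * (h * 1 - 1 / 2 * 0)) * 1 - (h * (- (1 / 2) * 1 - h * 0) - 1 / 2 * (h * 1 - 1 / 2 * 0)) * 0) = 1 / 4 - h * h by field.
  by rewrite hh; field.
Qed.

Lemma extra_far E a b c d : nice2 E -> extra E a b -> lattice c d -> 1 <= (a - c) ^+ 2 + (b - d) ^+ 2.
Proof.
move=> nE [f k] l; have [[sE _] _ _ _] := nE; rewrite leNgt; apply/negP => lt.
by have [e1 e2] := sE _ _ _ _ f (lattice_sub nE l) lt; apply: k; rewrite e1 e2.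
Qed.

Lemma extra_norm E a b : nice2 E -> extra E a b -> 1 < a ^+ 2 + b ^+ 2.
Proof.
move=> nE f; have [l0 l1 _ l2 l3] := lattice_points.
have := extra_far nE f l0; rewrite !subr0 le_eqVlt => /orP[/eqP/esym n|//].
have [_ _ [_ _ _ d] _] := nE; have [g k] := f.
by case: (d _ _ g n) => -[e1 e2]; case: k; rewrite e1 e2.
Qed.

Lemma extra_separated E : nice2 E -> separated (extra E).
Proof. by move=> [[sE _] _ _ _] x y x' y' [f _] [f' _]; exact: sE. Qed.

Lemma extra_balanced E : nice2 E -> balanced0 (extra E).
Proof.
move=> nE; have [g e _ _] := nE; have w := reach_rot (reach_id (2 : R)).
apply: (@balanced_diff _ _ (- (1 / 2)) h); [exact: half_h|lra| |by move=> x y; exact: lattice_sub|exact: balanced_origin].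
move=> x y /(lattice_act _ _ w); congr lattice; by field.
Qed.

Lemma extra_mid E : nice2 E -> balanced0 (shift 1 0 (extra E)).
Proof.
move=> nE; have [[_ bE] _ [e1 _ _ _] _] := nE; have w := reach_step (reach_id (2 : R)).
apply: (@balanced_diff (shift 1 0 E) (shift 1 0 lattice) (- 1) 0).
- exact: unit_opp.
- by lra.
- move=> x y /(lattice_act _ _ w); rewrite /shift; congr lattice; by ring.
- by move=> x y; exact: lattice_sub.
- exact: bE.
Qed.

(** The middle centre is the midpoint [(1, 0)] of a doubled edge, the outer ones are the ends of
    this edge. *)
Lemma extra_centers E : nice2 E -> three_centers (shift 1 0 (extra E)).
Proof.
move=> nE; have [l0 l1 l2 _ _] := lattice_points; split.
- exact: separated_shift (extra_separated nE).
- exact: extra_mid.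
- have w := reach_step (reach_id (2 : R)); have := frame_step 2 0 0 1 0 E; rewrite frame_id => ew.
  have := extra_balanced (nice2_back nE); rewrite -ew (extra_frame _ w) => /balanced_opp.
  by apply: balanced0_ext => x y; rewrite /opp /frame /turn /shift; split; congr extra; ring.
- apply: balanced0_ext (extra_balanced nE) => x y; rewrite /shift; split; congr extra; ring.
split=> a b; rewrite /shift add0r => f.
- by have := extra_far nE f l1; rewrite subr0 (_ : 1 + a - 1 = a) //; ring.
- by have := extra_far nE f l2; rewrite subr0 (_ : 1 + a - 2 = a - 1) //; ring.
- by have := extra_far nE f l0; rewrite !subr0 [1 + a]addrC.
Qed.

(** A point beyond the midpoint [(1, 0)] has, by balance about it, a companion nearer to the
    origin. *)
Lemma nearest_side E a b : nice2 E -> extra E a b ->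
  (forall c d, extra E c d -> a ^+ 2 + b ^+ 2 <= c ^+ 2 + d ^+ 2) -> a <= 1.
Proof.
move=> nE f mn; rewrite leNgt; apply/negP => l.
have fs : shift 1 0 (extra E) (a - 1) b by rewrite /shift add0r addrCA subrr addr0.
have [|x [y [g n k]]] := @balanced_opposite _ _ 1 0 _ _ (extra_mid nE) fs; first by move: l; clear; lra.
by have := mn _ _ g; move: n k l; clear; lra.
Qed.

Lemma tw_frame E : tw E = frame 0 0 (- (1 / 2) * 1 - h * 0) (h * 1 - 1 / 2 * 0) E.
Proof. by rewrite frame_rot frame_id. Qed.

Lemma extra_tw E : extra (tw E) = tw (extra E).
Proof. by rewrite !tw_frame extra_frame //; exact: reach_rot (reach_id _). Qed.

Lemma twR F x y : tw F (- (1 / 2) * x + h * y) (- h * x - 1 / 2 * y) = F x y.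
Proof. by rewrite /tw turn_rxy rx3 ry3. Qed.

Lemma nearest_tri E a b : nice2 E -> extra E a b ->
  (forall c d, extra E c d -> a ^+ 2 + b ^+ 2 <= c ^+ 2 + d ^+ 2) -> in_tri 1 a b.
Proof.
move=> nE f mn; have n1 := nice2_tw nE; have n2 := nice2_tw n1.
have mn1 c d : extra (tw E) c d -> a ^+ 2 + b ^+ 2 <= c ^+ 2 + d ^+ 2.
  by rewrite extra_tw /tw turn_rxy => /mn; rewrite rxy_norm.
have mn2 c d : extra (tw (tw E)) c d -> a ^+ 2 + b ^+ 2 <= c ^+ 2 + d ^+ 2.
  by rewrite extra_tw /tw turn_rxy => /mn1; rewrite rxy_norm.
split; first exact: nearest_side nE f mn.
  apply: (nearest_side (b := - h * a - 1 / 2 * b) n1); first by rewrite extra_tw twR.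
  by move=> c d; rewrite rxy_norm2; exact: mn1.
have := nearest_side (a := rx a b) (b := ry a b) n2; rewrite rxy_norm /rx => H; apply: H mn2.
by rewrite !extra_tw /tw !turn_rxy; case: (rotK a b) => -> ->.
Qed.

(** In the third of the triangle that belongs to the vertex [(- 2, 0)], the unit discs around the
    origin and two edge midpoints leave only points near this vertex. *)
Lemma corner_dist x y : 1 < x ^+ 2 + y ^+ 2 -> in_tri 1 x y ->
  1 <= (x - - (1 / 2)) ^+ 2 + (y - h) ^+ 2 -> 1 <= (x - - (1 / 2)) ^+ 2 + (y - - h) ^+ 2 ->
  x <= - (1 / 2) * x + h * y -> x <= - (1 / 2) * x - h * y -> (x - - 2) ^+ 2 + (y - 0) ^+ 2 < 1.
Proof.
move=> n [_ b1 b2] k1 k2 l1 l2; have e := h2 R.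
have ey : y ^+ 2 = 4 / 3 * (h * y) ^+ 2 by rewrite exprMn e; field.
have {}k1 : 0 <= x ^+ 2 + y ^+ 2 + x - 2 * (h * y) by move: k1 e; clear; lra.
have {}k2 : 0 <= x ^+ 2 + y ^+ 2 + x + 2 * (h * y) by move: k2 e; clear; lra.
rewrite subr0 ey; rewrite ey in n k1 k2.
have main z : 0 <= z -> 1 < x ^+ 2 + 4 / 3 * z ^+ 2 -> 0 <= x ^+ 2 + 4 / 3 * z ^+ 2 + x - 2 * z ->
    - (1 / 2) * x + z <= 1 -> x <= - (1 / 2) * x - z -> (x - - 2) ^+ 2 + 4 / 3 * z ^+ 2 < 1.
  rewrite -[x]opprK; move: (- x) => s z0 m1 m2 m3 m4.
  have [s1|s1] := lerP (114 / 100) s; first by move: z0 m3 s1 m4; clear; nra.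
  have [s2|s2] := ltrP s 1; first by exfalso; move: m1 m2 m3 m4 s2 z0; clear; nra.
  have q : 4 / 3 * z <= s ^+ 2 - s by move: m2 m3 s2 z0; clear; nra.
  have q2 : z <= 9 / 10 * (s - 1) by move: q s1 s2; clear; nra.
  have [s3|s3] := eqVneq s 1.
    by exfalso; move: q2 z0 m1; rewrite s3; clear; nra.
  have s4 : 0 < s - 1 by rewrite subr_gt0 lt_neqAle eq_sym s3.
  by move: q2 z0 s4 s1; clear; nra.
have [z0|z0] := lerP 0 (h * y).
  by apply: main => //; move: k1; clear; lra.
have -> : (h * y) ^+ 2 = (- (h * y)) ^+ 2 by rewrite sqrrN.
rewrite -[(h * y) ^+ 2]sqrrN in n k1 k2.
by apply: main => //; [rewrite oppr_ge0 ltW|move: k2; clear; lra|move: l1; clear; lra].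
Qed.

Lemma corner_close r x y x' y' : 2 < r -> x ^+ 2 + y ^+ 2 = r -> x' ^+ 2 + y' ^+ 2 = r ->
  in_tri 1 x y -> in_tri 1 x' y' -> x <= - 1 -> x' <= - 1 -> (x - x') ^+ 2 + (y - y') ^+ 2 < 1.
Proof.
move=> r2 n n' [_ b1 b2] [_ b1' b2'] l l'.
have k a b : a ^+ 2 + b ^+ 2 = r -> - (1 / 2) * a + h * b <= 1 -> - (1 / 2) * a - h * b <= 1 -> a <= - 1 ->
    a <= - (136 / 100) /\ b ^+ 2 <= 14 / 100.
  move=> m c1 c2 c3.
  have q : (h * b) ^+ 2 <= (1 + a / 2) ^+ 2 by move: c1 c2; clear; nra.
  rewrite exprMn h2 in q.
  have a1 : a <= - (136 / 100) by move: q m r2 c3; clear; nra.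
  by split=> //; have a2 : - 2 <= a by [move: c1 c2; clear; lra]; move: q a1 a2; clear; nra.
have [q1 q2] := k _ _ n b1 b2 l; have [p1 p2] := k _ _ n' b1' b2' l'.
have w : (x - x') * (x + x') = y' ^+ 2 - y ^+ 2 by move: n n'; clear; nra.
have o1 := sqr_ge0 y; have o2 := sqr_ge0 y'.
have [d1 d2] : x - x' <= 6 / 100 /\ - (6 / 100) <= x - x' by move: w q1 q2 p1 p2 o1 o2; clear; split; nra.
have := sqr_ge0 (y + y'); move: d1 d2 q2 p2; clear; nra.
Qed.

(** Up to r = 2 this is [tri_shell] for the whole configuration. Beyond, the nearest extra points
    lie in [in_tri 1], and each of its corners holds at most one of them. *)
Lemma extra_rot E x y : nice2 E -> extra E x y ->
  (forall c d, extra E c d -> x ^+ 2 + y ^+ 2 <= c ^+ 2 + d ^+ 2) -> extra E (rx x y) (ry x y).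
Proof.
move=> nE f mn; have [gE e0 tE _] := nE; have [sE _] := gE.
have [r2|r2] := lerP (x ^+ 2 + y ^+ 2) 2.
  have [g k] := f; split.
    exact: tri_shell sE (balanced_origin gE e0) tE (extra_norm nE f) r2 g erefl.
  have w := reach_rot (reach_id (2 : R)).
  move=> l; apply: k; apply/(lattice_act _ _ w); move: l; congr lattice; rewrite /rx /ry; by field.
apply: (corner_shell (t := 1) (extra_separated nE) (extra_balanced nE) _ _ _ _ f erefl).
- by [].
- by move: r2; clear; lra.
- by move=> a b g n; apply: (nearest_tri nE g) => c d /mn; rewrite n.
- by move=> a b a' b'; exact: corner_close r2.
Qed.

Lemma corner_extra E x y : nice2 E -> extra E x y -> in_tri 1 x y ->
  x <= - (1 / 2) * x + h * y -> x <= - (1 / 2) * x - h * y -> (x - - 2) ^+ 2 + (y - 0) ^+ 2 < 1.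
Proof.
move=> nE f t; have [_ _ _ l2 l3] := lattice_points.
exact: corner_dist (extra_norm nE f) t (extra_far nE f l2) (extra_far nE f l3).
Qed.

(** Let w be the rightmost of the extra points nearest to the origin and R the turn by 120 degrees.
    By [transfer] the reflection of w in the edge midpoint is extra and nearest to the other end of
    the edge, so [extra_rot] applies at both ends. If R w lies in the corner [(- 2, 0)], then w and
    (2, 0) - R^2 w are extra points that differ by (- 2, 0) - R w, because w + R w + R^2 w = 0. This
    is shorter than 1, so R w = (- 2, 0). If R^2 w lies in the corner, the argument is the same. *)
Lemma extra_center E a b : nice2 E -> extra E a b -> extra E (- 2) 0.
Proof.
move=> nE f; have tF := extra_centers nE.
have fs : shift 1 0 (extra E) (a - 1) b by rewrite /shift add0r addrCA subrr addr0.
have [H [x0 [y [[fx nx mnx] mx]]]] := last_left_exists tF fs.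
have [g mn1 _] := transfer tF (conj (And3 fx nx mnx) mx).
rewrite /shift add0r in fx.
pose x := 1 + x0; have ex0 : x0 = x - 1 by rewrite /x addrC addKr.
have fw : extra E x y by [].
have nw : x ^+ 2 + y ^+ 2 = H by rewrite -nx /x [1 + x0]addrC.
have mn c d : extra E c d -> x ^+ 2 + y ^+ 2 <= c ^+ 2 + d ^+ 2.
  move=> k; rewrite nw; have := mnx (c - 1) d; rewrite subrK; apply.
  by rewrite /shift add0r addrCA subrr addr0.
have mxw c d : extra E c d -> c ^+ 2 + d ^+ 2 = x ^+ 2 + y ^+ 2 -> c <= x.
  rewrite nw => k n; have := mx (c - 1) d; rewrite subrK ex0 lerBlDr subrK; apply=> //.
  by rewrite /shift add0r addrCA subrr addr0.
have nE' := nice2_back nE.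
have be : extra (back_by 2 E) = back_by 2 (extra E).
  have := frame_step 2 0 0 1 0 E; rewrite frame_id => <-; rewrite extra_frame; last exact: reach_step (reach_id _).
  by rewrite frame_step frame_id.
have fw' : extra (back_by 2 E) x y.
  by rewrite be /back_by; move: g; rewrite /shift add0r ex0; congr extra; ring.
have mn' c d : extra (back_by 2 E) c d -> x ^+ 2 + y ^+ 2 <= c ^+ 2 + d ^+ 2.
  rewrite be nw => k; have := mn1 (1 - c) (- d); rewrite sqrrN (_ : (1 - c - 1) ^+ 2 = c ^+ 2); last by ring.
  by apply; move: k; rewrite /shift add0r /back_by; congr extra; ring.
have tw_ := nearest_tri nE fw mn.
have f1 := extra_rot nE fw mn; have f1' := extra_rot nE' fw' mn'.
have mnr G c d : (forall c d, extra G c d -> x ^+ 2 + y ^+ 2 <= c ^+ 2 + d ^+ 2) -> extra G c d ->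
   rx x y ^+ 2 + ry x y ^+ 2 <= c ^+ 2 + d ^+ 2 by move=> H0 k0; rewrite rxy_norm; exact: H0.
have f2 := extra_rot nE f1 (fun c d => mnr E c d mn).
have f2' := extra_rot nE' f1' (fun c d => mnr _ c d mn').
rewrite rx2 ry2 in f2 f2'.
have sF := extra_separated nE.
have l1 : - (1 / 2) * x - h * y <= x.
  by have := mxw _ _ f1; rewrite rxy_norm => /(_ erefl).
have l2 : - (1 / 2) * x + h * y <= x by have := mxw _ _ f2; rewrite rxy_norm2; apply.
rewrite be /back_by in f1' f2'.
have sx : x + rx x y + (- (1 / 2) * x + h * y) = 0 by rewrite /rx; field.
have sy : y + ry x y + (- h * x - 1 / 2 * y) = 0 by rewrite /ry; field.
have t1 := in_tri_rot tw_; have t2 := in_tri_rot t1; rewrite rx2 ry2 in t2.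
have [e1 e2] := rotK x y.
have [c1|/ltW c1] := lerP (rx x y) (- (1 / 2) * x + h * y).
  have q : (rx x y - - 2) ^+ 2 + (ry x y - 0) ^+ 2 < 1.
    apply: (corner_extra nE f1 t1); first by rewrite -rx2 e1.
    by rewrite -[leRHS]/(rx (rx x y) (ry x y)) rx2.
  have [] := sF _ _ _ _ fw f2'.
    by move: q sx sy; move: (rx x y) (ry x y) (- (1 / 2) * x + h * y) (- h * x - 1 / 2 * y) => A B C D; clear; nra.
  move=> k1 k2; have <- : rx x y = - 2 by move: k1 sx; clear; lra.
  by have <- : ry x y = 0 by move: k2 sy; clear; lra.
have q : ((- (1 / 2) * x + h * y) - - 2) ^+ 2 + ((- h * x - 1 / 2 * y) - 0) ^+ 2 < 1.
  apply: (corner_extra nE f2 t2); last by rewrite -[leRHS]/(rx _ _) rx3.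
  by rewrite -(rx2 (- (1 / 2) * x + h * y)) rx3 ry3.
have [] := sF _ _ _ _ fw f1'.
  by move: q sx sy; move: (rx x y) (ry x y) (- (1 / 2) * x + h * y) (- h * x - 1 / 2 * y) => A B C D; clear; nra.
move=> k1 k2; have <- : - (1 / 2) * x + h * y = - 2 by move: k1 sx; clear; lra.
by have <- : - h * x - 1 / 2 * y = 0 by move: k2 sy; clear; lra.
Qed.

Lemma orb_tw (p q x y : R) : orb 2 p q (rx x y) (ry x y) <-> orb 2 p q x y.
Proof.
rewrite -(orb_act p q x y (reach_rot (reach_id (2 : R)))) /rx /ry.
by split; congr orb; field.
Qed.

Lemma extra_orb0 E x y : nice2 E -> extra E x y -> in_tri 1 x y -> orb 2 (- 2) 0 x y.
Proof.
move=> nE f t; have [b0 b1 b2] := t.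
have main G a b : nice2 G -> extra G a b -> in_tri 1 a b -> a <= - (1 / 2) * a + h * b ->
    a <= - (1 / 2) * a - h * b -> orb 2 (- 2) 0 a b.
  move=> nG g tG l1 l2; have [->  ->] := extra_separated nG g (extra_center nG g) (corner_extra nG g tG l1 l2).
  by do 4 eexists; split; [exact: reach_id|split; ring].
have n1 := nice2_tw nE; have n2 := nice2_tw n1; have [e1 e2] := rotK x y.
have t1 := in_tri_rot t; have t2 := in_tri_rot t1.
have f2 : extra (tw E) (rx (rx x y) (ry x y)) (ry (rx x y) (ry x y)) by rewrite extra_tw /tw turn_rxy e1 e2.
have f1 : extra (tw (tw E)) (rx x y) (ry x y) by rewrite !extra_tw /tw !turn_rxy e1 e2.
have r0 : x = - (1 / 2) * rx x y + h * ry x y by rewrite -rx2 e1.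
have r1 : rx (rx x y) (ry x y) = - (1 / 2) * rx x y - h * ry x y by [].
have r2 : - (1 / 2) * rx (rx x y) (ry x y) - h * ry (rx x y) (ry x y) = x := e1.
have r3 : - (1 / 2) * rx (rx x y) (ry x y) + h * ry (rx x y) (ry x y) = rx x y by rewrite -rx2 e1 e2.
have r4 : rx (rx x y) (ry x y) = - (1 / 2) * x + h * y := rx2 x y.
have r5 : rx x y = - (1 / 2) * x - h * y by [].
have [l1|/ltW l1] := lerP x (rx x y).
  have [l2|/ltW l2] := lerP x (rx (rx x y) (ry x y)).
    by apply: main nE f t _ _ => //; rewrite -?r4 -?r5.
  apply: (iffLR (orb_tw _ _ _ _)); apply: (iffLR (orb_tw _ _ _ _)); apply: main n1 f2 t2 _ _ => //; rewrite ?r2 ?r3 //; exact: le_trans l2 l1.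
have [l2|/ltW l2] := lerP (rx x y) (rx (rx x y) (ry x y)).
  by apply: (iffLR (orb_tw _ _ _ _)); apply: main n2 f1 t1 _ _ => //; rewrite -?r0 -?r1.
apply: (iffLR (orb_tw _ _ _ _)); apply: (iffLR (orb_tw _ _ _ _)); apply: main n1 f2 t2 _ _ => //; rewrite ?r2 ?r3 //; exact: le_trans l2 l1.
Qed.

Lemma extra_orb E x y : nice2 E -> extra E x y -> orb 2 (- 2) 0 x y.
Proof.
move=> nE f.
have sK : separated (orb 2 0 0 : R -> R -> Prop).
  by move=> a b a' b' k k'; have [[sE _] _ _ _] := nE; apply: sE; apply: lattice_sub nE _; left.
have [a [b [u [v [wx [wy [g ex ey m]]]]]]] := nearest_frame x y sK.
rewrite ex ey (orb_act _ _ _ _ g); have n1 := reach_ind_frame nice2_tw nice2_back nE g.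
apply: (extra_orb0 n1); first by rewrite (extra_frame _ g) /frame /turn /shift -ex -ey.
have [a1 a2 a3] := orb_arms (2 : R); have hh := hh R.
have k1 := m _ _ a1; have k2 := m _ _ a2; have k3 := m _ _ a3.
by split; [move: k1|move: k2 hh|move: k3 hh]; clear; lra.
Qed.

(** A single extra point yields a hexagon centre in every frame of the group, so there are no extra
    points or all centres. *)
Lemma nice2_cases E : nice2 E -> (forall x y, E x y <-> lattice x y) \/
  (forall x y, E x y <-> lattice x y \/ orb 2 (- 2) 0 x y).
Proof.
move=> nE; have [[x0 [y0 f]]|no] := pselect (exists x y, extra E x y).
  right=> x y; split.
    by move=> e; have [k|k] := pselect (lattice x y); [left|right; apply: (extra_orb nE)].
  case; first exact: lattice_sub.
  move=> [a [b [u [v [g [-> ->]]]]]]; have n1 := reach_ind_frame nice2_tw nice2_back nE g.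
  have fg : extra (frame a b u v E) (u * (x0 - a) + v * (y0 - b)) (u * (y0 - b) - v * (x0 - a)).
    have k z : z = (u ^+ 2 + v ^+ 2) * z by rewrite (reach_unit g) mul1r.
    rewrite (extra_frame _ g) /frame /turn /shift.
    rewrite (_ : a + _ = x0); last by rewrite -[RHS](subrK a) [x0 - a in RHS]k; ring.
    by rewrite (_ : b + _ = y0) //; rewrite -[RHS](subrK b) [y0 - b in RHS]k; ring.
  by have [] := extra_center n1 fg.
left=> x y; split; last exact: lattice_sub.
by move=> e; apply: contrapT => k; apply: no; exists x, y.
Qed.
End HalvedHoneycomb.

(** * Rotations in the presence of a triangle, lines of unit steps in its absence *)

Section ThreefoldSymmetry.
Variable R : realType.
Implicit Types (F D E K : R -> R -> Prop) (x y a b u v r : R) (p q w : R * R) (t : seq (R * R)).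
Notation h := (h R).

(** [(c, s)] stands for cosine and sine; [c <> 1] excludes the identity, which gives the unique
    fixed point. *)
Definition rotatable E x0 y0 := exists c s : R, [/\ c ^+ 2 + s ^+ 2 = 1, c <> 1 &
  forall x y, E (x0 + x) (y0 + y) <-> E (x0 + (c * x - s * y)) (y0 + (s * x + c * y))].

Lemma nice2_symmetric E x0 y0 : nice2 E -> E x0 y0 -> rotatable E x0 y0.
Proof.
move=> nE Ek.
have inv : invariant 2 E.
  move=> a b u v x y f; have [e|e] := nice2_cases nE; rewrite !e (lattice_act _ _ f) //.
  by rewrite (orb_act _ _ _ _ f).
have rot (p q a b c s : R) : reach 2 a b c s -> p = a + (c * p - s * q) -> q = b + (s * p + c * q) ->
    c <> 1 -> orb 2 p q x0 y0 -> rotatable E x0 y0.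
  move=> f ep eq c1 k; exists c, s; split=> //; first exact: reach_unit f.
  exact: invariant_rotation inv f ep eq k.
have hh := hh R; have r1 := reach_rot (reach_id (2 : R)).
have e : (- (1 / 2) * 1 - h * 0) = - (1 / 2) by ring.
have e' : h * 1 - 1 / 2 * 0 = h by ring.
rewrite e e' in r1.
have : orb 2 0 0 x0 y0 \/ orb 2 1 0 x0 y0 \/ orb 2 (- 2) 0 x0 y0.
  have [k|k] := nice2_cases nE; move/k: Ek.
    by case; [left|right; left].
  by case=> [[]|]; [left|right; left|right; right].
case=> [k|[k|k]].
- by apply: (rot 0 0 _ _ _ _ r1 _ _ _ k); rewrite ?mulr0 ?subrr ?addr0 //; lra.
- by apply: (rot 1 0 _ _ _ _ (reach_step (reach_id 2)) _ _ _ k); [ring|ring|lra].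
(* Turns by 120, 180 and 120 degrees compose to the rotation by 60 degrees about the hexagon
   centre. *)
apply: (rot (- 2) 0 _ _ _ _ (reach_rot (reach_step r1)) _ _ _ k).
- have -> : - (1 / 2) * - - (1 / 2) - h * - h = - (1 / 4) + h * h by field.
  by rewrite hh; field.
- by field.
- have -> : - (1 / 2) * - - (1 / 2) - h * - h = - (1 / 4) + h * h by field.
  by rewrite hh; lra.
Qed.

Lemma tri_symmetric E x0 y0 : good E -> E 0 0 -> tri E -> E x0 y0 -> rotatable E x0 y0.
Proof.
move=> g e t k; have [t'|d] := tri_neighbour g e t.
  by apply: nice_symmetric k; split.
by apply: nice2_symmetric k; split.
Qed.

Lemma frame_inv E a b u v x y : u ^+ 2 + v ^+ 2 = 1 ->
  frame a b u v E (u * (x - a) + v * (y - b)) (u * (y - b) - v * (x - a)) <-> E x y.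
Proof.
move=> n; have k z : z = (u ^+ 2 + v ^+ 2) * z by rewrite n mul1r.
rewrite /frame /turn /shift (_ : a + _ = x); last by rewrite -[RHS](subrK a) [x - a in RHS]k; ring.
by rewrite (_ : b + _ = y) //; rewrite -[RHS](subrK b) [y - b in RHS]k; ring.
Qed.

Lemma rotatable_frame E a b u v x0 y0 : u ^+ 2 + v ^+ 2 = 1 ->
  rotatable (frame a b u v E) (u * (x0 - a) + v * (y0 - b)) (u * (y0 - b) - v * (x0 - a)) ->
  rotatable E x0 y0.
Proof.
move=> n [c [s [cs c1 H]]]; exists c, s; split=> // x y.
rewrite -!(frame_inv E a b _ _ n); have := H (u * x + v * y) (u * y - v * x).
move=> h1; have i (z w : R) : u * (x0 + z - a) + v * (y0 + w - b) = u * (x0 - a) + v * (y0 - b) + (u * z + v * w) by ring.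
have j (z w : R) : u * (y0 + w - b) - v * (x0 + z - a) = u * (y0 - b) - v * (x0 - a) + (u * w - v * z) by ring.
rewrite !i !j h1; split; congr (frame _ _ _ _ _ _ _); ring.
Qed.

Lemma good_frame E a b u v : u ^+ 2 + v ^+ 2 = 1 -> good E -> good (frame a b u v E).
Proof. by move=> n g; apply: good_turn => //; exact: good_shift. Qed.

Lemma tri_frame_symmetric E a b u v x0 y0 : good E -> E a b -> u ^+ 2 + v ^+ 2 = 1 ->
  tri (frame a b u v E) -> E x0 y0 -> rotatable E x0 y0.
Proof.
move=> g e n t k; apply: (rotatable_frame (a := a) (b := b) n); apply: tri_symmetric t _.
- exact: good_frame.
- by rewrite frame_origin.
- by apply/frame_inv.
Qed.

Lemma prolong E a b u v : good E -> u ^+ 2 + v ^+ 2 = 1 -> ~ tri (frame a b u v E) ->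
  E a b -> E (a + u) (b + v) -> antipodal (frame a b u v E) 1.
Proof.
move=> g n nt e e1; have gf := good_frame a b n g; have [sf _] := gf.
have f0 : frame a b u v E 0 0 by rewrite frame_origin.
have f1 : frame a b u v E 1 0 by rewrite /frame /turn /shift !mulr1 !mulr0 subr0 addr0.
have [//|//|f5] := unit_types sf (balanced_origin gf f0) f1.
by case: (no_five gf f0 f1 f5).
Qed.

Lemma line_contained E : good E -> (forall a b u v, E a b -> u ^+ 2 + v ^+ 2 = 1 -> ~ tri (frame a b u v E)) ->
  E 0 0 -> E 1 0 -> forall k : int, E k%:~R 0.
Proof.
move=> g nt e0 e1.
have u1 : 1 ^+ 2 + 0 ^+ 2 = 1 :> R by rewrite expr1n expr0n addr0.
have step x : E x 0 -> E (x + 1) 0 -> E (x - 1) 0 /\ E (x + 1 + 1) 0.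
  have go y u : u ^+ 2 + 0 ^+ 2 = 1 -> E y 0 -> E (y + u) 0 -> E (y - u) 0.
    move=> n f f'; have := prolong (b := 0) (v := 0) g n (nt _ _ _ _ f n) f.
    rewrite addr0 => /(_ f') an; have := an 1 0; rewrite u1.
    have e : frame y 0 u 0 E 1 0 by move: f'; rewrite /frame /turn /shift; congr (E _ _); ring.
    by move=> /(_ e erefl); rewrite /frame /turn /shift; congr (E _ _); ring.
  move=> f f'; split; first exact: go u1 f f'.
  by have := go (x + 1) (- 1) (unit_opp R) f'; rewrite opprK addrK; apply.
have up n : E n%:R 0 /\ E (n%:R + 1) 0.
  elim: n => [|n [f f']]; first by rewrite add0r.
  by rewrite -natr1; split=> //; have [] := step _ f f'.
have dn n : E (- n%:R) 0 /\ E (- n%:R + 1) 0.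
  elim: n => [|n [f f']]; first by rewrite oppr0 add0r.
  by rewrite -natr1 opprD subrK; split=> //; have [] := step _ f f'.
by case=> n; [have [] := up n|have [] := dn n.+1; rewrite NegzE mulrNz].
Qed.
End ThreefoldSymmetry.

(** * Half turns about the points of a line *)

Section LineSymmetry.
Variable R : realType.
Implicit Types (F D E K : R -> R -> Prop) (x y a b u v r : R) (p q w : R * R) (t : seq (R * R)).

Definition closest F r := forall a b, F a b -> r <= a ^+ 2 + b ^+ 2.

Definition last_nearest F x y := [/\ F x y, closest F (x ^+ 2 + y ^+ 2) &
  forall a b, F a b -> a ^+ 2 + b ^+ 2 = x ^+ 2 + y ^+ 2 -> a <= x].

Lemma oppK F : opp (opp F) = F.
Proof. by apply/funext => x; apply/funext => y; rewrite /opp !opprK. Qed.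

Lemma last_nearest_exists F a b : separated F -> F a b -> exists x y, last_nearest F x y.
Proof.
move=> sF f; have [|c [d [g mn]]] := nearest sF; first by exists a, b.
have [x [y [f' n mx]]] := rightmost sF g erefl.
by exists x, y; split=> // [a' b'|a' b']; rewrite n; [exact: mn|exact: mx].
Qed.

Lemma closest_opp F r : closest F r -> closest (opp F) r.
Proof. by move=> c a b /c; rewrite !sqrrN. Qed.

(** By balance the nearest circle around [(1, 0)] has a point that is not to the right of this
    centre; its squared distance from the origin exceeds that from [(1, 0)] by at most 1. *)
Lemma closest_one F r : three_centers F -> closest F r ->
  forall a b, F a b -> r - 1 <= (a - 1) ^+ 2 + b ^+ 2.
Proof.
move=> [sF _ b1 _ _] cl a b f; have sS := separated_shift (a := 1) (b := 0) sF.
have [|c [d [g mn]]] := nearest sS.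
  by exists (a - 1), b; rewrite /shift add0r addrCA subrr addr0.
have [c' [d' [g' n' l']]] : exists c' d', [/\ shift 1 0 F c' d', c' ^+ 2 + d' ^+ 2 = c ^+ 2 + d ^+ 2 & c' <= 0].
  have [l|l] := lerP c 0; first by exists c, d.
  have [|x' [y' [f' n' l']]] := @balanced_opposite _ _ 1 0 _ _ b1 g; first by move: l; clear; lra.
  by exists x', y'; split=> //; move: l'; clear; lra.
have := mn (a - 1) b; rewrite /shift add0r addrCA subrr addr0 => /(_ f).
have := cl _ _ g'; rewrite add0r; move: n' l'; clear; lra.
Qed.

(** One of the rightmost and the leftmost nearest point is outermost, and [sym_shell] reflects it.
    Hence the leftmost cannot be further out than the rightmost, which is therefore reflected
    itself. *)
Lemma last_flip F x y : three_centers F -> last_nearest F x y -> last_nearest (opp F) x y.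
Proof.
have half G x' y' z : three_centers G -> last_nearest G x' y' -> z <= x' ->
    (forall a b, G a b -> a ^+ 2 + b ^+ 2 = x' ^+ 2 + y' ^+ 2 -> - z <= a) -> G (- x') (- y').
  move=> tG [g cl mx] zx mz; have [sG b0 b1 b2 [d0 d1 d2]] := tG.
  have cm a b : G a b -> x' ^+ 2 + y' ^+ 2 - 1 <= (a + 1) ^+ 2 + b ^+ 2.
    move=> k; have := closest_one (three_centers_opp tG) (closest_opp cl) (a := - a) (b := - b).
    rewrite /opp !opprK !sqrrN (_ : (- a - 1) ^+ 2 = (a + 1) ^+ 2); last by ring.
    exact.
  apply: (sym_shell sG b0 b1 b2 d0 d1 d2 (closest_one tG cl) cm g erefl) => a b k n.
  by have := mx _ _ k n; have := mz _ _ k n; move: zx; clear; nra.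
move=> tF lF; have tO := three_centers_opp tF; have [f cl mx] := lF; have [sF _ _ _ _] := tF.
have fo : opp F (- x) (- y) by rewrite /opp !opprK.
have [x' [y' lO]] := last_nearest_exists (separated_opp sF) fo; have [f' cl' mx'] := lO.
have en : x' ^+ 2 + y' ^+ 2 = x ^+ 2 + y ^+ 2.
  apply/eqP; rewrite eq_le; have := cl' _ _ fo; rewrite !sqrrN => ->.
  by have := cl _ _ f'; rewrite !sqrrN => ->.
have m1 a b : F a b -> a ^+ 2 + b ^+ 2 = x ^+ 2 + y ^+ 2 -> - x' <= a.
  by move=> k n; have := mx' (- a) (- b); rewrite /opp !opprK !sqrrN en => /(_ k n); clear; lra.
have m2 a b : opp F a b -> a ^+ 2 + b ^+ 2 = x' ^+ 2 + y' ^+ 2 -> - x <= a.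
  by move=> k n; have := mx _ _ k; rewrite !sqrrN -en => /(_ n); clear; lra.
have xx : x' <= x.
  rewrite leNgt; apply/negP => l; have := half _ _ _ _ tO lO (ltW l) m2; rewrite /opp !opprK => g.
  by have := mx _ _ g en; rewrite leNgt l.
have g := half _ _ _ _ tF lF xx m1; split=> [||a b k n].
- by [].
- exact: closest_opp.
have := mx' _ _ k; rewrite en => /(_ n) h'; exact: le_trans h' xx.
Qed.

(** Translation by 2 as the half turn about [(1, 0)], by [transfer], followed by the one about
    [(2, 0)], by [last_flip]. *)
Lemma last_shift F x y : three_centers F -> three_centers (shift 1 0 F) -> three_centers (shift 2 0 F) ->
  last_nearest F x y -> last_nearest (shift 2 0 F) x y.
Proof.
move=> t0 t1 t2 [f cl mx].
have s1 a b : shift 1 0 F (a - 1) b = F a b by rewrite /shift add0r addrCA subrr addr0.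
have s2 a b : shift 1 0 F (a + 1) b = shift 2 0 F a b by rewrite /shift; congr (F _ _); ring.
have [|g1 g2 g3] := @transfer _ (shift 1 0 F) (x ^+ 2 + y ^+ 2) (x - 1) y t1.
  split; first split; rewrite ?s1 ?subrK // => a b.
    by rewrite /shift add0r => /cl; rewrite [1 + a]addrC.
  by rewrite /shift add0r [1 + a]addrC => /mx h' n; have := h' n; clear; lra.
have lo : last_nearest (opp (shift 2 0 F)) x y.
  split.
  - by move: g1; rewrite /opp -s2 opprB [1 - x]addrC.
  - move=> a b; rewrite /opp -s2 => /g2; by rewrite addrK !sqrrN.
  - move=> a b; rewrite /opp -s2 => /g3; rewrite addrK !sqrrN => h' /h'; clear; lra.
by have := last_flip (three_centers_opp t2) lo; rewrite oppK.
Qed.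

Lemma shift_shift F x y a b : shift a b (shift x y F) = shift (x + a) (y + b) F.
Proof. by apply/funext => z; apply/funext => w; rewrite /shift !addrA. Qed.

Lemma shift0 F : shift 0 0 F = F.
Proof. by apply/funext => z; apply/funext => w; rewrite /shift !add0r. Qed.

Lemma last_all F x y : (forall k : int, three_centers (shift k%:~R 0 F)) -> last_nearest F x y ->
  forall k : int, last_nearest (shift (2 * k%:~R) 0 F) x y.
Proof.
have up G n : (forall k : int, three_centers (shift k%:~R 0 G)) -> last_nearest G x y ->
    last_nearest (shift (2 * n%:R) 0 G) x y.
  move=> tG; elim: n G tG => [|n IH] G tG lG; first by rewrite mulr0 shift0.
  have -> : shift (2 * n.+1%:R) 0 G = shift (2 * n%:R) 0 (shift 2 0 G).
    by rewrite shift_shift addr0 -[n.+1%:R]natr1 mulrDr mulr1 addrC.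
  apply: IH; first by move=> k; rewrite shift_shift addr0; by have := tG (2 + k); rewrite intrD.
  have t0 := tG 0; rewrite shift0 in t0.
  by apply: last_shift => //; [exact: (tG 1)|exact: (tG 2)].
move=> tF lF [n|n]; first exact: up.
have tO (k : int) : three_centers (shift k%:~R 0 (opp F)).
  have := three_centers_opp (tF (- k)); congr three_centers.
  by apply/funext => z; apply/funext => w; rewrite /opp /shift mulrNz; congr (F _ _); ring.
have t0 := tF 0; rewrite shift0 in t0.
have := up (opp F) n.+1 tO (last_flip t0 lF).
have -> : shift (2 * n.+1%:R) 0 (opp F) = opp (shift (2 * (Negz n)%:~R) 0 F).
  by apply/funext => z; apply/funext => w; rewrite /opp /shift NegzE mulrNz; congr (F _ _); ring.
move=> lO; have := last_flip (three_centers_opp (tF (2 * Negz n))) .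
by rewrite intrM oppK => /(_ _ _ lO).
Qed.

Lemma line_periodic D x y : good D -> (forall k : int, D k%:~R 0) -> D x y ->
  forall k : int, D (2 * k%:~R + x) y /\ D (2 * k%:~R - x) (- y).
Proof.
move=> gD L Dxy; have [sD bD] := gD.
(* [K] is closed under the half turns and contains the line. So removing it keeps the balance about
   the line points, and what is left has distance at least 1 from them. *)
pose K x y := forall k : int, D (2 * k%:~R + x) y /\ D (2 * k%:~R - x) (- y).
apply: contrapT => bad; pose F x y := D x y /\ ~ K x y.
have KL (n : int) : K n%:~R 0.
  move=> k; rewrite oppr0; have := L (2 * k + n); have := L (2 * k - n).
  by rewrite intrD intrD intrM mulrNz.
have KD a b : K a b -> D a b by move=> /(_ 0)[]; rewrite mulr0 add0r.
have Kflip (n : int) a b : K a b -> K (2 * n%:~R - a) (- b).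
  move=> k m; have [_ k1] := k (m + n); have [k2 _] := k (m - n); split.
    by move: k1; rewrite intrD; congr (D _ _); ring.
  by move: k2; rewrite opprK intrD mulrNz; congr (D _ _); ring.
have sF : separated F by move=> a b a' b' [f _] [f' _]; exact: sD.
have bF (n : int) : balanced0 (shift n%:~R 0 F).
  apply: (@balanced_diff _ (shift n%:~R 0 D) (shift n%:~R 0 K) (- 1) 0).
  - exact: unit_opp.
  - by lra.
  - by move=> a b /(Kflip n); rewrite /shift; congr K; ring.
  - by move=> a b; exact: KD.
  - exact: bD.
have dF (n : int) a b : F a b -> 1 <= (a - n%:~R) ^+ 2 + b ^+ 2.
  move=> [f nk]; rewrite leNgt; apply/negP => l.
  have [e1 e2] := sD _ _ _ _ f (L n) (ltac:(by rewrite subr0)).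
  by apply: nk; rewrite e1 e2; exact: KL.
have tF (n : int) : three_centers (shift n%:~R 0 F).
  split.
  - exact: separated_shift.
  - exact: bF.
  - by have := bF (n + 1); rewrite shift_shift addr0 intrD.
  - by have := bF (n - 1); rewrite shift_shift addr0 intrD.
  split=> a b; rewrite /shift add0r.
  - by move=> /(dF n); rewrite (_ : n%:~R + a - n%:~R = a) //; ring.
  - by move=> /(dF (n + 1)); rewrite intrD (_ : n%:~R + a - (n%:~R + 1%:~R) = a - 1) //; ring.
  - by move=> /(dF (n - 1)); rewrite intrD (_ : n%:~R + a - (n%:~R + (-1)%:~R) = a + 1) //; ring.
have [x1 [y1 lF]] := last_nearest_exists sF (conj Dxy bad); have [[_ nk] _ _] := lF.
apply: nk => k; have lk := last_all tF lF k.
have tk := tF (2 * k); rewrite intrM in tk.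
have [[f _] _ _] := lk; have [[g _] _ _] := last_flip tk lk.
by split; [move: f; rewrite add0r|move: g; rewrite add0r].
Qed.
End LineSymmetry.

(** * The first row above a line *)

Section SecondRow.
Variable R : realType.
Implicit Types (F D E K : R -> R -> Prop) (x y a b u v r : R) (p q w : R * R) (t : seq (R * R)).

(** The limiting case is r = 1, where the unit chord from abscissa - 1 ends at - 1/2. *)
Lemma outer_chord (x y x' y' r : R) : 1 < r -> x ^+ 2 + y ^+ 2 = r -> x' ^+ 2 + y' ^+ 2 = r ->
  0 <= y -> 0 <= y' -> 1 <= (x - x') ^+ 2 + (y - y') ^+ 2 -> - 1 <= x -> x < x' -> - (1 / 2) < x'.
Proof.
move=> r1 n n' y0 y0' k x1 l; rewrite ltNge; apply/negP => x2.
have [l1 l2] := upper_chord n n' y0 y0' k.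
move: r1 x1 l x2 l1 l2; rewrite -[x]opprK -[x']opprK; move: (- x) (- x') => u v; clear => r1 u1 uv v1 l1 l2.
have {}u1 : u <= 1 by lra.
have {}v1 : 1 / 2 <= v by lra.
have {}uv : v < u by lra.
have [a ua] : exists a, u = 1 - a by exists (1 - u); ring.
have [b vb] : exists b, v = 1 / 2 + b by exists (v - 1 / 2); ring.
have a0 : 0 <= a by move: u1 ua; clear; lra.
have b0 : 0 <= b by move: v1 vb; clear; lra.
have ab : a + b < 1 / 2 by move: uv ua vb; clear; lra.
have ep : u * v = 1 / 2 + b - a / 2 - a * b by rewrite ua vb; field.
have ed : (u - v) ^+ 2 = (1 / 2 - a - b) ^+ 2 by rewrite ua vb; congr (_ ^+ 2); field.
rewrite mulrNN ep in l1 l2; have es : (- u - - v) ^+ 2 = (u - v) ^+ 2 by ring.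
rewrite es ed in l2; clear es.
clear ep ed ua vb u1 v1 uv.
have d1 : (1 / 2 - a - b) ^+ 2 <= 1 / 4 by move: a0 b0 ab; clear; nra.
have [c|c] := lerP b (a / 2 + a * b).
  have ba : b <= a by move: c a0 b0 ab; clear; nra.
  have k : a ^+ 2 + b ^+ 2 + a * b <= 3 / 4 * a by move: ba a0 b0 ab; clear; nra.
  have : 1 - (1 / 2 - a - b) ^+ 2 < 1 / 2 + b - a / 2 - a * b + 1 / 4 by move: r1 d1 l2; clear; nra.
  by move: k a0; clear; lra.
have b1 : 0 < b by move: c a0 b0; clear; nra.
have k : (1 + b - a / 2 - a * b) * (1 - (1 / 2 - a - b) ^+ 2) <= 1 / 2 + b - a / 2 - a * b + 1 / 4.
  by move: l1 l2 d1; clear; nra.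
have k2 : 1 / 4 <= (1 / 2 - a - b) ^+ 2 * (1 + b).
  have : 0 <= (1 / 2 - a - b) ^+ 2 * (a / 2 + a * b).
    by apply: mulr_ge0 (sqr_ge0 _) _; move: a0 b0; clear; nra.
  by move: k; clear; lra.
have k3 : (1 / 2 - a - b) ^+ 2 <= (1 / 2 - b) ^+ 2 by move: a0 b0 ab; clear; nra.
by move: k2 k3 b1 ab a0; clear; nra.
Qed.

(** For r = 1 the arc over [- 1/2, 1/2] spans exactly 60 degrees. *)
Lemma inner_chord (x y x' y' r : R) : 1 < r -> x ^+ 2 + y ^+ 2 = r -> x' ^+ 2 + y' ^+ 2 = r ->
  0 <= y -> 0 <= y' -> 1 <= (x - x') ^+ 2 + (y - y') ^+ 2 -> - (1 / 2) < x -> x' < 1 / 2 -> x < x' -> False.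
Proof.
move=> r1 n n' y0 y0' k x1 x2 l; have [_ l2] := upper_chord n n' y0 y0' k.
have d1 : (x - x') ^+ 2 < 1 by move: x1 x2 l; clear; nra.
have k2 : 1 - (x - x') ^+ 2 < x * x' + 1 / 4 by move: r1 d1 l2; clear; nra.
have [a1 a2] : x ^+ 2 < 1 / 4 /\ x' ^+ 2 < 1 / 4 by move: x1 x2 l; clear; split; nra.
have : - (x * x') <= 1 / 4 by move: x1 x2 l a1 a2; clear; nra.
by move: k2 a1 a2; clear; lra.
Qed.

(** By [outer_chord] from both sides the second and third of four points would contradict
    [inner_chord]. *)
Lemma four_tops F r t : separated F -> 1 < r -> upper F r t -> (forall p, p \in t -> - 1 <= p.1 /\ p.1 <= 1) ->
  (size t <= 3)%N.
Proof.
move=> sF r1 [so ut] w.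
have P x y : (x, y) \in t -> [/\ F x y, x ^+ 2 + y ^+ 2 = r & 0 <= y] by move=> /ut[f n /ltW].
case: t so P w {ut} => [|[x1 y1] [|[x2 y2] [|[x3 y3] [|[x4 y4] t]]]] //= so P w; exfalso.
have m1 : (x1, y1) \in [:: (x1, y1), (x2, y2), (x3, y3), (x4, y4) & t] by rewrite !inE eqxx.
have m2 : (x2, y2) \in [:: (x1, y1), (x2, y2), (x3, y3), (x4, y4) & t] by rewrite !inE eqxx ?orbT.
have m3 : (x3, y3) \in [:: (x1, y1), (x2, y2), (x3, y3), (x4, y4) & t] by rewrite !inE eqxx ?orbT.
have m4 : (x4, y4) \in [:: (x1, y1), (x2, y2), (x3, y3), (x4, y4) & t] by rewrite !inE eqxx ?orbT.
case/and4P: so => l1 l2 l3 _.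
have [f1 n1 p1] := P _ _ m1; have [f2 n2 p2] := P _ _ m2; have [f3 n3 p3] := P _ _ m3; have [f4 n4 p4] := P _ _ m4.
have d12 := separated_ge sF f1 f2 (negbT (lt_eqF l1)).
have d23 := separated_ge sF f2 f3 (negbT (lt_eqF l2)).
have d34 := separated_ge sF f3 f4 (negbT (lt_eqF l3)).
have [b1 _] := w _ m1; have [_ b4] := w _ m4.
have h2 := outer_chord r1 n1 n2 p1 p2 d12 b1 l1.
have h3 : - (1 / 2) < - x3.
  apply: (@outer_chord (- x4) y4 (- x3) y3 r) => //; rewrite ?sqrrN ?lerN2 ?ltrN2 //.
  by move: d34; clear; nra.
by apply: (inner_chord r1 n2 n3 p2 p3 d23 h2 _ l2); move: h3; clear; lra.
Qed.

(** The middle abscissa is at most 1/10 in absolute value and the outer ones are at least 16/10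
    apart, so translation by - 2 brings the right point close to the left one. Periodicity will then
    identify them. *)
Lemma wrapped_tops (a ya b yb c yc r : R) : 1 < r -> a ^+ 2 + ya ^+ 2 = r -> b ^+ 2 + yb ^+ 2 = r ->
  c ^+ 2 + yc ^+ 2 = r -> 0 <= ya -> 0 <= yb -> 0 <= yc -> a < b -> b < c -> - 1 <= a -> c <= 1 ->
  a + b + c = 0 -> 1 <= (a - b) ^+ 2 + (ya - yb) ^+ 2 -> 1 <= (b - c) ^+ 2 + (yb - yc) ^+ 2 ->
  (c - 2 - a) ^+ 2 + (yc - ya) ^+ 2 < 1.
Proof.
have main (z w r' : R) : 1 < r' -> 0 <= z -> z < w -> z + w <= 1 -> r' * (1 - (w - z) ^+ 2) <= z * w + 1 / 4 ->
    z <= 1 / 10 /\ 8 / 10 <= w.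
  move=> r1 z0 zw zw1 l.
  have d1 : (w - z) ^+ 2 <= 1 by move: z0 zw zw1; clear; nra.
  have l' : 1 - (w - z) ^+ 2 <= z * w + 1 / 4 by move: r1 d1 l; clear; nra.
  have zb : z <= 1 / 10 by move: z0 zw zw1 l'; clear; nra.
  by split=> //; move: z0 zw zw1 l' zb; clear; nra.
move=> r1 na nb nc ya0 yb0 yc0 ab bc a1 c1 s dab dbc.
have [_ l1] := upper_chord na nb ya0 yb0 dab; have [_ l2] := upper_chord nb nc yb0 yc0 dbc.
have [k1 [k2 k3]] : 16 / 10 <= c - a /\ (- (1 / 10) <= b /\ b <= 1 / 10).
  have [b0|b0] := lerP b 0.
    have [||||z1 w1] := main (- b) (- a) r r1; first by lra.
    - by lra.
    - by lra.
    - have -> : (- a - - b) ^+ 2 = (a - b) ^+ 2 by ring.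
      by rewrite mulrNN [b * a]mulrC.
    by move: s z1 w1 b0 a1 c1; clear; split; [|split]; lra.
  have [||||z1 w1] := main b c r r1; first by lra.
  - by lra.
  - by lra.
  - have -> : (c - b) ^+ 2 = (b - c) ^+ 2 by ring.
    by [].
  by move: s z1 w1 b0 a1 c1; clear; split; [|split]; lra.
have e : (yc - ya) * (yc + ya) = (c - a) * b.
  have -> : b = - (a + c) by move: s; clear; lra.
  by move: na nc; clear; nra.
have q : (yc - ya) ^+ 2 <= 2 / 10.
  have le : - (2 / 10) <= (c - a) * b /\ (c - a) * b <= 2 / 10 by move: k1 k2 k3 a1 c1; clear; split; nra.
  rewrite -e in le; case: le => le1 le2.
  by have [l|l] := lerP ya yc; move: le1 le2 l ya0 yc0; clear; nra.
by move: q k1 a1 c1; clear; nra.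
Qed.

(* [D] seen from a point of the first row above the line of integer points; the line is at
   height [- e] and no other point lies less than [2 e] below. *)
Definition first_row D (s e : R) : Prop := [/\ good D, D 0 0, 0 < e,
  forall k : int, D (k%:~R + s) (- e) &
  [/\ forall x y, D x y -> D (x + 2) y, forall x y, D x y -> D (x - 2) y,
  forall x y, D x y -> - (2 * e) < y -> y < 0 -> y = - e &
  forall x y, D x y -> x ^+ 2 + y ^+ 2 <> 1]].

Lemma second_row D (s e q : R) : first_row D s e -> 0 < q -> D 1 q ->
  (q ^+ 2 < 1 / 4 /\ 1 < e ^+ 2 + 2 * e * q) \/
  [/\ q ^+ 2 = 1 / 3, e ^+ 2 = 4 / 3, forall x, D x (- e) -> x ^+ 2 <> 8 / 3 & ~ D 0 e] -> False.
Proof.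
move=> [gD D0 e0 L [p1 p2 gap nu]] q0 Q hyp; have [sD bD] := gD.
have q3 : q ^+ 2 <= 1 / 3 by case: hyp => [[l _]|[-> _ _ _]]; lra.
have eq1 : 1 < e ^+ 2 + 2 * e * q by case: hyp => [[_ l]//|[_ -> _ _]]; move: e0 q0; clear; nra.
have q1 : q < 1 by move: q3 q0; clear; nra.
have Dp : D 2 0 by have := p1 _ _ D0; rewrite add0r.
have Q2 : D 3 q by have := p1 _ _ Q; congr (D _ _); ring.
have Qm : D (- 1) q by have := p2 _ _ Q; congr (D _ _); ring.
set r := 1 + q ^+ 2.
have side x y : D (1 + x) (q + y) -> x ^+ 2 + y ^+ 2 = r -> 0 <= x -> x = 1 /\ y = - q \/ 2 * x <= 1 + 2 * q ^+ 2 + 2 * q * y.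
  move=> f n x0; have [l|l] := lerP 1 ((1 + x - 2) ^+ 2 + (q + y - 0) ^+ 2).
    by right; move: l n; rewrite /r; clear; nra.
  by left; have [e1 e2] := sD _ _ _ _ f Dp l; move: e1 e2; clear; lra.
have side' x y : D (1 + x) (q + y) -> x ^+ 2 + y ^+ 2 = r -> x <= 0 -> x = - 1 /\ y = - q \/ - 2 * x <= 1 + 2 * q ^+ 2 + 2 * q * y.
  move=> f n x0; have [l|l] := lerP 1 ((1 + x - 0) ^+ 2 + (q + y - 0) ^+ 2).
    by right; move: l n; rewrite /r; clear; nra.
  by left; have [e1 e2] := sD _ _ _ _ f D0 l; move: e1 e2; clear; lra.
have below x y : D (1 + x) (q + y) -> x ^+ 2 + y ^+ 2 = r -> y < 0 -> (x = 1 \/ x = - 1) /\ y = - q.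
  move=> f n y0; have hq : - q <= y.
    rewrite leNgt; apply/negP => l.
    have ye : q + y <= - e.
      rewrite leNgt; apply/negP => l'; have := gap _ _ f.
      have -> : - (2 * e) < q + y by move: l' e0; clear; lra.
      have -> : q + y < 0 by move: l; clear; lra.
      by move=> /(_ isT isT) ee; rewrite ee ltxx in l'.
    have : (e + q) ^+ 2 <= r by move: n ye (sqr_ge0 x) e0 q0; clear; nra.
    by move: eq1; rewrite /r; clear; lra.
  have nope : 4 * x ^+ 2 <= (1 + 2 * q ^+ 2) ^+ 2 -> False.
    move=> l; have : x ^+ 2 < 1 by move: l q3 (sqr_ge0 q); clear; nra.
    by move: n hq y0; rewrite /r; clear; nra.
  have qy : 2 * q * y <= 0 by move: q0 y0; clear; nra.
  have [x0|/ltW x0] := lerP 0 x.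
    have [[-> ->]|l] := side _ _ f n x0; first by split=> //; left.
    by exfalso; apply: nope; move: l x0 qy; clear; nra.
  have [[-> ->]|l] := side' _ _ f n x0; first by split=> //; right.
  by exfalso; apply: nope; move: l x0 qy; clear; nra.
have axis x : D (1 + x) (q + 0) -> x ^+ 2 = r -> False.
  move=> f n; rewrite addr0 in f.
  have rb : 1 < r /\ r <= 4 / 3 by rewrite /r; move: q3 q0; clear; split; nra.
  have [x0|/ltW x0] := lerP 0 x.
    have xb : 1 < x /\ x < 2 by move: rb n x0; clear; split; nra.
    have [] := sD _ _ _ _ f Q2; first by rewrite subrr; move: xb; clear; nra.
    by move: xb; clear; lra.
  have xb : - 2 < x /\ x < - 1 by move: rb n x0; clear; split; nra.
  have [] := sD _ _ _ _ f Qm; first by rewrite subrr; move: xb; clear; nra.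
  by move: xb; clear; lra.
have above x y : D (1 + x) (q + y) -> x ^+ 2 + y ^+ 2 = r -> 0 < y -> 2 / 3 * q < y.
  move=> f n y0; rewrite ltNge; apply/negP => l.
  have big : 2 <= 1 + 2 * q ^+ 2 + 2 * q * y /\ 4 * x ^+ 2 <= (1 + 2 * q ^+ 2 + 2 * q * y) ^+ 2 -> False.
    move=> [k1 k2]; case: hyp => [[q4 _]|[q4 _ _ _]].
      by move: k1 l q0 y0 q4; clear; nra.
    have yq : q * y <= 2 / 9 by move: l q0 q4; clear; nra.
    have y2 : y ^+ 2 <= 4 / 27 by move: l q0 q4 y0; clear; nra.
    by move: k1 k2 yq y2 n; rewrite /r q4; clear; nra.
  have x1 : 1 < x ^+ 2 by move: n l y0 q0; rewrite /r; clear; nra.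
  have nq : y = - q -> False by move: y0 q0; clear; lra.
  apply: big; have [x0|/ltW x0] := lerP 0 x.
    have [[_ /nq//]|k] := side _ _ f n x0.
    by split; move: k x0 x1; clear; nra.
  have [[_ /nq//]|k] := side' _ _ f n x0.
  by split; move: k x0 x1; clear; nra.
have bQ : balanced0 (shift 1 q D) := bD _ _ Q.
have [t [t' [z [[ut ut' hz e1 e2] _]]]] := balanced_split r bQ.
have z0 : z = [::].
  by case: z hz {e1} => // x z hz; have [f n] := iffLR (hz x) (mem_head _ _); case: (axis x f n).
have te : perm_eq t' [:: (- 1, q); (1, q)].
  apply: uniq_perm; first exact: upper_uniq ut'.
    by rewrite /= inE andbT xpair_eqE eqxx andbT lt_eqF //; clear; lra.
  move=> [x y]; apply/idP/idP.
    move=> /(ut'.2)[f n y0]; rewrite !inE !xpair_eqE.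
    have [] := below x (- y) f; rewrite ?sqrrN ?oppr_lt0 //.
    by case=> -> /oppr_inj ->; rewrite !eqxx ?orbT.
  rewrite !inE !xpair_eqE => /orP[]/andP[/eqP-> /eqP->]; apply/ut'.2; split=> //.
  - by rewrite /mirror /shift !subrr.
  - by rewrite /r; ring.
  - by rewrite /mirror /shift subrr.
  - by rewrite /r; ring.
rewrite z0 big_nil addr0 in e1; rewrite !(perm_big _ te) !big_cons !big_nil /= in e1 e2.
have {}e1 : \sum_(p <- t) p.1 = 0 by move: e1; clear; lra.
have {}e2 : \sum_(p <- t) p.2 = 2 * q by move: e2; clear; lra.
have T p : p \in t -> [/\ D (1 + p.1) (q + p.2), p.1 ^+ 2 + p.2 ^+ 2 = r & 2 / 3 * q < p.2].
  by case: p => x y /(ut.2)[f n y0]; split=> //; exact: above n y0.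
have ut0 := upper_uniq ut.
case: t T e1 e2 ut0 {ut} => [|[x1 y1] [|[x2 y2] [|[x3 y3] t]]] T; rewrite ?big_cons ?big_nil ?addr0 /= => e1 e2 ut0.
- by move: e2 q0; clear; lra.
- have [f n _] := T _ (mem_head _ _); rewrite /= e1 e2 ?addr0 in f n.
  case: hyp => [[q4 _]|[q4 e4 noL _]]; first by move: n q4; rewrite /r; clear; lra.
  have nT : 1 ^+ 2 + (q + 2 * q) ^+ 2 = 4 by rewrite (_ : (q + 2 * q) ^+ 2 = 9 * q ^+ 2); [rewrite q4; field|ring].
  have [|x' [y' [f' n' l']]] := @balanced_opposite _ _ 0 1 _ _ (balanced_origin gD D0) f; first by move: q0; clear; lra.
  rewrite nT in n'; have y0 : y' < 0 by move: l'; clear; lra.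
  have [l|l] := ltrP (- (2 * e)) y'.
    have ye := gap _ _ f' l y0; rewrite ye in f' n'.
    by apply: (noL _ f'); move: n' e4; rewrite sqrrN; clear; lra.
  by move: n' l e4 e0 (sqr_ge0 x'); clear; nra.
- have [f1 n1 l1] := T _ (mem_head _ _).
  have [f2 n2 l2] := T (x2, y2) (ltac:(by rewrite !inE eqxx orbT)).
  rewrite /= in f1 n1 l1 f2 n2 l2.
  have x21 : x2 = - x1 by move: e1; clear; lra.
  have yy : y1 = y2.
    have : (y1 - y2) * (y1 + y2) = 0 by move: n1 n2; rewrite x21; clear; lra.
    by move/eqP; rewrite mulf_eq0 => /orP[/eqP|/eqP]; move: l1 l2 q0; clear; lra.
  have y1q : y1 = q by move: e2; rewrite -yy; clear; lra.
  have x11 : x1 ^+ 2 = 1 by move: n1; rewrite y1q /r; clear; lra.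
  have f : D 0 (2 * q).
    rewrite -yy y1q x21 in f2; rewrite y1q in f1; move/eqP: x11; rewrite sqrf_eq1 => /orP[]/eqP x1e.
      by move: f2; rewrite x1e; congr (D _ _); ring.
    by move: f1; rewrite x1e; congr (D _ _); ring.
  case: hyp => [[q4 _]|[q4 e4 _ nD]].
    by have [] := sD _ _ _ _ f D0; [move: q4; clear; lra|move: q0; clear; lra].
  apply: nD; have <- : 2 * q = e by move: q4 e4 q0 e0; clear; nra.
  by [].
have [_ _ l1] := T _ (mem_head _ _).
have [_ _ l2] := T (x2, y2) (ltac:(by rewrite !inE eqxx orbT)).
have [_ _ l3] := T (x3, y3) (ltac:(by rewrite !inE eqxx !orbT)).
have : 0 <= \sum_(p <- t) p.2.
  rewrite big_seq; apply: sumr_ge0 => p pt; have [_ _ l] := T p (ltac:(by rewrite !inE pt !orbT)).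
  by move: l q0; clear; lra.
by rewrite /= in l1 l2 l3; move: e2 l1 l2 l3 q0; clear; lra.
Qed.
End SecondRow.

(** * Half turns about the points of the first row *)

Section FirstRow.
Variable R : realType.
Implicit Types (F D E K : R -> R -> Prop) (x y a b u v r : R) (p q w : R * R) (t : seq (R * R)).

Lemma round (z : R) : exists k : int, - (1 / 2) <= z - k%:~R /\ z - k%:~R <= 1 / 2.
Proof.
exists (Num.floor (z + 1 / 2)); have := floor_itv (z + 1 / 2).
by rewrite intrD => /andP[]; split; lra.
Qed.

Lemma intr_third (m : int) : (m%:~R : R) ^+ 2 <> 8 / 3.
Proof.
move=> e; have {}e : (3 * m ^+ 2)%:~R = 8%:~R :> R by rewrite intrM rmorphXn /= e; field.
by move/intr_inj: e; rewrite expr2; nia.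
Qed.

(** Translation by - 2 brings the right point within distance less than 1 of the left one, so it is
    the left one. *)
Lemma three_wrap F r x1 y1 x2 y2 x3 y3 : separated F -> (forall x y, F x y -> F (x - 2) y) ->
  2 <= r -> window F r -> upper F r [:: (x1, y1); (x2, y2); (x3, y3)] -> x1 = - 1 /\ x3 = 1.
Proof.
move=> sF per r2 w ut; have r1 : 1 <= r by move: r2; clear; lra.
have [_ _ c1 c2 [a1 a2]] := three_tops sF r1 w ut.
have [f1 n1 p1] : [/\ F x1 y1, x1 ^+ 2 + y1 ^+ 2 = r & 0 < y1] by apply/(ut.2); rewrite !inE eqxx.
have [f3 n3 p3] : [/\ F x3 y3, x3 ^+ 2 + y3 ^+ 2 = r & 0 < y3] by apply/(ut.2); rewrite !inE eqxx ?orbT.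
have b1 : 1 <= y1 by move: n1 a1 a2 r2 p1; clear; nra.
have b3 : 1 <= y3 by move: n3 c1 c2 r2 p3; clear; nra.
have e : (y3 - y1) * (y3 + y1) = x1 ^+ 2 - x3 ^+ 2 by move: n1 n3; clear; lra.
have q : - (1 / 2) <= x1 ^+ 2 - x3 ^+ 2 /\ x1 ^+ 2 - x3 ^+ 2 <= 1 / 2 by move: a1 a2 c1 c2; clear; split; nra.
rewrite -e in q; case: q => q1 q2.
have d : (y3 - y1) ^+ 2 <= 1 / 4 by have [l|l] := lerP y1 y3; move: l q1 q2 b1 b3; clear; nra.
have [] := sF _ _ _ _ (per _ _ f3) f1; first by move: d a1 a2 c1 c2; clear; nra.
by move: a1 c2; clear; lra.
Qed.

(** Two points above and [(u, - e)] below form a regular triangle, whence d^2 = 3 e^2. Wrapping by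
    the period identifies the upper two, which fixes all values, or requires distance at least 1,
    for which there is no room. *)
Lemma two_tops (x1 y1 x2 y2 u e r : R) : 1 < r -> 3 / 4 <= e ^+ 2 -> 0 < e ->
  x1 ^+ 2 + y1 ^+ 2 = r -> x2 ^+ 2 + y2 ^+ 2 = r -> u ^+ 2 + e ^+ 2 = r ->
  0 < y1 -> 0 < y2 -> x1 < x2 -> - 1 <= x1 -> x2 <= 1 -> x1 + x2 + u = 0 -> y1 + y2 = e ->
  ((x2 - 2 - x1) ^+ 2 + (y2 - y1) ^+ 2 < 1 -> x2 - 2 = x1 /\ y2 = y1) ->
  [/\ u = 0, x2 = 1, y2 ^+ 2 = 1 / 3 & e ^+ 2 = 4 / 3].
Proof.
move=> r1 e2 e0 n1 n2 nu p1 p2 l b1 b2 sx sy wrap.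
have r0 : r != 0 by rewrite gt_eqF //; move: r1; clear; lra.
pose d := x2 - x1; pose f := y2 - y1.
have pe : f * e = u * d.
  by rewrite /f /d -sy (_ : u = - (x1 + x2)); [move: n1 n2; clear; lra|move: sx; clear; lra].
have nn : d ^+ 2 + f ^+ 2 = 3 * r.
  have : (x1 + x2) ^+ 2 + (y1 + y2) ^+ 2 = r.
    by rewrite sy -nu; congr (_ + _); rewrite (_ : x1 + x2 = - u) ?sqrrN //; move: sx; clear; lra.
  by rewrite /d /f; move: n1 n2; clear; lra.
have d2 : d ^+ 2 = 3 * e ^+ 2.
  apply: (mulfI r0); have -> : r * d ^+ 2 = (u * d) ^+ 2 + e ^+ 2 * d ^+ 2 by rewrite -nu; ring.
  have -> : r * (3 * e ^+ 2) = e ^+ 2 * (d ^+ 2 + f ^+ 2) by rewrite nn; ring.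
  by rewrite -pe; ring.
have d0 : 0 < d by rewrite /d subr_gt0.
have du : d + u <= 2 /\ d - u <= 2 by rewrite /d; move: b1 b2 sx; clear; split; lra.
have eqw : (x2 - 2 - x1) ^+ 2 + (y2 - y1) ^+ 2 = 4 - 4 * d + 3 * r by rewrite -nn /d /f; ring.
have [k|k] := ltrP ((x2 - 2 - x1) ^+ 2 + (y2 - y1) ^+ 2) 1.
  have [g1 g2] := wrap k.
  have d2' : d = 2 by rewrite /d -g1; ring.
  have u0 : u = 0 by move: du; rewrite d2'; clear; case; lra.
  have x2e : x2 = 1 by move: b1 b2 g1; clear; lra.
  have e43 : e ^+ 2 = 4 / 3 by move: d2; rewrite d2'; clear; lra.
  split=> //; have -> : y2 = e / 2 by move: sy g2; clear; lra.
  by rewrite expr_div_n e43; field.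
exfalso; rewrite eqw in k; case: du => du1 du2.
have d3 : 3 / 2 <= d by move: d2 e2 d0; clear; nra.
have u2 : u ^+ 2 <= (2 - d) ^+ 2 by move: du1 du2; clear; nra.
have t2 : (2 - d) ^+ 2 <= 1 / 4 by move: d3 du1 du2; clear; nra.
have k2 : 1 <= (2 - d) ^+ 2 + 3 * u ^+ 2 by move: k nu d2; clear; lra.
have d4 : d <= 3 / 2.
  have l2 : d <= 2 by move: du1 du2; clear; lra.
  have t3 : 1 / 4 <= (2 - d) ^+ 2 by move: k2 u2; clear; lra.
  by move: t3 l2; clear; nra.
have de : d = 3 / 2 by move: d3 d4; clear; lra.
by rewrite de in d2 u2; move: nu d2 u2 r1; clear; lra.
Qed.

(** These are the heights of points with abscissae 1 and 0 above and 1 / 2 below; their balance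
    confines [q] between 1/4 and 1/2. *)
Lemma three_height (e q y r : R) : 1 < r -> 0 < e -> 0 <= q -> 0 <= y -> q ^+ 2 = r - 1 -> e ^+ 2 = r - 1 / 4 ->
  y ^+ 2 = r -> 2 * q + y = 2 * e -> [/\ 0 < q, q ^+ 2 < 1 / 4 & 1 < e ^+ 2 + 2 * e * q].
Proof.
move=> r1 e0 q0 y0 q2 e2 y2 s.
have qp : 0 < q by rewrite lt_neqAle q0 andbT eq_sym; apply/eqP => z; move: q2; rewrite z expr0n /=; move: r1; clear; lra.
pose d := e - q; have ed : e = q + d by rewrite /d; ring.
have yd : y = 2 * d by move: s; rewrite /d; clear; lra.
have d0 : 0 <= d by move: y0; rewrite yd; clear; lra.
have dd : d ^+ 2 = (1 + q ^+ 2) / 4 by move: y2; rewrite yd q2; clear; lra.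
have k : 2 * q * d + d ^+ 2 = 3 / 4 by move: e2 q2; rewrite ed; clear; lra.
have qh : q ^+ 2 < 1 / 4.
  rewrite ltNge; apply/negP => l; have ql : 1 / 2 <= q by move: l qp; clear; nra.
  have dl : 5 / 16 <= d ^+ 2 by move: dd l; clear; lra.
  have dl' : 55 / 100 <= d by move: dl d0; clear; nra.
  by move: k dl dl' ql; clear; nra.
split=> //; have ql : 1 / 4 <= q.
  rewrite leNgt; apply/negP => l; have q4 : q ^+ 2 <= 1 / 16 by move: l qp; clear; nra.
  have du : d ^+ 2 <= 17 / 64 by move: dd q4; clear; lra.
  have du' : d <= 6 / 10 by move: du d0; clear; nra.
  by move: k du du' l qp d0; clear; nra.
have e1 : 3 / 4 <= e ^+ 2 by move: e2 r1; clear; lra.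
have e3 : 8 / 10 <= e by move: e1 e0; clear; nra.
by move: e1 e3 ql; clear; nra.
Qed.

(** On the circle of the nearest points without mirror image, period 2 bounds the abscissae by 1.
    For r >= 2 [window_cases] applies, and wrapping settles the triples. For r < 2 all points below
    the origin lie on the line, at most two of them; each number of points above fails by
    arithmetic, yields an antipodal pair or leads to [second_row]. *)
Lemma first_row_symmetric D s e x y : first_row D s e -> D x y -> D (- x) (- y).
Proof.
move=> fr Dxy; have [gD D0 e0 L [p1 p2 gap nu]] := fr; have [sD bD] := gD.
have e34 : 3 / 4 <= e ^+ 2.
  have [k [k1 k2]] := round (- s); have : 1 <= (k%:~R + s - 0) ^+ 2 + (- e - 0) ^+ 2.
    rewrite leNgt; apply/negP => l; have [_ ez] := sD _ _ _ _ (L k) D0 l.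
    by move: e0 ez; clear; lra.
  by move: k1 k2; clear; nra.
have row z : D z (- e) -> exists k : int, z = k%:~R + s.
  move=> f; have [k [k1 k2]] := round (z - s); exists k.
  by have [] := sD _ _ _ _ f (L k); first by rewrite subrr; move: k1 k2; clear; nra.
apply: contrapT => bad.
pose K x y := D x y /\ D (- x) (- y); pose F x y := D x y /\ ~ K x y.
have noF a b : F a b -> ~ D (- a) (- b) by move=> [f k] g; apply: k.
have sF : separated F by move=> a b a' b' [f _] [f' _]; exact: sD.
have bF : balanced0 F.
  apply: (@balanced_diff _ D K (- 1) 0); [exact: unit_opp|lra| |by move=> a b []|exact: balanced_origin].
  move=> a b [f g]; have -> : - 1 * a - 0 * b = - a by ring.
  have -> : 0 * a + - 1 * b = - b by ring.
  by split; rewrite ?opprK.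
have q1 a b : F a b -> F (a + 2) b.
  move=> [f k]; split; first exact: p1.
  by move=> [_ /p1 g]; apply: k; split=> //; move: g; congr (D _ _); ring.
have q2 a b : F a b -> F (a - 2) b.
  move=> [f k]; split; first exact: p2.
  by move=> [_ /p2 g]; apply: k; split=> //; move: g; congr (D _ _); ring.
have f0 : F x y by split=> // -[_].
have [|fx [fy [ff mn]]] := nearest sF; first by exists x, y.
set r := fx ^+ 2 + fy ^+ 2 in mn.
have F0 : ~ F 0 0 by move=> /noF; rewrite oppr0.
have r1 : 1 < r.
  have [g _] := ff; rewrite lt_neqAle; apply/andP; split; first by apply/eqP => /esym; exact: (nu _ _ g).
  rewrite leNgt; apply/negP => l.
  have [|ex ey] := sD _ _ _ _ g D0; first by rewrite !subr0.
  by apply: F0; rewrite -{1}ex -ey.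
have w1 a b : F a b -> a ^+ 2 + b ^+ 2 = r -> - 1 <= a /\ a <= 1.
  move=> f n; have := mn _ _ (q1 _ _ f); have := mn _ _ (q2 _ _ f).
  by move: n; clear; split; lra.
have [r2|r2] := lerP 2 r.
  have w : window F r by move=> a b f n; have [l l'] := w1 _ _ f n; move: l l' r2; clear; split; nra.
  have rr : 1 <= r := ltW r1.
  have [an|[x1 [y1 [x2 [y2 [x3 [y3 [u1 [v1 [u2 [v2 [u3 [v3 [ut ut' _ _]]]]]]]]]]]]]] := window_cases sF bF rr w.
    by have [g _] := an _ _ ff erefl; apply: noF ff g.
  have [_ e3] := three_wrap sF q2 r2 w ut.
  have q2' a b : mirror F a b -> mirror F (a - 2) b by exact: q2.
  have [e1 _] := three_wrap (separated_mirror sF) q2' r2 (window_mirror w) ut'.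
  have [f3 n3 p3] : [/\ F x3 y3, x3 ^+ 2 + y3 ^+ 2 = r & 0 < y3] by apply/(ut.2); rewrite !inE eqxx ?orbT.
  have [f1 n1 p3'] : [/\ mirror F u1 v1, u1 ^+ 2 + v1 ^+ 2 = r & 0 < v1] by apply/(ut'.2); rewrite !inE eqxx.
  have ev : v1 = y3 by move: n1 n3 p3 p3'; rewrite e1 e3; clear; nra.
  by rewrite /mirror e1 ev in f1; rewrite e3 in f3; have [g _] := f1; apply: noF f3 g.
have [t [t' [z [[ut ut' hz e1 e2] _]]]] := balanced_split r bF.
have z0 : z = [::].
  case: z hz {e1} => // c z hz; have [f n] := iffLR (hz c) (mem_head _ _).
  have [l l'] : - 1 <= c /\ c <= 1 by apply: (w1 _ _ f); rewrite n expr0n addr0.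
  by exfalso; move: n r1 l l'; clear; nra.
rewrite z0 big_nil addr0 in e1.
have B p : p \in t' -> [/\ F p.1 (- e), p.2 = e & p.1 ^+ 2 + e ^+ 2 = r].
  case: p => u v /(ut'.2)[f n v0]; rewrite /mirror in f.
  (* Since 4 e^2 >= 3 > r, the point is above height - 2 e, where [gap] leaves only the line. *)
  have ve : - v = - e.
    have [g _] := f; apply: (gap _ _ g); last by rewrite oppr_lt0.
    by rewrite ltrN2; move: n r2 e34 e0 v0 (sqr_ge0 u); clear; nra.
  have {}ve : v = e by rewrite -[v]opprK ve opprK.
  by rewrite ve in f n *.
have st : (size t <= 3)%N.
  by apply: (four_tops sF r1 ut) => -[a b] /(ut.2)[f n _]; exact: w1 f n.
have T p : p \in t -> [/\ F p.1 p.2, p.1 ^+ 2 + p.2 ^+ 2 = r & 0 < p.2] by case: p => a b /(ut.2).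
have near a b c d : F a b -> F c d -> (c - 2 - a) ^+ 2 + (d - b) ^+ 2 < 1 -> c - 2 = a /\ d = b.
  by move=> f /q2 f' l; exact: sF f' f l.
have r0 : 0 < r by move: r1; clear; lra.
have [so' _] := ut'; have [so _] := ut.
have inf a b : F a b -> a ^+ 2 + b ^+ 2 = r -> 0 < b -> (a, b) \in t by move=> f n b0; apply/(ut.2).
have opp4 a b c d : F a b -> F c (- d) -> c = - a -> d = b -> False.
  by move=> f [g _] ec ed; apply: noF f _; rewrite -ec -ed.
case: t' e1 e2 B so' ut' => [|[u1 v1] [|[u2 v2] [|[u3 v3] t']]] e1 e2 B so' ut'.
- have [fy0|fy0|fyz] := ltrgtP 0 fy.
  + have ft := inf _ _ ff erefl fy0; move: e2; rewrite big_nil => e2.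
    have : fy <= \sum_(p <- t) p.2 by apply: (sum_ge_one (f := snd) ft) => p /T[_ _ /ltW].
    by rewrite e2 leNgt fy0.
  + have : (fx, - fy) \in ([::] : seq (R * R)).
      by apply/(ut'.2); rewrite /mirror opprK sqrrN oppr_gt0; split.
    by rewrite in_nil.
  by have := w1 _ _ ff erefl; move: r1; rewrite /r -fyz expr0n /=; clear => r1 [l l']; nra.
- have [fu /= ve nu1] := B _ (mem_head _ _); rewrite /= in fu nu1.
  rewrite !big_cons !big_nil /= !addr0 ve in e1 e2.
  case: t st T so e1 e2 {ut inf} => [|[x1 y1] [|[x2 y2] [|[x3 y3] [|? ?]]]] // _ T so; rewrite ?big_cons ?big_nil ?addr0 /= => e1 e2.
  + by move: e2 e0; clear; lra.
  + have [/= f n y0] := T _ (mem_head _ _).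
    by apply: (opp4 _ _ _ _ f fu); [move: e1; clear; lra|].
  + have [/= f n y0] := T _ (mem_head _ _).
    have [/= f' n' y0'] := T (x2, y2) (ltac:(by rewrite !inE eqxx orbT)).
    have l12 : x1 < x2 by move: so => /= /andP[].
    have [l1 _] := w1 _ _ f n; have [_ l2] := w1 _ _ f' n'.
    have [u0 x2e q13 e43] := two_tops r1 e34 e0 n n' nu1 y0 y0' l12 l1 l2 e1 e2 (near _ _ _ _ f f').
    rewrite x2e in f'; have [g' _] := f'; have [gu _] := fu.
    apply: (second_row fr y0' g'); right; split=> //; last first.
      by have := noF _ _ fu; rewrite u0 oppr0 opprK.
    (* With [(0, - e)] on the line its points have integer abscissae. The excluded value 8/3 arises
       as 4 - e^2. *)
    move=> c /row[k ->]; rewrite u0 in gu; have [k' k'e] := row _ gu.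
    have -> : k%:~R + s = (k - k')%:~R :> R by rewrite intrB; move: k'e; clear; lra.
    exact: intr_third.
  have [/= f1 n1 p1'] := T _ (mem_head _ _).
  have [/= f2 n2 p2'] := T (x2, y2) (ltac:(by rewrite !inE eqxx orbT)).
  have [/= f3 n3 p3'] := T (x3, y3) (ltac:(by rewrite !inE eqxx !orbT)).
  have s1 : x1 + x2 + x3 + u1 = 0 by move: e1; clear; lra.
  have s2 : y1 + y2 = - y3 + e by move: e2; clear; lra.
  have n3' : x3 ^+ 2 + (- y3) ^+ 2 = r by rewrite sqrrN.
  have := four_balanced r0 n1 n2 n3' nu1 p1' (ltW p2') s1 s2.
  by move: p1' p2' p3'; clear => ? ? ?; case=> -[? [? [? ?]]]; lra.
- have [/= fu1 ve1 nu1] := B _ (mem_head _ _).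
  have [/= fu2 ve2 nu2] := B (u2, v2) (ltac:(by rewrite !inE eqxx orbT)).
  rewrite !big_cons !big_nil /= !addr0 ve1 ve2 in e1 e2.
  have l12 : u1 < u2 by move: so' => /= /andP[].
  have u21 : u1 = - u2.
    have : (u1 - u2) * (u1 + u2) = 0 by move: nu1 nu2; clear; lra.
    by move/eqP; rewrite mulf_eq0 => /orP[/eqP|/eqP]; move: l12; clear; lra.
  have ne u : u ^+ 2 + (- e) ^+ 2 = u ^+ 2 + e ^+ 2 by rewrite sqrrN.
  have [_ u2le] : - 1 <= u2 /\ u2 <= 1 by apply: (w1 _ _ fu2); rewrite ne.
  (* Twice [u2] is the distance of two line points, hence 1 or 2. If it were 2, a line point would
     lie straight below the origin, so e >= 1 and r >= 2. *)
  have u2half : u2 = 1 / 2.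
    have [g1 _] := fu1; have [g2 _] := fu2; have [k1 k1e] := row _ g1; have [k2 k2e] := row _ g2.
    have m2 : 2 * u2 = (k2 - k1)%:~R by rewrite intrB; move: k1e k2e u21; clear; lra.
    have u2p : 0 < u2 by move: l12 u21; clear; lra.
    have mp : 0 < (k2 - k1)%:~R :> R by rewrite -m2; move: u2p; clear; lra.
    have ml : (k2 - k1)%:~R <= 2%:~R :> R by rewrite -m2; move: u2le; clear; lra.
    rewrite ltr0z in mp; rewrite ler_int in ml.
    have [m1|m1] : k2 - k1 = 1 \/ k2 - k1 = 2 by move: mp ml; clear; lia.
      by move: m2; rewrite m1; clear; lra.
    have u2e : u2 = 1 by move: m2; rewrite m1; clear; lra.
    exfalso; have := L (k2 - 1); rewrite intrB (_ : k2%:~R - 1%:~R + s = 0); last by move: k2e; rewrite u2e; clear; lra.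
    move=> g; have : 1 <= (0 - 0) ^+ 2 + (- e - 0) ^+ 2.
      rewrite leNgt; apply/negP => l; have [_ ez] := sD _ _ _ _ g D0 l.
      by move: e0 ez; clear; lra.
    by move: nu2 r2; rewrite u2e; clear; lra.
  have e14 : e ^+ 2 = r - 1 / 4 by move: nu2; rewrite u2half; clear; lra.
  have {}e1 : \sum_(i <- t) i.1 = 0 by move: e1 u21; clear; lra.
  case: t st T so e1 e2 {ut inf} => [|[x1 y1] [|[x2 y2] [|[x3 y3] [|? ?]]]] // _ T so; rewrite ?big_cons ?big_nil ?addr0 /= => e1 e2.
  + by move: e2 e0; clear; lra.
  + have [/= f n y0] := T _ (mem_head _ _).
    by rewrite e1 e2 in n; move: n r2 e34; clear; lra.
  + have [/= f n y0] := T _ (mem_head _ _).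
    have [/= f' n' y0'] := T (x2, y2) (ltac:(by rewrite !inE eqxx orbT)).
    have x21 : x2 = - x1 by move: e1; clear; lra.
    have yy : y1 = y2.
      have : (y1 - y2) * (y1 + y2) = 0 by move: n n'; rewrite x21; clear; lra.
      by move/eqP; rewrite mulf_eq0 => /orP[/eqP|/eqP]; move: y0 y0'; clear; lra.
    have y1e : y1 = e by move: e2 yy; clear; lra.
    have x14 : (x1 - u2) * (x1 - u1) = 0 by rewrite u21; move: n nu2; rewrite y1e; clear; lra.
    move/eqP: x14; rewrite mulf_eq0 => /orP[]/eqP/subr0_eq xe.
      by apply: (opp4 _ _ _ _ f fu1); [rewrite xe|].
    by apply: (opp4 _ _ _ _ f fu2); [rewrite xe u21 opprK|].
  have [/= f1 n1 p1'] := T _ (mem_head _ _).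
  have [/= f2 n2 p2'] := T (x2, y2) (ltac:(by rewrite !inE eqxx orbT)).
  have [/= f3 n3 p3'] := T (x3, y3) (ltac:(by rewrite !inE eqxx !orbT)).
  have [a12 a23] : x1 < x2 /\ x2 < x3 by move: so => /= /and3P[].
  have [l1 _] := w1 _ _ f1 n1; have [_ l3] := w1 _ _ f3 n3.
  have s1 : x1 + x2 + x3 = 0 by move: e1; clear; lra.
  have d12 := separated_ge sF f1 f2 (negbT (lt_eqF a12)).
  have d23 := separated_ge sF f2 f3 (negbT (lt_eqF a23)).
  have wr := wrapped_tops r1 n1 n2 n3 (ltW p1') (ltW p2') (ltW p3') a12 a23 l1 l3 s1 d12 d23.
  have [g1 g2] := near _ _ _ _ f1 f3 wr.
  have x3e : x3 = 1 by move: g1 l1 l3; clear; lra.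
  have x2e : x2 = 0 by move: g1 s1 x3e; clear; lra.
  have q2' : y3 ^+ 2 = r - 1 by move: n3; rewrite x3e; clear; lra.
  have y2' : y2 ^+ 2 = r by move: n2; rewrite x2e; clear; lra.
  have hs : 2 * y3 + y2 = 2 * e by move: e2 g2; clear; lra.
  have [h1 h2 h3] := three_height r1 e0 (ltW p3') (ltW p2') q2' e14 y2' hs.
  rewrite x3e in f3; have [g3 _] := f3.
  by apply: (second_row fr p3' g3); left.
have [_ _ nu1] := B _ (mem_head _ _).
have [_ _ nu2] := B (u2, v2) (ltac:(by rewrite !inE eqxx orbT)).
have [_ _ nu3] := B (u3, v3) (ltac:(by rewrite !inE eqxx !orbT)).
rewrite /= in nu1 nu2 nu3; move: so' => /= /and3P[a12 a23 _].
have k1 : (u1 - u2) * (u1 + u2) = 0 by move: nu1 nu2; clear; lra.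
have k2 : (u2 - u3) * (u2 + u3) = 0 by move: nu2 nu3; clear; lra.
move/eqP: k1; rewrite mulf_eq0 => /orP[]/eqP k1; first by move: k1 a12; clear; lra.
move/eqP: k2; rewrite mulf_eq0 => /orP[]/eqP k2; first by move: k2 a23; clear; lra.
by move: k1 k2 a12 a23; clear; lra.
Qed.
End FirstRow.

(** * From the first row to all points *)

Section Rows.
Variable R : realType.
Implicit Types (F D E K : R -> R -> Prop) (x y a b u v r : R) (p q w : R * R) (t : seq (R * R)).

Definition centered D a b := forall x y, D (a + x) (b + y) -> D (a - x) (b - y).

Definition triless D := forall a b u v, D a b -> u ^+ 2 + v ^+ 2 = 1 -> ~ tri (frame a b u v D).

Lemma triless_frame D a b u v : u ^+ 2 + v ^+ 2 = 1 -> triless D -> triless (frame a b u v D).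
Proof.
move=> n tD a' b' u' v' f n'.
have -> : frame a' b' u' v' (frame a b u v D) =
    frame (a + (u * a' - v * b')) (b + (v * a' + u * b')) (u * u' - v * v') (v * u' + u * v') D.
  by apply: pred2_ext => x y; rewrite /frame /turn /shift; split; congr (D _ _); ring.
apply: tD; first exact: f.
have -> : (u * u' - v * v') ^+ 2 + (v * u' + u * v') ^+ 2 = (u ^+ 2 + v ^+ 2) * (u' ^+ 2 + v' ^+ 2) by ring.
by rewrite n n' mulr1.
Qed.

(** The unit step extends to a full line in its own frame, and [line_periodic] at [k = 0] is the
    half turn. *)
Lemma unit_centered D a b u v : good D -> triless D -> D a b -> D (a + u) (b + v) ->
  u ^+ 2 + v ^+ 2 = 1 -> centered D a b.
Proof.
move=> gD tD f f1 n; pose G := frame a b u v D.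
have gG : good G := good_frame a b n gD.
have G0 : G 0 0 by rewrite /G frame_origin.
have G1 : G 1 0 by rewrite /G /frame /turn /shift !mulr1 !mulr0 subr0 addr0.
have L := line_contained gG (triless_frame n tD) G0 G1.
have k z : z = (u ^+ 2 + v ^+ 2) * z by rewrite n mul1r.
move=> x y g.
have g' : G (u * x + v * y) (u * y - v * x).
  move: g; rewrite /G /frame /turn /shift {1}[x]k {1}[y]k; congr (D _ _); ring.
have [_] := line_periodic gG L g' 0; rewrite mulr0 sub0r /G /frame /turn /shift.
by rewrite [x in D (a - x)]k [y in D _ (b - y)]k; congr (D _ _); ring.
Qed.

(** With [e] the lowest positive height, the half turns about the origin and about a point [(px, e)]
    compose to the translation by [(2 * px, 2 * e)]. Its powers move every point into the strip of
    heights between - e and e, which contains only points at heights - e, 0 and e. *)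
Lemma even_centered D a b : good D -> triless D -> D 0 0 -> D 1 0 -> D a b -> centered D a b.
Proof.
move=> gD tD D0 D1; have [sD bD] := gD.
have L := line_contained gD tD D0 D1.
have per x y : D x y -> forall k : int, D (x + 2 * k%:~R) y.
  by move=> f k; have [g _] := line_periodic gD L f k; rewrite addrC.
have cL (k : int) : centered D k%:~R 0.
  move=> x y /(line_periodic gD L)/(_ k)[_]; congr (D _ _); ring.
have c0 x y : D x y -> D (- x) (- y).
  by move=> f; have := cL 0 x y; rewrite mulr0z !add0r; apply.
have row0 x : D x 0 -> exists k : int, x = k%:~R.
  move=> f; have [k [k1 k2]] := round x; exists k.
  by have [] := sD _ _ _ _ f (L k); first by rewrite subrr; move: k1 k2; clear; nra.
move=> Dab; have [[x0 [y0 [f0 ny]]]|flat] := pselect (exists x y, D x y /\ y <> 0); last first.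
  have b0 : b = 0 by apply: contrapT => nb; apply: flat; exists a, b.
  by rewrite b0 in Dab *; have [k ->] := row0 _ Dab.
have [x1 [y1 [f1 y1p]]] : exists x y, D x y /\ 0 < y.
  have [l|l|e] := ltrgtP 0 y0; last by case: ny.
    by exists x0, y0.
  by exists (- x0), (- y0); split; [exact: c0|rewrite oppr_gt0].
(* Period 2 along the line reduces the search for a lowest row to a bounded box. *)
pose F x y := [/\ D x y, 0 < y, y <= y1, - 1 <= x & x <= 1].
have sF : separated F by move=> x y x' y' [f _ _ _ _] [f' _ _ _ _]; exact: sD.
have bF p : F p.1 p.2 -> [/\ - (1 + y1) <= p.1, p.1 <= 1 + y1, - (1 + y1) <= p.2 & p.2 <= 1 + y1].
  by move=> [_ l1 l2 l3 l4]; move: l1 l2 l3 l4 y1p; clear; split; lra.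
have red x y : D x y -> 0 < y -> y <= y1 -> exists x', F x' y.
  move=> f l1 l2; have [k [k1 k2]] := round (x / 2); exists (x + 2 * (- k)%:~R).
  split=> //; first exact: per.
    by rewrite mulrNz; move: k1 k2; clear; lra.
  by rewrite mulrNz; move: k1 k2; clear; lra.
have [|[px e] /= [[fp e0 _ _ _] mn]] := bounded_min (fun p => p.2) sF bF.
  by have [x' f'] := red _ _ f1 y1p (lexx _); exists x', y1.
have low x y : D x y -> 0 < y -> e <= y.
  move=> f l; have [l1|/ltW l1] := lerP y y1.
    by have [x' f'] := red _ _ f l l1; have := mn (x', y) f'.
  have [x' f'] := red _ _ f1 y1p (lexx _); exact: le_trans (mn (x', y1) f') l1.
have low' x y : D x y -> - e < y -> y < e -> y = 0.
  move=> f l1 l2; have [l|l|//] := ltrgtP 0 y.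
    by have := low _ _ f l; rewrite leNgt l2.
  by have := low _ _ (c0 _ _ f); rewrite oppr_gt0 leNgt => /(_ l); rewrite ltrNl l1.
have cP x : D x e -> centered D x e.
  move=> f; have [[u [v [g n]]]|no] := pselect (exists u v, D (x + u) (e + v) /\ u ^+ 2 + v ^+ 2 = 1).
    exact: unit_centered g n.
  have fr : first_row (shift x e D) (- x) e.
    split=> //; first exact: good_shift.
    - by rewrite /shift !addr0.
    - by move=> k; rewrite /shift subrr addrC subrK.
    split=> [c d|c d|c d|c d].
    - by rewrite /shift addrA => /per /(_ 1); rewrite mulr1.
    - by rewrite /shift addrA => /per /(_ (- 1)); rewrite mulrN1.
    - rewrite /shift => g l1 l2; have := low' _ _ g.
      have -> : - e < e + d by move: l1; clear; lra.
      have -> : e + d < e by move: l2; clear; lra.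
      by move=> /(_ isT isT); clear; lra.
    - by move=> g n; apply: no; exists c, d.
  by move=> c d g; exact: (first_row_symmetric fr g).
have tr x y : D x y -> D (x + 2 * px) (y + 2 * e).
  move=> /c0 f; have := cP _ fp (- x - px) (- y - e).
  rewrite (_ : px + (- x - px) = - x); last by ring.
  rewrite (_ : e + (- y - e) = - y); last by ring.
  by move=> /(_ f); congr (D _ _); ring.
have tr' x y : D x y -> D (x - 2 * px) (y - 2 * e).
  move=> f; have := cP _ fp (x - px) (y - e).
  rewrite (_ : px + (x - px) = x); last by ring.
  rewrite (_ : e + (y - e) = y); last by ring.
  by move=> /(_ f)/c0; congr (D _ _); ring.
have trn x y (n : nat) : D x y -> D (x + n%:R * (2 * px)) (y + n%:R * (2 * e)).
  move=> f; elim: n => [|n IH]; first by rewrite !mul0r !addr0.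
  by move: (tr _ _ IH); rewrite -[n.+1%:R]natr1; congr (D _ _); ring.
have trn' x y (n : nat) : D x y -> D (x - n%:R * (2 * px)) (y - n%:R * (2 * e)).
  move=> f; elim: n => [|n IH]; first by rewrite !mul0r !subr0.
  by move: (tr' _ _ IH); rewrite -[n.+1%:R]natr1; congr (D _ _); ring.
have trz x y (n : int) : D x y -> D (x + n%:~R * (2 * px)) (y + n%:~R * (2 * e)).
  case: n => n f; first exact: trn.
  by move: (trn' _ _ n.+1 f); rewrite NegzE mulrNz; congr (D _ _); ring.
have move_center x y (n : int) : centered D (x + n%:~R * (2 * px)) (y + n%:~R * (2 * e)) -> centered D x y.
  move=> H c d f; have := H c d.
  have g := trz _ _ n f; have -> : x + n%:~R * (2 * px) + c = x + c + n%:~R * (2 * px) by ring.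
  have -> : y + n%:~R * (2 * e) + d = y + d + n%:~R * (2 * e) by ring.
  by move=> /(_ g) g'; move: (trz _ _ (- n) g'); rewrite mulrNz; congr (D _ _); ring.
have strip x y : D x y -> - e <= y -> y <= e -> centered D x y.
  move=> f l1 l2; have [ye|ne] := eqVneq y e; first by rewrite ye in f *; exact: cP.
  have [ye|ne'] := eqVneq y (- e).
    apply: (move_center _ _ 1); rewrite !mul1r ye.
    have -> : - e + 2 * e = e by ring.
    by apply: cP; move: (tr _ _ f); rewrite ye; congr (D _ _); ring.
  have y0e : y = 0 by apply: (low' _ _ f); rewrite lt_neqAle ?ne ?l1 ?l2 // eq_sym ne'.
  by rewrite y0e in f *; have [k ->] := row0 _ f.
have [k [k1 k2]] := round (b / (2 * e)).
have e2 : 0 < 2 * e by move: e0; clear; lra.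
apply: (move_center _ _ (- k)); apply: strip; first exact: trz.
  rewrite mulrNz; have -> : b = b / (2 * e) * (2 * e) by rewrite divfK // gt_eqF.
  by move: k1 e0; move: (b / _) => z; clear; nra.
rewrite mulrNz; have -> : b = b / (2 * e) * (2 * e) by rewrite divfK // gt_eqF.
by move: k2 e0; move: (b / _) => z; clear; nra.
Qed.

Theorem good_rotatable D a b : good D -> D 0 0 -> D 1 0 -> D a b -> rotatable D a b.
Proof.
move=> gD D0 D1 Dab.
have [[c [d [u [v [f n t]]]]]|no] :=
    pselect (exists c d u v, [/\ D c d, u ^+ 2 + v ^+ 2 = 1 & tri (frame c d u v D)]).
  exact: tri_frame_symmetric f n t Dab.
have tD : triless D by move=> c d u v f n t; apply: no; exists c, d, u, v.
have H := even_centered gD tD D0 D1 Dab.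
exists (- 1), 0; split; [exact: unit_opp|lra|move=> x y].
have -> : - 1 * x - 0 * y = - x by ring.
have -> : 0 * x + - 1 * y = - y by ring.
by split=> /H; rewrite ?opprK.
Qed.
End Rows.

(** * Back to the plane *)

Section Plane.
Variable R : realType.
Implicit Types (P Q X V : 'rV[R]_2) (C : set 'rV[R]_2) (x y a b c s d : R).

Definition vec x y : 'rV[R]_2 := \row_(i < 2) if i == 0 then x else y.

Lemma vec0 x y : vec x y 0 0 = x.
Proof. by rewrite mxE. Qed.

Lemma vec1 x y : vec x y 0 1 = y.
Proof. by rewrite mxE. Qed.

Lemma vec_eta Q : vec (Q 0 0) (Q 0 1) = Q.
Proof.
apply/rowP => i; rewrite mxE; case: i => [[|[|//]] i] /=; congr (Q _ _); exact: val_inj.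
Qed.

Lemma vec_inj P Q : P 0 0 = Q 0 0 -> P 0 1 = Q 0 1 -> P = Q.
Proof. by move=> e1 e2; rewrite -(vec_eta P) -(vec_eta Q) e1 e2. Qed.

Lemma distE P Q : dist P Q = Num.sqrt ((Q 0 0 - P 0 0) ^+ 2 + (Q 0 1 - P 0 1) ^+ 2).
Proof.
rewrite /dist big_ord_recl big_ord1; congr (Num.sqrt (_ + (Q _ _ - P _ _) ^+ 2)); exact: val_inj.
Qed.

Lemma dist_sq P Q : dist P Q ^+ 2 = (Q 0 0 - P 0 0) ^+ 2 + (Q 0 1 - P 0 1) ^+ 2.
Proof. by rewrite distE sqr_sqrtr // addr_ge0 // sqr_ge0. Qed.

Lemma dist_ge0 P Q : 0 <= dist P Q.
Proof. by rewrite distE sqrtr_ge0. Qed.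

Definition rotate P c s Q := vec (P 0 0 + (c * (Q 0 0 - P 0 0) - s * (Q 0 1 - P 0 1)))
  (P 0 1 + (s * (Q 0 0 - P 0 0) + c * (Q 0 1 - P 0 1))).

Lemma rotateK P c s : c ^+ 2 + s ^+ 2 = 1 -> cancel (rotate P c s) (rotate P c (- s)).
Proof.
move=> n Q; have k z : z = (c ^+ 2 + s ^+ 2) * z by rewrite n mul1r.
apply: vec_inj; rewrite /rotate ?vec0 ?vec1.
  by rewrite -[Q 0 0 in RHS](subrK (P 0 0)) [Q 0 0 - P 0 0 in RHS]k; ring.
by rewrite -[Q 0 1 in RHS](subrK (P 0 1)) [Q 0 1 - P 0 1 in RHS]k; ring.
Qed.

Lemma rotate_isometry P c s : c ^+ 2 + s ^+ 2 = 1 -> plane_isometry (rotate P c s).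
Proof.
move=> n; split.
  exists (rotate P c (- s)); first exact: rotateK.
  by rewrite -{2}[s]opprK; apply: rotateK; rewrite sqrrN.
move=> Q Q'; rewrite !distE /rotate !vec0 !vec1; congr Num.sqrt.
set A := Q 0 0; set A' := Q' 0 0; set B := Q 0 1; set B' := Q' 0 1.
have -> : (A' - A) ^+ 2 + (B' - B) ^+ 2 = (c ^+ 2 + s ^+ 2) * ((A' - A) ^+ 2 + (B' - B) ^+ 2) by rewrite n mul1r.
by ring.
Qed.

Lemma rotate_fix P c s Q : c ^+ 2 + s ^+ 2 = 1 -> c <> 1 -> rotate P c s Q = Q <-> Q = P.
Proof.
move=> n c1; split=> [e|->]; last first.
  by apply: vec_inj; rewrite /rotate ?vec0 ?vec1 !subrr !mulr0 ?subrr !addr0.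
have e0 := congr1 (fun M : 'rV[R]_2 => M 0 0) e; have e1 := congr1 (fun M : 'rV[R]_2 => M 0 1) e.
rewrite /rotate vec0 in e0; rewrite /rotate vec1 in e1.
set A := Q 0 0 - P 0 0 in e0 e1; set B := Q 0 1 - P 0 1 in e0 e1.
have f0 : c * A - s * B = A by move: e0; rewrite /A; clear; lra.
have f1 : s * A + c * B = B by move: e1; rewrite /B; clear; lra.
have [A0 B0] := rotation_fixed n c1 (esym f0) (esym f1).
by apply: vec_inj; apply/eqP; rewrite -subr_eq0; apply/eqP.
Qed.

(* Coordinates in the frame with origin [X] and first axis [V]. *)
Definition pt X V a b := vec (X 0 0 + (a * V 0 0 - b * V 0 1)) (X 0 1 + (a * V 0 1 + b * V 0 0)).

(** [co1] and [co2] are the real and imaginary parts of (Q - X) / V, read as complex numbers. *)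
Definition co1 X V Q := (V 0 0 * (Q 0 0 - X 0 0) + V 0 1 * (Q 0 1 - X 0 1)) / (V 0 0 ^+ 2 + V 0 1 ^+ 2).
Definition co2 X V Q := (V 0 0 * (Q 0 1 - X 0 1) - V 0 1 * (Q 0 0 - X 0 0)) / (V 0 0 ^+ 2 + V 0 1 ^+ 2).

Lemma pt_co X V Q : V 0 0 ^+ 2 + V 0 1 ^+ 2 != 0 -> pt X V (co1 X V Q) (co2 X V Q) = Q.
Proof. by move=> n; apply: vec_inj; rewrite /pt ?vec0 ?vec1 /co1 /co2; field. Qed.

Lemma co_pt X V a b : V 0 0 ^+ 2 + V 0 1 ^+ 2 != 0 ->
  co1 X V (pt X V a b) = a /\ co2 X V (pt X V a b) = b.
Proof. by move=> n; rewrite /co1 /co2 /pt !vec0 !vec1; split; field. Qed.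

Lemma dist_pt X V a b a' b' : dist (pt X V a b) (pt X V a' b') ^+ 2 =
  (V 0 0 ^+ 2 + V 0 1 ^+ 2) * ((a' - a) ^+ 2 + (b' - b) ^+ 2).
Proof. by rewrite dist_sq /pt !vec0 !vec1; ring. Qed.

Lemma rotate_pt X V a b c s x y : rotate (pt X V a b) c s (pt X V (a + x) (b + y)) =
  pt X V (a + (c * x - s * y)) (b + (s * x + c * y)).
Proof. by apply: vec_inj; rewrite /rotate /pt ?vec0 ?vec1; ring. Qed.

(** The frame scales [d] to 1, and squared radius [r] in coordinates corresponds to the distance
    [d * Num.sqrt r]. *)
Lemma good_pt C X V d : balanced C -> 0 < d -> V 0 0 ^+ 2 + V 0 1 ^+ 2 = d ^+ 2 ->
  (forall Q Q', C Q -> C Q' -> Q <> Q' -> d <= dist Q Q') -> good (fun a b => C (pt X V a b)).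
Proof.
move=> bal d0 Vd sep; have d2 : d ^+ 2 != 0 by rewrite gt_eqF // exprn_gt0.
have Vn : V 0 0 ^+ 2 + V 0 1 ^+ 2 != 0 by rewrite Vd.
split=> [a b a' b' f f' l|a b f r].
  have [e|ne] := pselect (pt X V a b = pt X V a' b').
    have [e1 e2] := co_pt X a b Vn; have [e3 e4] := co_pt X a' b' Vn.
    by split; [rewrite -e1 e e3|rewrite -e2 e e4].
  have k : d ^+ 2 <= dist (pt X V a b) (pt X V a' b') ^+ 2.
    by have := sep _ _ f f' ne; move: d0; clear; nra.
  rewrite dist_pt Vd -[leLHS]mulr1 ler_pM2l ?exprn_gt0 // leNgt in k.
  by move: k; rewrite -[(a' - a) ^+ 2]sqrrN -[(b' - b) ^+ 2]sqrrN !opprB l.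
set P := pt X V a b in f.
have [/finite_seqP[l el] sum0] := bal P f (d * Num.sqrt r).
pose g Q := (co1 X V Q - a, co2 X V Q - b).
have gpt x y : g (pt X V (a + x) (b + y)) = (x, y).
  by rewrite /g; have [-> ->] := co_pt X (a + x) (b + y) Vn; rewrite ![_ + _ - _]addrAC !subrr !add0r.
have ginj : injective g.
  move=> Q Q' [/addIr e1 /addIr e2].
  by rewrite -(pt_co X Q Vn) -(pt_co X Q' Vn) e1 e2.
pose s := undup l.
have us : uniq s by exact: undup_uniq.
have ms Q : Q \in s <-> at_distance C P (d * Num.sqrt r) Q.
  by rewrite mem_undup el.
(* For negative [r] the square root is 0 by convention, so the empty shell is treated apart. *)
have [r0|r0] := lerP 0 r; last first.
  exists [::]; split; rewrite ?big_nil //; split=> // p; split=> // -[_ n].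
  by move: n (sqr_ge0 p.1) (sqr_ge0 p.2) r0; clear; lra.
have dp x y : dist P (pt X V (a + x) (b + y)) = d * Num.sqrt r <-> x ^+ 2 + y ^+ 2 = r.
  have e : dist P (pt X V (a + x) (b + y)) ^+ 2 = d ^+ 2 * (x ^+ 2 + y ^+ 2).
    by rewrite dist_pt Vd ![_ + _ - _]addrAC !subrr !add0r.
  split=> [h|h].
    by apply: (mulfI d2); rewrite -e h exprMn sqr_sqrtr.
  apply: (@pexpIrn _ 2); rewrite ?nnegrE ?dist_ge0 ?mulr_ge0 ?sqrtr_ge0 ?ltW //.
  by rewrite e h exprMn sqr_sqrtr.
have ptg Q : Q = pt X V (a + (g Q).1) (b + (g Q).2).
  by rewrite /g /= ![_ + (_ - _)]addrC !subrK pt_co.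
have sumP : \sum_(Q <- s) (Q - P) = 0.
  have es : at_distance C P (d * Num.sqrt r) = [set` s]%classic.
    by rewrite el; apply/seteqP; split=> Q /=; rewrite mem_undup.
  by rewrite es -fsbig_seq in sum0.
have s0 : \sum_(Q <- s) (Q 0 0 - P 0 0) = 0.
  transitivity ((\sum_(Q <- s) (Q - P)) 0 0); last by rewrite sumP mxE.
  by rewrite summxE; apply: eq_bigr => Q _; rewrite !mxE.
have s1 : \sum_(Q <- s) (Q 0 1 - P 0 1) = 0.
  transitivity ((\sum_(Q <- s) (Q - P)) 0 1); last by rewrite sumP mxE.
  by rewrite summxE; apply: eq_bigr => Q _; rewrite !mxE.
have [a_ b_] := co_pt X a b Vn; rewrite -/P in a_ b_.
exists (map g s); split.
- split; first by rewrite map_inj_uniq.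
  move=> [x y]; rewrite -gpt mem_map // gpt ms /at_distance /= dp.
  by rewrite /shift.
- rewrite big_map /=.
  have E Q : co1 X V Q - a = (V 0 0 * (Q 0 0 - P 0 0) + V 0 1 * (Q 0 1 - P 0 1)) / (V 0 0 ^+ 2 + V 0 1 ^+ 2).
    by rewrite -a_ /co1; field.
  under eq_bigr do rewrite E; rewrite -mulr_suml big_split /= -!mulr_sumr s0 s1.
  by rewrite !mulr0 addr0 mul0r.
rewrite big_map /=.
have E Q : co2 X V Q - b = (V 0 0 * (Q 0 1 - P 0 1) - V 0 1 * (Q 0 0 - P 0 0)) / (V 0 0 ^+ 2 + V 0 1 ^+ 2).
  by rewrite -b_ /co2; field.
under eq_bigr do rewrite E; rewrite -mulr_suml sumrB -!mulr_sumr s0 s1.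
by rewrite !mulr0 subr0 mul0r.
Qed.
End Plane.

Theorem corollary1p1 (R : realType) (C : set 'rV[R]_2)
  (hbal : balanced C) (hmin : minimal_distance_property C) :
  group_balanced C.
Proof.
have [d [d0 sep [X [Y [CX CY dXY]]]]] := hmin; move=> P CP.
pose V := Y - X.
have Vd : V 0 0 ^+ 2 + V 0 1 ^+ 2 = d ^+ 2 by rewrite -dXY dist_sq /V !mxE.
have Vn : V 0 0 ^+ 2 + V 0 1 ^+ 2 != 0 by rewrite Vd gt_eqF // exprn_gt0.
have gD := good_pt X hbal d0 Vd sep; set D := (fun a b : R => _) in gD.
have D0 : D 0 0.
  rewrite /D (_ : pt X V 0 0 = X) //.
  by apply: vec_inj; rewrite /pt ?vec0 ?vec1; ring.
have D1 : D 1 0.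
  rewrite /D (_ : pt X V 1 0 = Y) //.
  by apply: vec_inj; rewrite /pt ?vec0 ?vec1 /V !mxE; ring.
have Dab : D (co1 X V P) (co2 X V P) by rewrite /D pt_co.
have [c [s [cs c1 rot]]] := good_rotatable gD D0 D1 Dab.
have CE Q : C Q <-> C (rotate P c s Q).
  pose x := co1 X V Q - co1 X V P; pose y := co2 X V Q - co2 X V P.
  have eP : pt X V (co1 X V P) (co2 X V P) = P by exact: pt_co.
  have eQ : pt X V (co1 X V P + x) (co2 X V P + y) = Q.
    by rewrite /x /y ![_ + (_ - _)]addrC !subrK pt_co.
  by have := rot x y; rewrite /D eQ -rotate_pt eP eQ.
exists (rotate P c s); split; last by move=> Q; exact: rotate_fix.
split; first exact: rotate_isometry.
apply/seteqP; split=> [_ [Q CQ <-]|Q CQ]; first exact: (iffLR (CE Q) CQ).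
have Q' : rotate P c s (rotate P c (- s) Q) = Q.
  have n : c ^+ 2 + (- s) ^+ 2 = 1 by rewrite sqrrN.
  by have := @rotateK _ P c (- s) n Q; rewrite opprK.
by exists (rotate P c (- s) Q) => //; apply: (iffRL (CE _)); rewrite Q'.
Qed.
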